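(* Let $f:\mathbb{R}^+\to\mathbb{R}$ be twice continuously differentiable with $f>0$, $f'>0$, $f''>0$, and assume there exist constants $c_1\geq 1/2$ and $c_2>0$ such that $c_1 f''(x)\leq f''(y)\leq c_2 f''(x)$ whenever $0<x\leq y\leq 2x$. Let $A_0\geq 2$ be such that $f'(A_0)\geq 1$. Then there exists a constant $C=C(f)$ such that for every function $\varphi:\mathbb{N}\to\mathbb{C}$ with $|\varphi(m)|\leq 1$ for all $m$, for all integers $A\geq A_0$ and for all real $z>0$, \[ \frac 1A\left|\sum_{A<n\leq 2A}\varphi\bigl(\lfloor f(n)\rfloor\bigr)-\sum_{f(A)<m\leq f(2A)}\varphi(m)\,(f^{-1})'(m)\right| \leq C\left(\frac{f''(A)}{f'(A)^2}z^2+f'(A)(\log A)^3 J(A,z)\right), \] where \[ J(A,z)=\int_0^1\sup_{f(A)<x\leq f(2A)}\frac 1z\left|\sum_{x<m\leq x+z}\varphi(m)\,e(m\theta)\right|\,d\theta . \]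
   Context: $e(x)=e^{2\pi i x}$; $\lfloor\cdot\rfloor$ is the floor function; $\mathbb{N}$ denotes the nonnegative integers; sums over $m$ or $n$ range over integers in the indicated intervals. $f^{-1}$ is the inverse function of the strictly increasing function $f$. *)

(* Defs.v *)
From Stdlib Require Import Reals List.
From Coquelicot Require Import Coquelicot.
Open Scope R_scope.

Definition e (x : R) : C := (cos (2 * PI * x), sin (2 * PI * x)).

Definition floorZ (r : R) : Z := Int_part r.

Definition sum_between (F : nat -> C) (a b : R) : C :=
  fold_right Cplus (RtoC 0)
    (map F (filter (fun m : nat =>
                      if Rlt_dec a (INR m) then
                        if Rle_dec (INR m) b then true else false
                      else false)
                   (seq 0 (S (Z.to_nat (up b)))))).

Definition J (f : R -> R) (phi : nat -> C) (A z : R) : R :=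
  RInt (fun theta =>
          real (Lub_Rbar (fun r => exists x, f A < x <= f (2 * A) /\
                  r = / z * Cmod (sum_between (fun m => Cmult (phi m) (e (INR m * theta))) x (x + z)))))
       0 1.

(* Main.v *)
Require Import Defs.
From Stdlib Require Import Reals List Lra Lia ZArith Classical Ranalysis5.
From Coquelicot Require Import Coquelicot.
Open Scope R_scope.

(** With g = f^{-1} and C(m) the ceiling of g(m), the first sum is the sum of
    phi(m) (C(m+1) - C(m)) over f(A) < m <= f(2A).  On a window (x, x+z] replace g by its tangent
    at x, of slope beta = g'(x); this changes C(m) only if the tangent comes within
    delta ~ f''(A) z^2 / f'(A)^3 of an integer.  Such m are counted by pigeonhole: two of them at
    distance d force d beta to be close to an integer.  For the tangent, ceil y - y - 1/2 is
    approximated by the Fejer mean of its Fourier series of length about 1/delta^2, which leaves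
    the sums of phi(m) e(m h beta) with weight min(1/h, beta).  Averaging over the position of the
    windows gives integrals over x; as beta is monotone with derivative of size
    f''(A) / f'(A)^3, the substitution theta = h beta(x) turns them into integrals over full
    periods, that is into J.  The condition c_1 >= 1/2 gives f'(A) << A f''(A) log A, which bounds
    the cost of an incomplete period.  Since z J dominates every |phi(m)|, the trivial estimate
    suffices if z << f'(A) (log A)^3 or f''(A) z^2 >> f'(A)^2. *)

(** Two features of [J] decide the route. Its supremum over x makes the bound for a window depend on
    the frequency h beta alone and not on the position of the window; but its integral over theta
    controls no single frequency, so beta has to move before [J] can appear. The count of
    near-integers meets the same problem and is therefore also written with a Fejer kernel, of
    length about 1/(4 delta), whose mean over a period is 1. The coefficients are bounded throughout
    by mu = min(1, z J) instead of 1, so that an error term can be charged to either summand of the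
    result. Most errors carry a small factor and go to the first one; but in every window the first
    near index costs O(1), and only mu <= z J pays for it. With n about 1/delta^2 the sawtooth error
    away from the integers is 1/(n delta) <= delta, and n enters the result only through its
    logarithm. Both halves of the weight min(1/h, beta) matter: 1/h makes the sum over complete
    periods logarithmic, and beta gains a factor 1/f'(A) on the incomplete one. *)

(** * Rounding, finite sums and sums over real intervals *)

Fixpoint rsum (F : nat -> R) (n : nat) : R :=
  match n with O => 0 | S k => rsum F k + F k end.

Fixpoint csum (F : nat -> C) (n : nat) : C :=
  match n with O => RtoC 0 | S k => Cplus (csum F k) (F k) end.

(** Convertible to the [Z.to_nat (floorZ r)] of the theorem; later proofs pass between the two by
    [change]. *)
Definition floorN (r : R) : nat := Z.to_nat (Int_part r).

(** Ceilings occur because f(n) has integer part m exactly when g(m) <= n < g(m+1), and the least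
    such n can only be the ceiling of g(m). *)
Definition ceil (y : R) : Z := (- Int_part (- y))%Z.

Lemma floorN_spec r : 0 <= r -> INR (floorN r) <= r < INR (floorN r) + 1.
Proof.
  intros Hr. destruct (base_Int_part r) as [H1 H2]. unfold floorN.
  assert (H : (0 <= Int_part r)%Z).
  { assert (-1 < Int_part r)%Z by (apply lt_IZR; lra). lia. }
  rewrite INR_IZR_INZ, Z2Nat.id by exact H. lra.
Qed.

Lemma floorN_unique r n : INR n <= r < INR n + 1 -> floorN r = n.
Proof.
  intros H. assert (H0 : 0 <= r) by (pose proof (pos_INR n); lra).
  pose proof (floorN_spec r H0) as H1.
  assert (floorN r < S n)%nat by (apply INR_lt; rewrite S_INR; lra).
  assert (n < S (floorN r))%nat by (apply INR_lt; rewrite S_INR; lra).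
  lia.
Qed.

Lemma floorN_mono r s : 0 <= r <= s -> (floorN r <= floorN s)%nat.
Proof.
  intros H. pose proof (floorN_spec r ltac:(lra)). pose proof (floorN_spec s ltac:(lra)).
  assert (floorN r < S (floorN s))%nat by (apply INR_lt; rewrite S_INR; lra). lia.
Qed.

Lemma ceil_spec y : y <= IZR (ceil y) < y + 1.
Proof.
  destruct (base_Int_part (- y)) as [H1 H2]. unfold ceil. rewrite opp_IZR. lra.
Qed.

Lemma ceil_unique y n : y <= IZR n < y + 1 -> ceil y = n.
Proof.
  intros H. pose proof (ceil_spec y) as H1.
  assert (ceil y < n + 1)%Z by (apply lt_IZR; rewrite plus_IZR; lra).
  assert (n < ceil y + 1)%Z by (apply lt_IZR; rewrite plus_IZR; lra).
  lia.
Qed.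

Lemma ceil_mono x y : x <= y -> (ceil x <= ceil y)%Z.
Proof.
  intros H. pose proof (ceil_spec x). pose proof (ceil_spec y).
  assert (ceil x < ceil y + 1)%Z by (apply lt_IZR; rewrite plus_IZR; lra). lia.
Qed.

Lemma csum_ext F G n : (forall i, (i < n)%nat -> F i = G i) -> csum F n = csum G n.
Proof.
  induction n as [|n IH]; intros H; simpl; [reflexivity|].
  rewrite IH by (intros; apply H; lia). rewrite H by lia. reflexivity.
Qed.

Lemma rsum_ext F G n : (forall i, (i < n)%nat -> F i = G i) -> rsum F n = rsum G n.
Proof.
  induction n as [|n IH]; intros H; simpl; [reflexivity|].
  rewrite IH by (intros; apply H; lia). rewrite H by lia. reflexivity.
Qed.

Lemma csum_app F k l :
  csum F (k + l) = Cplus (csum F k) (csum (fun i => F (k + i)%nat) l).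
Proof.
  induction l as [|l IH]; simpl.
  - rewrite Nat.add_0_r. ring.
  - rewrite Nat.add_succ_r. simpl. rewrite IH. ring.
Qed.

Lemma csum_plus F G n : csum (fun i => Cplus (F i) (G i)) n = Cplus (csum F n) (csum G n).
Proof. induction n as [|n IH]; simpl; [ring|]. rewrite IH. ring. Qed.

Lemma csum_minus F G n : csum (fun i => Cminus (F i) (G i)) n = Cminus (csum F n) (csum G n).
Proof. induction n as [|n IH]; simpl; [ring|]. rewrite IH. ring. Qed.

Lemma csum_scal c F n : csum (fun i => Cmult c (F i)) n = Cmult c (csum F n).
Proof. induction n as [|n IH]; simpl; [ring|]. rewrite IH. ring. Qed.

Lemma rsum_plus F G n : rsum (fun i => F i + G i) n = rsum F n + rsum G n.
Proof. induction n as [|n IH]; simpl; [ring|]. rewrite IH. ring. Qed.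

Lemma rsum_minus F G n : rsum (fun i => F i - G i) n = rsum F n - rsum G n.
Proof. induction n as [|n IH]; simpl; [ring|]. rewrite IH. ring. Qed.

Lemma rsum_scal c F n : rsum (fun i => c * F i) n = c * rsum F n.
Proof. induction n as [|n IH]; simpl; [ring|]. rewrite IH. ring. Qed.

Lemma rsum_const c n : rsum (fun _ => c) n = INR n * c.
Proof. induction n as [|n IH]; [simpl; ring|]. rewrite S_INR. simpl rsum. rewrite IH. ring. Qed.

Lemma rsum_le F G n : (forall i, (i < n)%nat -> F i <= G i) -> rsum F n <= rsum G n.
Proof.
  induction n as [|n IH]; intros H; simpl; [lra|].
  apply Rplus_le_compat; [apply IH; intros; apply H; lia | apply H; lia].
Qed.

Lemma rsum_nonneg F n : (forall i, (i < n)%nat -> 0 <= F i) -> 0 <= rsum F n.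
Proof.
  intros H. replace 0 with (rsum (fun _ => 0) n) by (rewrite rsum_const; ring).
  apply rsum_le. exact H.
Qed.

Lemma rsum_le_length F m n : (m <= n)%nat -> (forall i, (i < n)%nat -> 0 <= F i) ->
  rsum F m <= rsum F n.
Proof.
  intros Hmn H. induction n as [|n IH]; [replace m with O by lia; lra|].
  destruct (Nat.eq_dec m (S n)) as [->|E]; [lra|]. simpl.
  pose proof (H n ltac:(lia)). pose proof (IH ltac:(lia) ltac:(intros; apply H; lia)). lra.
Qed.

Lemma rsum_S_l F n : rsum F (S n) = F O + rsum (fun i => F (S i)) n.
Proof.
  induction n as [|n IH]; [simpl; ring|].
  change (rsum F (S (S n))) with (rsum F (S n) + F (S n)). rewrite IH. simpl. ring.
Qed.

Lemma Cmod_csum F n : Cmod (csum F n) <= rsum (fun i => Cmod (F i)) n.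
Proof.
  induction n as [|n IH]; simpl; [rewrite Cmod_0; lra|].
  eapply Rle_trans; [apply Cmod_triangle|]. lra.
Qed.

Lemma Cmod_csum_le F n B : (forall i, (i < n)%nat -> Cmod (F i) <= B) ->
  Cmod (csum F n) <= INR n * B.
Proof.
  intros H. eapply Rle_trans; [apply Cmod_csum|].
  rewrite <- rsum_const. apply rsum_le. exact H.
Qed.

Lemma fold_right_Cplus_seq F s k :
  fold_right Cplus (RtoC 0) (map F (seq s k)) = csum (fun i => F (s + i)%nat) k.
Proof.
  assert (H : forall l x, fold_right Cplus (RtoC 0) (l ++ x :: nil)
              = Cplus (fold_right Cplus (RtoC 0) l) x).
  { induction l as [|y l IH]; intros x; simpl; [ring|]. rewrite IH. ring. }
  induction k as [|k IH]; [reflexivity|].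
  rewrite seq_S, map_app. simpl map. rewrite H, IH. reflexivity.
Qed.

Lemma filter_seq_interval (P : nat -> bool) p q n : (p <= q < n)%nat ->
  (forall m, P m = true <-> (p < m <= q)%nat) ->
  filter P (seq 0 n) = seq (S p) (q - p).
Proof.
  intros H HP.
  assert (Hno : forall s k, (forall m, (s <= m < s + k)%nat -> ~ (p < m <= q)%nat) ->
            filter P (seq s k) = nil).
  { intros s k; revert s; induction k as [|k IH]; intros s Hk; [reflexivity|]. simpl.
    destruct (P s) eqn:E; [apply HP in E; exfalso; apply (Hk s); lia|].
    apply IH. intros m Hm. apply Hk. lia. }
  assert (Hall : forall s k, (forall m, (s <= m < s + k)%nat -> (p < m <= q)%nat) ->
            filter P (seq s k) = seq s k).
  { intros s k; revert s; induction k as [|k IH]; intros s Hk; [reflexivity|]. simpl.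
    rewrite (proj2 (HP s)) by (apply Hk; lia). f_equal.
    apply IH. intros m Hm. apply Hk. lia. }
  replace n with (S p + ((q - p) + (n - S q)))%nat by lia.
  rewrite !seq_app, !filter_app.
  rewrite Hno by lia. rewrite Hall by lia. rewrite Hno by lia.
  rewrite app_nil_r. reflexivity.
Qed.

(** Turns the filtered list into consecutive indices, where splitting and linearity are plain
    inductions; all later work on interval sums passes through this form. *)
Lemma sum_between_csum F a b : 0 <= a <= b ->
  sum_between F a b
  = csum (fun i => F (S (floorN a) + i)%nat) (floorN b - floorN a).
Proof.
  intros H. unfold sum_between. rewrite <- fold_right_Cplus_seq. do 2 f_equal.
  pose proof (floorN_spec a ltac:(lra)) as Ha. pose proof (floorN_spec b ltac:(lra)) as Hb.
  apply filter_seq_interval.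
  (* [up b] is the integer part of [b] plus one, so the list being filtered reaches beyond
     [floorN b]. *)
  - split; [apply floorN_mono; lra|]. unfold floorN, Int_part.
    assert (up b - 1 <= up b)%Z as Hz by lia. apply Z2Nat.inj_le in Hz; try lia.
    + destruct (archimed b). assert (0 < up b)%Z by (apply lt_IZR; lra). lia.
    + destruct (archimed b). assert (0 < up b)%Z by (apply lt_IZR; lra). lia.
  - intros m. destruct (Rlt_dec a (INR m)) as [H1|H1]; [destruct (Rle_dec (INR m) b) as [H2|H2]|].
    + split; [intros _ | reflexivity]. split.
      * apply INR_lt. lra.
      * assert (m < S (floorN b))%nat by (apply INR_lt; rewrite S_INR; lra). lia.
    + split; [discriminate|]. intros [_ H3]. apply le_INR in H3. lra.
    + split; [discriminate|]. intros [H3 _]. apply le_INR in H3. rewrite S_INR in H3. lra.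
Qed.

Lemma sum_between_chasles F a b c : 0 <= a <= b -> b <= c ->
  sum_between F a c = Cplus (sum_between F a b) (sum_between F b c).
Proof.
  intros H1 H2. rewrite !sum_between_csum by lra.
  pose proof (floorN_mono a b ltac:(lra)). pose proof (floorN_mono b c ltac:(lra)).
  replace (floorN c - floorN a)%nat
    with ((floorN b - floorN a) + (floorN c - floorN b))%nat by lia.
  rewrite csum_app. f_equal. apply csum_ext. intros i _. f_equal. lia.
Qed.

Lemma between_floorN a b i : 0 <= a <= b -> (i < floorN b - floorN a)%nat ->
  a < INR (S (floorN a) + i) <= b.
Proof.
  intros H Hi. pose proof (floorN_spec a ltac:(lra)). pose proof (floorN_spec b ltac:(lra)).
  rewrite plus_INR, S_INR. pose proof (pos_INR i).
  assert (S (floorN a) + i <= floorN b)%nat as H3 by lia. apply le_INR in H3.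
  rewrite plus_INR, S_INR in H3. lra.
Qed.

Lemma floorN_diff_le a b : 0 <= a <= b -> INR (floorN b - floorN a) <= b - a + 1.
Proof.
  intros H. pose proof (floorN_spec a ltac:(lra)). pose proof (floorN_spec b ltac:(lra)).
  rewrite minus_INR by (apply floorN_mono; lra). lra.
Qed.

Lemma Cmod_sum_between_le F a b B : 0 <= a <= b -> 0 <= B ->
  (forall m, a < INR m <= b -> Cmod (F m) <= B) ->
  Cmod (sum_between F a b) <= (b - a + 1) * B.
Proof.
  intros H HB HF. rewrite sum_between_csum by exact H.
  eapply Rle_trans.
  - apply Cmod_csum_le with (B := B). intros i Hi. apply HF. apply between_floorN; assumption.
  - apply Rmult_le_compat_r; [exact HB|]. apply floorN_diff_le. exact H.
Qed.

Lemma sum_between_ext F G a b : 0 <= a <= b ->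
  (forall m, a < INR m <= b -> F m = G m) -> sum_between F a b = sum_between G a b.
Proof.
  intros H HF. rewrite !sum_between_csum by exact H. apply csum_ext.
  intros i Hi. apply HF. apply between_floorN; assumption.
Qed.

Lemma sum_between_minus F G a b : 0 <= a <= b ->
  sum_between (fun m => Cminus (F m) (G m)) a b
  = Cminus (sum_between F a b) (sum_between G a b).
Proof. intros H. rewrite !sum_between_csum by exact H. apply csum_minus. Qed.

(** * The Fejer kernel and the sawtooth function *)

Definition dirichlet (k : nat) (x : R) : R :=
  1 + 2 * rsum (fun h => cos (2 * PI * (INR (S h) * x))) k.

Definition fejer (n : nat) (x : R) : R := / INR n * rsum (fun k => dirichlet k x) n.

(* Fejer mean of the Fourier series of [ceil y - y - 1/2]. *)
Definition saw (n : nat) (y : R) : R :=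
  / INR n * rsum (fun k => rsum (fun h => sin (2 * PI * (INR (S h) * y)) / (PI * INR (S h))) k) n.

(** The condition [sin (PI * x) = 0] stands for x being an integer, the case in which the closed
    formula for the kernel says nothing. *)
Lemma sin_int_PI x n : sin (PI * x) = 0 -> sin (INR n * (PI * x)) = 0.
Proof.
  intros H. induction n as [|n IH]; [rewrite Rmult_0_l; apply sin_0|].
  rewrite S_INR, Rmult_plus_distr_r, Rmult_1_l, sin_plus, IH, H. ring.
Qed.

(** Telescoping: 2 cos y sin(pi x) = sin(y + pi x) - sin(y - pi x). Without division the identity
    holds at integers too. *)
Lemma dirichlet_sin k x :
  dirichlet k x * sin (PI * x) = sin ((2 * INR k + 1) * (PI * x)).
Proof.
  induction k as [|k IH]; [unfold dirichlet; cbn [rsum INR]; rewrite !Rmult_0_r, Rplus_0_r, Rplus_0_l, !Rmult_1_l; reflexivity|].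
  assert (E : dirichlet (S k) x = dirichlet k x + 2 * cos (2 * PI * (INR (S k) * x))).
  { unfold dirichlet. cbn [rsum]. ring. }
  rewrite E, Rmult_plus_distr_r, IH. set (y := 2 * PI * (INR (S k) * x)).
  replace ((2 * INR k + 1) * (PI * x)) with (y - PI * x) by (unfold y; rewrite S_INR; ring).
  replace ((2 * INR (S k) + 1) * (PI * x)) with (y + PI * x) by (unfold y; ring).
  rewrite sin_minus, sin_plus. ring.
Qed.

(** Telescopes again, by sin((2n+1)y) sin y = sin((n+1)y)^2 - sin(ny)^2. *)
Lemma rsum_dirichlet_sin n x :
  rsum (fun k => dirichlet k x) n * (sin (PI * x))^2 = (sin (INR n * (PI * x)))^2.
Proof.
  induction n as [|n IH]; [cbn [rsum INR]; rewrite !Rmult_0_l, sin_0; ring|].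
  simpl rsum. rewrite Rmult_plus_distr_r, IH.
  replace (dirichlet n x * sin (PI * x) ^ 2)
    with (dirichlet n x * sin (PI * x) * sin (PI * x)) by ring.
  rewrite dirichlet_sin, S_INR. set (y := PI * x). set (t := INR n * y).
  replace ((2 * INR n + 1) * y) with (t + t + y) by (unfold t; ring).
  replace ((INR n + 1) * y) with (t + y) by (unfold t; ring).
  rewrite !sin_plus, !cos_plus.
  pose proof (sin2_cos2 t) as H1. pose proof (sin2_cos2 y) as H2. unfold Rsqr in *.
  replace (cos t * cos t) with (1 - sin t * sin t) by lra.
  replace (cos y ^ 2) with (1 - sin y * sin y) by (simpl; lra).
  assert (cos t ^ 2 = 1 - sin t ^ 2) as H3 by (simpl; lra).
  assert (cos y ^ 2 = 1 - sin y ^ 2) as H4 by (simpl; lra).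
  ring_simplify. rewrite ?H3, ?H4. ring.
Qed.

Lemma fejer_sin n x : (0 < n)%nat ->
  INR n * fejer n x * (sin (PI * x))^2 = (sin (INR n * (PI * x)))^2.
Proof.
  intros Hn. apply lt_INR in Hn. simpl in Hn. unfold fejer.
  rewrite <- rsum_dirichlet_sin. field. lra.
Qed.

Lemma dirichlet_int k x : sin (PI * x) = 0 -> dirichlet k x = 2 * INR k + 1.
Proof.
  intros H. unfold dirichlet.
  rewrite (rsum_ext _ (fun _ => 1)).
  - rewrite rsum_const. ring.
  - intros h _. replace (2 * PI * (INR (S h) * x)) with (2 * (INR (S h) * (PI * x))) by ring.
    rewrite cos_2a_sin, sin_int_PI by exact H. ring.
Qed.

Lemma fejer_int n x : (0 < n)%nat -> sin (PI * x) = 0 -> fejer n x = INR n.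
Proof.
  intros Hn H. apply lt_INR in Hn. simpl in Hn. unfold fejer.
  assert (E : rsum (fun k => dirichlet k x) n = INR n * INR n).
  { clear Hn. induction n as [|n IH]; [simpl; ring|]. simpl rsum.
    rewrite IH, dirichlet_int, S_INR by exact H. ring. }
  rewrite E. field. lra.
Qed.

Lemma fejer_nonneg n x : (0 < n)%nat -> 0 <= fejer n x.
Proof.
  intros Hn. assert (HN : 0 < INR n) by (apply lt_0_INR; exact Hn).
  destruct (Req_dec (sin (PI * x)) 0) as [H|H].
  - rewrite fejer_int by assumption. lra.
  - assert (Hs : 0 < (sin (PI * x))^2) by (rewrite <- Rsqr_pow2; apply Rsqr_pos_lt; exact H).
    pose proof (fejer_sin n x Hn) as E. pose proof (pow2_ge_0 (sin (INR n * (PI * x)))).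
    apply Rnot_lt_le. intros Hlt.
    assert (0 < INR n * (sin (PI * x))^2) by (apply Rmult_lt_0_compat; assumption). nra.
Qed.

Lemma cos_2PI_add_nat y h n : cos (2 * PI * (INR h * (y + INR n))) = cos (2 * PI * (INR h * y)).
Proof.
  replace (2 * PI * (INR h * (y + INR n)))
    with (2 * PI * (INR h * y) + 2 * INR (h * n) * PI) by (rewrite mult_INR; ring).
  apply cos_period.
Qed.

Lemma sin_2PI_add_nat y h n : sin (2 * PI * (INR h * (y + INR n))) = sin (2 * PI * (INR h * y)).
Proof.
  replace (2 * PI * (INR h * (y + INR n)))
    with (2 * PI * (INR h * y) + 2 * INR (h * n) * PI) by (rewrite mult_INR; ring).
  apply sin_period.
Qed.

Lemma periodic_Z (P : R -> R) : (forall y n, P (y + INR n) = P y) ->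
  forall y k, P (y + IZR k) = P y.
Proof.
  intros H y k. destruct (Z_le_gt_dec 0 k) as [Hk|Hk].
  - rewrite <- (Z2Nat.id k), <- INR_IZR_INZ by exact Hk. apply H.
  - rewrite <- (H (y + IZR k) (Z.to_nat (- k))). f_equal.
    rewrite INR_IZR_INZ, Z2Nat.id, opp_IZR by lia. ring.
Qed.

Lemma fejer_periodic n y k : fejer n (y + IZR k) = fejer n y.
Proof.
  revert y k. apply periodic_Z. intros y m. unfold fejer, dirichlet. f_equal.
  apply rsum_ext. intros k _. do 2 f_equal. apply rsum_ext. intros h _. apply cos_2PI_add_nat.
Qed.

Lemma saw_periodic n y k : saw n (y + IZR k) = saw n y.
Proof.
  revert y k. apply periodic_Z. intros y m. unfold saw. f_equal.
  apply rsum_ext. intros k _. apply rsum_ext. intros h _. f_equal. apply sin_2PI_add_nat.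
Qed.

Lemma saw_opp n y : saw n (- y) = - saw n y.
Proof.
  unfold saw. rewrite Ropp_mult_distr_r. f_equal.
  replace (- rsum _ n) with ((-1) * rsum (fun k => rsum (fun h => sin (2 * PI * (INR (S h) * y)) / (PI * INR (S h))) k) n) by ring.
  rewrite <- rsum_scal. apply rsum_ext. intros k _. rewrite <- rsum_scal. apply rsum_ext. intros h _.
  replace (2 * PI * (INR (S h) * - y)) with (- (2 * PI * (INR (S h) * y))) by ring.
  rewrite sin_neg. unfold Rdiv. ring.
Qed.

Lemma is_derive_rsum (F F' : nat -> R -> R) n y :
  (forall i, (i < n)%nat -> is_derive (F i) y (F' i y)) ->
  is_derive (fun x => rsum (fun i => F i x) n) y (rsum (fun i => F' i y) n).
Proof.
  induction n as [|n IH]; intros H; simpl; [exact (is_derive_const (V := R_NormedModule) 0 y)|].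
  apply (is_derive_plus (fun x => rsum (fun i => F i x) n)); [apply IH; intros; apply H; lia | apply H; lia].
Qed.

(** Each sin(2 pi h y)/(pi h) has derivative 2 cos(2 pi h y), so what results is the Fejer kernel
    without its constant term 1. *)
Lemma is_derive_saw n y : (0 < n)%nat -> is_derive (saw n) y (fejer n y - 1).
Proof.
  intros Hn. apply lt_INR in Hn. simpl in Hn.
  replace (fejer n y - 1)
    with (/ INR n * rsum (fun k => rsum (fun h => 2 * cos (2 * PI * (INR (S h) * y))) k) n).
  - unfold saw. apply is_derive_scal.
    apply (is_derive_rsum (fun k x => rsum (fun h => sin (2 * PI * (INR (S h) * x)) / (PI * INR (S h))) k)
            (fun k x => rsum (fun h => 2 * cos (2 * PI * (INR (S h) * x))) k)). intros k _.
    apply (is_derive_rsum (fun h x => sin (2 * PI * (INR (S h) * x)) / (PI * INR (S h)))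
            (fun h x => 2 * cos (2 * PI * (INR (S h) * x)))). intros h _.
    assert (Hc : 0 < INR (S h)) by (apply lt_0_INR; lia). pose proof PI_RGT_0.
    revert Hc. generalize (INR (S h)). intros c Hc.
    auto_derive; [split; lra|]. field. split; lra.
  - unfold fejer. rewrite (rsum_ext (fun k => dirichlet k y)
      (fun k => 1 + rsum (fun h => 2 * cos (2 * PI * (INR (S h) * y))) k)).
    + rewrite rsum_plus, rsum_const.
      change (rsum (fun k => rsum (fun h => 2 * cos (2 * PI * (INR (S h) * y))) k) n)
        with (rsum (rsum (fun h => 2 * cos (2 * PI * (INR (S h) * y)))) n).
      field. lra.
    + intros k _. unfold dirichlet. rewrite rsum_scal. reflexivity.
Qed.

Lemma continuous_rsum (F : nat -> R -> R) n y :
  (forall i, (i < n)%nat -> continuous (F i) y) -> continuous (fun x => rsum (fun i => F i x) n) y.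
Proof.
  induction n as [|n IH]; intros H; simpl; [apply continuous_const|].
  apply (continuous_plus (fun x => rsum (fun i => F i x) n)); [apply IH; intros; apply H; lia | apply H; lia].
Qed.

Lemma continuous_fejer n y : continuous (fejer n) y.
Proof.
  unfold fejer. apply (continuous_scal_r (/ INR n) (fun x => rsum (fun k => dirichlet k x) n)).
  apply (continuous_rsum (fun k x => dirichlet k x)). intros k _. unfold dirichlet.
  apply (continuous_plus (fun _ => 1)); [apply continuous_const|].
  apply (continuous_scal_r 2 (fun x => rsum (fun h => cos (2 * PI * (INR (S h) * x))) k)).
  apply (continuous_rsum (fun h x => cos (2 * PI * (INR (S h) * x)))). intros h _.
  apply (ex_derive_continuous (fun x => cos (2 * PI * (INR (S h) * x)))). auto_derive. exact I.
Qed.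

(** Taylor polynomial of degree 7 with x^2 <= 4. The factor 1/3 is what PI >= 3 needs to give x <=
    sin(PI x). *)
Lemma sin_ge_third x : 0 <= x <= PI / 2 -> x / 3 <= sin x.
Proof.
  intros [H0 H1]. pose proof PI_4 as HP. 
  destruct (SIN x H0 ltac:(pose proof PI_RGT_0; lra)) as [H _].
  eapply Rle_trans; [|exact H]. unfold sin_lb, sin_approx, sin_term. simpl.
  assert (H2 : x * x <= 4) by nra.
  apply Rle_trans with (x * (1 - x*x/6 + (x*x)*(x*x)/120 - (x*x)*(x*x)*(x*x)/5040)); [|right; field].
  assert (0 <= (x*x)*(x*x)) by nra.
  assert ((x*x)*(x*x)*(x*x) <= (x*x)*(x*x)*4) by (apply Rmult_le_compat_l; assumption). nra.
Qed.

Lemma sin_PI_ge x : 0 <= x <= 1 / 2 -> x <= sin (PI * x).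
Proof.
  intros H. pose proof PI2_3_2. 
  eapply Rle_trans; [|apply sin_ge_third; split; nra]. nra.
Qed.

Lemma fejer_le n y : (0 < n)%nat -> 0 < y <= 1 / 2 -> fejer n y <= / (INR n * y^2).
Proof.
  intros Hn Hy. assert (HN : 0 < INR n) by (apply lt_0_INR; exact Hn).
  pose proof (fejer_sin n y Hn) as E. pose proof (fejer_nonneg n y Hn) as Hf.
  pose proof (sin_PI_ge y ltac:(lra)) as Hs.
  assert (Hs2 : y ^ 2 <= (sin (PI * y))^2) by (apply pow_incr; lra).
  assert (H1 : (sin (INR n * (PI * y)))^2 <= 1).
  { pose proof (SIN_bound (INR n * (PI * y))). nra. }
  assert (0 < INR n * y^2) by (apply Rmult_lt_0_compat; [lra | apply pow_lt; lra]).
  apply Rmult_le_reg_l with (INR n * y^2); [assumption|].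
  rewrite Rinv_r by lra. eapply Rle_trans; [|exact H1]. rewrite <- E.
  replace (INR n * y ^ 2 * fejer n y) with (INR n * fejer n y * y^2) by ring.
  apply Rmult_le_compat_l; [|exact Hs2]. apply Rmult_le_pos; lra.
Qed.

Lemma sin_le_self x : 0 <= x -> sin x <= x.
Proof.
  intros [H|<-]; [left; apply sin_lt_x; exact H | rewrite sin_0; lra].
Qed.

(** With t the distance to the integer, sin(n PI t) >= n t and sin(PI t) <= 4 t, so the kernel is at
    least n/16. Scaled by 16/n it majorises the indicator of being near an integer. *)
Lemma fejer_ge n y k : (0 < n)%nat -> Rabs (y - IZR k) <= / (2 * INR n) ->
  1 <= 16 / INR n * fejer n y.
Proof.
  intros Hn Hy. assert (HN : 0 < INR n) by (apply lt_0_INR; exact Hn).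
  assert (HN1 : 1 <= INR n) by (apply (le_INR 1); lia).
  replace y with ((y - IZR k) + IZR k) by ring. rewrite fejer_periodic.
  set (t := y - IZR k) in *.
  destruct (Req_dec t 0) as [E|E].
  - rewrite fejer_int; [|exact Hn| rewrite E, Rmult_0_r; apply sin_0].
      replace (16 / INR n * INR n) with 16 by (field; lra). lra.
  - pose proof (fejer_sin n t Hn) as H. pose proof (fejer_nonneg n t Hn) as Hf.
    pose proof PI_4 as HP. pose proof PI_RGT_0 as HP0.
    pose proof (Rabs_pos_lt t E) as Hs.
    (* Squares of sines are even, so the signed [t] may be replaced by its absolute value. *)
    assert (Hsq : forall c, (sin (c * t))^2 = (sin (c * Rabs t))^2).
    { intros c. unfold Rabs. destruct (Rcase_abs t); [|reflexivity].
      replace (c * - t) with (- (c * t)) by ring. rewrite sin_neg. ring. }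
    replace (INR n * (PI * t)) with ((INR n * PI) * t) in H by ring.
    rewrite !Hsq in H. set (s := Rabs t) in *.
    assert (Hns : INR n * s <= 1 / 2).
    { apply Rmult_le_compat_l with (r := INR n) in Hy; [|lra].
      replace (INR n * / (2 * INR n)) with (1/2) in Hy by (field; lra). exact Hy. }
    assert (Hs2 : s <= 1/2) by nra.
    pose proof (sin_PI_ge (INR n * s) ltac:(split; nra)) as H1.
    replace (PI * (INR n * s)) with (INR n * PI * s) in H1 by ring.
    pose proof (sin_PI_ge s ltac:(lra)) as H2.
    pose proof (sin_le_self (PI * s) ltac:(nra)) as H3.
    assert (H4 : (INR n * s)^2 <= (sin (INR n * PI * s))^2) by (apply pow_incr; split; nra).
    assert (H5 : (sin (PI * s))^2 <= (4 * s)^2) by (apply pow_incr; split; nra).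
    rewrite <- H in H4.
    assert (H6 : INR n * fejer n t * (sin (PI * s))^2 <= INR n * fejer n t * (4 * s)^2)
      by (apply Rmult_le_compat_l; [apply Rmult_le_pos; lra | exact H5]).
    assert (H7 : (INR n * s^2) * INR n <= (INR n * s^2) * (16 * fejer n t)) by nra.
    apply Rmult_le_reg_l in H7; [|apply Rmult_lt_0_compat; [lra | apply pow_lt; lra]].
    apply Rmult_le_reg_l with (INR n); [lra|].
    replace (INR n * (16 / INR n * fejer n t)) with (16 * fejer n t) by (field; lra). lra.
Qed.

Lemma mean_value (F F' : R -> R) a b : a <= b ->
  (forall x, a <= x <= b -> is_derive F x (F' x)) ->
  exists c, a <= c <= b /\ F b - F a = F' c * (b - a).
Proof.
  intros Hab H. destruct (MVT_gen F a b F') as [c [Hc E]].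
  - rewrite Rmin_left, Rmax_right by exact Hab. intros x Hx. apply H. lra.
  - rewrite Rmin_left, Rmax_right by exact Hab. intros x Hx.
    apply continuity_pt_filterlim. apply (ex_derive_continuous F). exists (F' x). apply H. exact Hx.
  - rewrite Rmin_left, Rmax_right in Hc by exact Hab. exists c. split; assumption.
Qed.

Lemma antitone_of_deriv (F F' : R -> R) a b : a <= b ->
  (forall x, a <= x <= b -> is_derive F x (F' x)) ->
  (forall x, a <= x <= b -> F' x <= 0) -> F b <= F a.
Proof.
  intros Hab H Hs. destruct (mean_value F F' a b Hab H) as [c [Hc E]].
  pose proof (Hs c Hc). nra.
Qed.

(** With t = y - ceil y + 1, a point of (0, 1], the sawtooth ceil y - y - 1/2 equals 1/2 - t; this
    is thus the error of the Fejer mean read on one period. Unlike the sawtooth it has no jump, and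
    its derivative is minus the kernel. *)
Definition sawdiff (n : nat) (t : R) : R := 1 / 2 - t - saw n t.

Lemma is_derive_sawdiff n t : (0 < n)%nat -> is_derive (sawdiff n) t (- fejer n t).
Proof.
  intros Hn. unfold sawdiff.
  replace (- fejer n t) with (minus (- 1) (fejer n t - 1)) by (unfold minus, plus, opp; simpl; ring).
  apply (is_derive_minus (fun x => 1 / 2 - x) (saw n)).
  - auto_derive; [exact I | ring].
  - apply is_derive_saw. exact Hn.
Qed.

Lemma saw_0 n : saw n 0 = 0.
Proof. pose proof (saw_opp n 0) as H. rewrite Ropp_0 in H. lra. Qed.

Lemma saw_half n : saw n (1 / 2) = 0.
Proof.
  pose proof (saw_opp n (1 / 2)) as H. rewrite <- (saw_periodic n (- (1 / 2)) 1) in H.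
  replace (- (1 / 2) + 1) with (1 / 2) in H by lra. lra.
Qed.

Lemma sawdiff_flip n t : sawdiff n (1 - t) = - sawdiff n t.
Proof.
  unfold sawdiff. replace (1 - t) with (- t + IZR 1) by ring.
  rewrite saw_periodic, saw_opp. simpl. lra.
Qed.

Lemma sawdiff_antitone n s t : (0 < n)%nat -> s <= t -> sawdiff n t <= sawdiff n s.
Proof.
  intros Hn H. apply (antitone_of_deriv (sawdiff n) (fun x => - fejer n x)); [exact H| |].
  - intros x _. apply is_derive_sawdiff. exact Hn.
  - intros x _. pose proof (fejer_nonneg n x Hn). lra.
Qed.

Lemma sawdiff_half n : sawdiff n (1 / 2) = 0.
Proof. unfold sawdiff. rewrite saw_half. lra. Qed.

(** It decreases from 1/2 at 0 to -1/2 at 1. *)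
Lemma sawdiff_bound n t : (0 < n)%nat -> 0 <= t <= 1 -> Rabs (sawdiff n t) <= 1 / 2.
Proof.
  intros Hn Ht. pose proof (sawdiff_antitone n 0 t Hn ltac:(lra)) as H1.
  pose proof (sawdiff_antitone n t (1 - 0) Hn ltac:(lra)) as H2.
  rewrite sawdiff_flip in H2. unfold sawdiff at 2 in H1. unfold sawdiff at 1 in H2.
  rewrite saw_0 in *. apply Rabs_le. lra.
Qed.

(* The tail of the Fejer kernel is compared with the primitive of its majorant [1 / (n t^2)]. *)
Lemma sawdiff_tail n d t : (0 < n)%nat -> 0 < d -> d <= t <= 1 - d ->
  Rabs (sawdiff n t) <= / (INR n * d).
Proof.
  intros Hn Hd. assert (HN : 0 < INR n) by (apply lt_0_INR; exact Hn).
  assert (Hleft : forall t, d <= t <= 1 / 2 -> Rabs (sawdiff n t) <= / (INR n * d)).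
  { clear t. intros t Ht.
    pose proof (sawdiff_antitone n t (1 / 2) Hn ltac:(lra)) as H0. rewrite sawdiff_half in H0.
    rewrite Rabs_pos_eq by exact H0.
    (* [/ (INR n * x) - sawdiff n x] is decreasing, and positive at 1/2, where [sawdiff]
       vanishes. *)
    assert (H1 : / (INR n * (1/2)) - sawdiff n (1 / 2) <= / (INR n * t) - sawdiff n t).
    { apply (antitone_of_deriv (fun x => / (INR n * x) - sawdiff n x)
               (fun x => - / (INR n * x^2) + fejer n x)); [lra| |].
      - intros x Hx.
        replace (- / (INR n * x ^ 2) + fejer n x) with (minus (- / (INR n * x^2)) (- fejer n x))
          by (unfold minus, plus, opp; simpl; ring).
        apply (is_derive_minus (fun x => / (INR n * x)) (sawdiff n)).
        + auto_derive; [nra|]. field. split; lra.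
        + apply is_derive_sawdiff. exact Hn.
      - intros x Hx. pose proof (fejer_le n x Hn ltac:(lra)). lra. }
    rewrite sawdiff_half in H1.
    assert (0 < / (INR n * (1/2))) by (apply Rinv_0_lt_compat; lra).
    apply Rle_trans with (/ (INR n * t)); [lra|].
    apply Rinv_le_contravar; nra. }
  intros Ht. destruct (Rle_dec t (1 / 2)) as [H|H]; [apply Hleft; lra|].
  replace t with (1 - (1 - t)) by ring. rewrite sawdiff_flip, Rabs_Ropp. apply Hleft. lra.
Qed.

Lemma ceil_saw n y :
  IZR (ceil y) - y - 1 / 2 - saw n y = sawdiff n (y - IZR (ceil y) + 1).
Proof.
  unfold sawdiff. replace (y - IZR (ceil y) + 1) with (y + IZR (1 - ceil y))
    by (rewrite minus_IZR; ring). rewrite saw_periodic, minus_IZR. lra.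
Qed.

Lemma saw_approx n y : (0 < n)%nat -> Rabs (IZR (ceil y) - y - 1 / 2 - saw n y) <= 1 / 2.
Proof.
  intros Hn. rewrite ceil_saw. pose proof (ceil_spec y). apply sawdiff_bound; [exact Hn | lra].
Qed.

Lemma saw_approx_far n d y : (0 < n)%nat -> 0 < d -> (forall k : Z, d <= Rabs (y - IZR k)) ->
  Rabs (IZR (ceil y) - y - 1 / 2 - saw n y) <= / (INR n * d).
Proof.
  intros Hn Hd H. rewrite ceil_saw. pose proof (ceil_spec y) as H0.
  apply sawdiff_tail; [exact Hn | exact Hd|].
  (* The integers on the two sides of y give the two inequalities d <= t <= 1 - d. *)
  pose proof (H (ceil y)) as H1. pose proof (H (ceil y - 1)%Z) as H2.
  rewrite minus_IZR in H2. rewrite Rabs_left1 in H1 by lra.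
  rewrite Rabs_pos_eq in H2 by lra. lra.
Qed.

(** * Integrals of periodic functions and suprema of Lipschitz families *)

Lemma ex_RInt_cont (P : R -> R) u v : (forall x, continuous P x) -> ex_RInt P u v.
Proof. intros H. apply (ex_RInt_continuous (V := R_CompleteNormedModule)). intros; apply H. Qed.

Lemma RInt_Chasles_cont (P : R -> R) u v w : (forall x, continuous P x) ->
  RInt P u w = RInt P u v + RInt P v w.
Proof.
  intros H. symmetry. apply (RInt_Chasles P u v w); apply ex_RInt_cont; exact H.
Qed.

Lemma RInt_nonneg (P : R -> R) u v : (forall x, continuous P x) -> (forall x, 0 <= P x) ->
  u <= v -> 0 <= RInt P u v.
Proof. intros Hc H0 Huv. apply RInt_ge_0; [exact Huv | apply ex_RInt_cont; exact Hc | intros; apply H0]. Qed.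

Section Periodic.

Variable P : R -> R.
Hypothesis Pcont : forall x, continuous P x.
Hypothesis Pper : forall x, P (x + 1) = P x.

Lemma RInt_periodic_shift u v : RInt P (u + 1) (v + 1) = RInt P u v.
Proof.
  replace (u + 1) with (1 * u + 1) by ring. replace (v + 1) with (1 * v + 1) by ring.
  rewrite <- (RInt_comp_lin P 1 1 u v) by (apply ex_RInt_cont; exact Pcont).
  apply RInt_ext. intros x _. unfold scal; simpl; unfold mult; simpl.
  rewrite !Rmult_1_l. apply Pper.
Qed.

Lemma RInt_period s : RInt P s (s + 1) = RInt P 0 1.
Proof.
  rewrite (RInt_Chasles_cont P s 0 (s + 1)) by exact Pcont.
  rewrite (RInt_Chasles_cont P 0 1 (s + 1)) by exact Pcont.
  replace (RInt P 1 (s + 1)) with (RInt P 0 s)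
    by (rewrite <- (RInt_periodic_shift 0 s), Rplus_0_l; reflexivity).
  pose proof (RInt_Chasles_cont P s 0 s Pcont) as H. rewrite RInt_point in H.
  unfold zero in H; simpl in H. lra.
Qed.

Lemma RInt_period_n s n : RInt P s (s + INR n) = INR n * RInt P 0 1.
Proof.
  induction n as [|n IH].
  - simpl. rewrite Rplus_0_r, RInt_point. unfold zero; simpl. ring.
  - rewrite S_INR, (RInt_Chasles_cont P s (s + INR n)) by exact Pcont.
    rewrite IH. replace (s + (INR n + 1)) with ((s + INR n) + 1) by ring.
    rewrite RInt_period. change (@eq R (INR n * RInt P 0 1 + RInt P 0 1) ((INR n + 1) * RInt P 0 1)). ring.
Qed.

Lemma continuous_reflect x : continuous (fun t => P (- t)) x.
Proof.
  apply (continuous_comp (fun t => - t) P); [|apply Pcont].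
  apply (continuous_opp (fun t : R => t)). apply continuous_id.
Qed.

Lemma reflect_periodic x : P (- (x + 1)) = P (- x).
Proof. rewrite <- (Pper (- (x + 1))). f_equal. ring. Qed.

(** A sine contributes both e(y) and e(-y), so window sums at opposite frequencies occur; this gives
    both the same mean. *)
Lemma RInt_reflect : RInt (fun t => P (- t)) 0 1 = RInt P 0 1.
Proof.
  rewrite <- (RInt_period (- 1)).
  rewrite <- (opp_RInt_swap P (- 1 + 1)) by (apply ex_RInt_cont; exact Pcont).
  replace (- 1 + 1) with (- 1 * 0 + 0) by ring. replace (- 1) with (- 1 * 1 + 0) at 2 by ring.
  rewrite <- (RInt_comp_lin P (- 1) 0 0 1) by (apply ex_RInt_cont; exact Pcont).
  rewrite (RInt_ext (fun t => scal (- 1) (P (- 1 * t + 0))) (fun t => scal (- 1) (P (- t))))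
    by (intros t _; replace (- 1 * t + 0) with (- t) by ring; reflexivity).
  assert (E : RInt (fun t => scal (- 1) (P (- t))) 0 1 = - 1 * RInt (fun t => P (- t)) 0 1)
    by exact (RInt_scal (V := R_CompleteNormedModule) (fun t => P (- t)) 0 1 (- 1)
                (ex_RInt_cont _ 0 1 continuous_reflect)).
  rewrite E. unfold opp; simpl.
  enough (H : forall j : R, j = - (- 1 * j)) by exact (H _). intros j. ring.
Qed.

Hypothesis Pnonneg : forall x, 0 <= P x.

(** The interval is enlarged to a whole number of periods; the + 1 is the cost of the incomplete
    one. *)
Lemma RInt_periodic_le u v : u <= v -> RInt P u v <= (v - u + 1) * RInt P 0 1.
Proof.
  intros Huv. pose proof (floorN_spec (v - u) ltac:(lra)) as Hn.
  set (n := S (floorN (v - u))).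
  assert (Hn' : v - u <= INR n <= v - u + 1) by (unfold n; rewrite S_INR; lra).
  pose proof (RInt_nonneg P 0 1 Pcont Pnonneg ltac:(lra)) as H1.
  pose proof (RInt_nonneg P v (u + INR n) Pcont Pnonneg ltac:(lra)) as H2.
  pose proof (RInt_Chasles_cont P u v (u + INR n) Pcont) as H3.
  rewrite RInt_period_n in H3. nra.
Qed.

(** Since - beta' >= lam, inserting the factor - beta'/lam only enlarges the integrand, and it makes
    the substitution theta = h beta(x) exact. *)
Lemma RInt_comp_periodic_le (beta beta' : R -> R) h lam a b :
  0 < h -> 0 < lam -> a <= b ->
  (forall x, a <= x <= b -> is_derive beta x (beta' x)) ->
  (forall x, a <= x <= b -> continuous beta' x) ->
  (forall x, a <= x <= b -> beta' x <= - lam) ->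
  RInt (fun x => P (h * beta x)) a b
    <= / (h * lam) * ((h * (beta a - beta b) + 1) * RInt P 0 1).
Proof.
  intros Hh Hl Hab Hd Hc Hb.
  assert (Hd' : forall x, a <= x <= b -> is_derive (fun x => h * beta x) x (h * beta' x))
    by (intros x Hx; apply is_derive_scal; apply Hd; exact Hx).
  assert (Hbc : forall x, a <= x <= b -> continuous (fun x => P (h * beta x)) x).
  { intros x Hx. apply (continuous_comp (fun x => h * beta x) P); [|apply Pcont].
    apply (ex_derive_continuous (fun x => h * beta x)). exists (h * beta' x). apply Hd'. exact Hx. }
  assert (HR : is_RInt (fun y => scal (h * beta' y) (P (h * beta y))) a b
                 (RInt P (h * beta a) (h * beta b))).
  { apply (is_RInt_comp P (fun x => h * beta x) (fun x => h * beta' x)).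
    - intros; apply Pcont.
    - rewrite Rmin_left, Rmax_right by exact Hab. intros x Hx. split; [apply Hd'; exact Hx|].
      apply (continuous_scal_r h beta'). apply Hc. exact Hx. }
  apply (is_RInt_scal _ _ _ (- / (h * lam))) in HR.
  assert (Hhl : 0 < h * lam) by (apply Rmult_lt_0_compat; assumption).
  assert (Hle : RInt (fun x => P (h * beta x)) a b
     <= - / (h * lam) * RInt P (h * beta a) (h * beta b)).
  { apply (is_RInt_le (fun x => P (h * beta x))
      (fun y => scal (- / (h * lam)) (scal (h * beta' y) (P (h * beta y)))) a b).
    - exact Hab.
    - apply (RInt_correct (V := R_CompleteNormedModule)).
      apply (ex_RInt_continuous (V := R_CompleteNormedModule)).
      rewrite Rmin_left, Rmax_right by exact Hab. exact Hbc.
    - exact HR.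
    - intros x Hx. unfold scal; simpl; unfold mult; simpl.
      pose proof (Pnonneg (h * beta x)). pose proof (Hb x ltac:(lra)).
      replace (- / (h * lam) * (h * beta' x * P (h * beta x)))
        with ((- beta' x / lam) * P (h * beta x)) by (field; lra).
      assert (1 <= - beta' x / lam).
      { apply Rmult_le_reg_r with lam; [exact Hl|]. unfold Rdiv.
        rewrite Rmult_assoc, Rinv_l by lra. lra. }
      nra. }
  eapply Rle_trans; [exact Hle|].
  rewrite <- (opp_RInt_swap P (h * beta b)) by (apply ex_RInt_cont; exact Pcont).
  unfold opp; simpl. rewrite Rmult_opp_opp.
  apply Rmult_le_compat_l; [left; apply Rinv_0_lt_compat; exact Hhl|].
  assert (Hanti : beta b <= beta a).
  { apply (antitone_of_deriv beta beta'); [exact Hab | exact Hd|].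
    intros x Hx. pose proof (Hb x Hx). lra. }
  replace (h * (beta a - beta b) + 1) with (h * beta a - h * beta b + 1) by ring.
  apply RInt_periodic_le. apply Rmult_le_compat_l; lra.
Qed.

End Periodic.

(** [saw n x + x] is a primitive of the kernel, and [saw] has period 1. *)
Lemma RInt_fejer n : (0 < n)%nat -> RInt (fejer n) 0 1 = 1.
Proof.
  intros Hn.
  assert (H : is_RInt (fejer n) 0 1 (minus (saw n 1 + 1) (saw n 0 + 0))).
  { apply (is_RInt_derive (fun x => saw n x + x)).
    - intros x _. replace (fejer n x) with (plus (fejer n x - 1) 1)
        by (unfold plus; simpl; ring).
      apply (is_derive_plus (saw n) (fun x => x)); [apply is_derive_saw; exact Hn|].
      apply (is_derive_id (K := R_AbsRing)).
    - intros x _. apply continuous_fejer. }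
  apply (is_RInt_unique (V := R_CompleteNormedModule)) in H. rewrite H.
  rewrite <- (saw_periodic n 0 1), Rplus_0_l. unfold minus, plus, opp; simpl. ring.
Qed.

Lemma e_add x y : e (x + y) = Cmult (e x) (e y).
Proof.
  unfold e, Cmult; simpl. rewrite Rmult_plus_distr_l, cos_plus, sin_plus.
  f_equal; ring.
Qed.

Lemma e_INR n : e (INR n) = RtoC 1.
Proof.
  unfold e, RtoC. replace (2 * PI * INR n) with (0 + 2 * INR n * PI) by ring.
  rewrite cos_period, sin_period, cos_0, sin_0. reflexivity.
Qed.

Lemma Cmod_e x : Cmod (e x) = 1.
Proof.
  unfold Cmod, e; simpl. pose proof (sin2_cos2 (2 * PI * x)) as H. unfold Rsqr in H.
  rewrite <- sqrt_1 at 3. f_equal. lra.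
Qed.

Lemma Cmod_e_sub_1 x : Cmod (Cminus (e x) (RtoC 1)) = 2 * Rabs (sin (PI * x)).
Proof.
  unfold Cmod, e; simpl.
  replace (2 * PI * x) with (2 * (PI * x)) by ring. rewrite cos_2a_sin, sin_2a.
  set (s := sin (PI * x)). pose proof (sin2_cos2 (PI * x)) as H. unfold Rsqr in H. fold s in H.
  transitivity (sqrt (Rsqr (2 * s)));
    [f_equal | rewrite sqrt_Rsqr_abs, Rabs_mult, (Rabs_pos_eq 2) by lra; reflexivity].
  unfold Rsqr. set (c := cos (PI * x)) in *.
  assert (E : c * c = 1 - s * s) by lra.
  transitivity (4 * (s * s) * (s * s) + 4 * (s * s) * (c * c)); [ring|]. rewrite E. ring.
Qed.

Lemma Rabs_sin_le x : Rabs (sin x) <= Rabs x.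
Proof.
  assert (H : forall x, 0 <= x -> Rabs (sin x) <= x).
  { clear x. intros x Hx. pose proof (sin_le_self x Hx). pose proof (SIN_bound x).
    apply Rabs_le. split; [|lra].
    destruct (Rle_dec x 1) as [H1|H1]; [|lra].
    pose proof PI2_3_2. pose proof (sin_ge_0 x Hx ltac:(lra)). lra. }
  destruct (Rle_dec 0 x) as [Hx|Hx].
  - rewrite (Rabs_pos_eq x) by exact Hx. apply H. exact Hx.
  - replace (sin x) with (- sin (- x)) by (rewrite sin_neg; ring). rewrite Rabs_Ropp, (Rabs_left x) by lra.
    apply H. lra.
Qed.

Lemma Cmod_e_sub_1_le x : Cmod (Cminus (e x) (RtoC 1)) <= 2 * PI * Rabs x.
Proof.
  rewrite Cmod_e_sub_1. pose proof (Rabs_sin_le (PI * x)) as H. pose proof PI_RGT_0.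
  rewrite Rabs_mult, (Rabs_pos_eq PI) in H by lra. lra.
Qed.

Lemma Cmod_e_sub_1_le2 x : Cmod (Cminus (e x) (RtoC 1)) <= 2.
Proof.
  rewrite Cmod_e_sub_1. pose proof (SIN_bound (PI * x)).
  assert (Rabs (sin (PI * x)) <= 1) by (apply Rabs_le; lra). lra.
Qed.

Lemma Cmod_e_sub x y : Cmod (Cminus (e x) (e y)) <= 2 * PI * Rabs (x - y).
Proof.
  replace (Cminus (e x) (e y)) with (Cmult (e y) (Cminus (e (x - y)) (RtoC 1))).
  - rewrite Cmod_mult, Cmod_e, Rmult_1_l. apply Cmod_e_sub_1_le.
  - transitivity (Cminus (Cmult (e y) (e (x - y))) (e y)); [ring|].
    rewrite <- e_add. do 2 f_equal. ring.
Qed.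

Section SupFamily.

Variables (dom : R -> Prop) (q : R -> R -> R) (bd lip x0 : R).
Hypothesis Hx0 : dom x0.
Hypothesis Hq : forall x t, dom x -> 0 <= q x t <= bd.
Hypothesis Hlip : forall x t s, dom x -> q x t <= q x s + lip * Rabs (t - s).

(** Abstract form of the integrand of [J]. Members that are Lipschitz in t with a common constant
    have a Lipschitz, hence continuous and integrable, supremum. *)
Definition sup_family (t : R) : R := real (Lub_Rbar (fun r => exists x, dom x /\ r = q x t)).

(** [real] sends infinite values to 0. Here the supremum is finite: the member at [x0] excludes
    minus infinity and [bd] excludes plus infinity. *)
Lemma sup_family_lub t :
  (forall x, dom x -> q x t <= sup_family t) /\
  (forall M, (forall x, dom x -> q x t <= M) -> sup_family t <= M).
Proof.
  unfold sup_family. set (E := fun r => exists x, dom x /\ r = q x t).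
  destruct (Lub_Rbar_correct E) as [Hub Hlub].
  assert (HM : forall M, (forall x, dom x -> q x t <= M) -> Rbar_le (Lub_Rbar E) (Finite M)).
  { intros M HM. apply Hlub. intros r [x [Hx ->]]. simpl. apply HM. exact Hx. }
  assert (Hb : Rbar_le (Lub_Rbar E) (Finite bd))
    by (apply HM; intros x Hx; apply Hq; exact Hx).
  assert (H0 : Rbar_le (Finite (q x0 t)) (Lub_Rbar E)).
  { apply Hub. exists x0. split; [exact Hx0 | reflexivity]. }
  destruct (Lub_Rbar E) as [l| |]; simpl in *; try contradiction.
  split; [|exact HM]. intros x Hx. apply (Hub (q x t)). exists x. split; [exact Hx | reflexivity].
Qed.

Lemma sup_family_nonneg t : 0 <= sup_family t.
Proof.
  eapply Rle_trans; [apply (Hq x0 t Hx0)|]. apply sup_family_lub. exact Hx0.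
Qed.

Lemma sup_family_lipschitz t s : sup_family t <= sup_family s + lip * Rabs (t - s).
Proof.
  apply sup_family_lub. intros x Hx. eapply Rle_trans; [apply (Hlip x t s Hx)|].
  apply Rplus_le_compat_r. apply sup_family_lub. exact Hx.
Qed.

Lemma continuous_sup_family t : 0 <= lip -> continuous sup_family t.
Proof.
  intros Hl. apply continuity_pt_filterlim. intros eps Heps.
  (* [lip + 1] avoids a division by zero when [lip = 0]. *)
  assert (Hp : 0 < eps / (lip + 1)) by (apply Rdiv_lt_0_compat; lra).
  exists (eps / (lip + 1)). split; [exact Hp|].
  intros s [_ Hs]. simpl in *. unfold R_dist in *.
  pose proof (sup_family_lipschitz t s) as H1. pose proof (sup_family_lipschitz s t) as H2.
  rewrite Rabs_minus_sym in H1. pose proof (Rabs_pos (s - t)).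
  assert (H3 : (lip + 1) * Rabs (s - t) < eps).
  { apply Rmult_lt_compat_l with (r := lip + 1) in Hs; [|lra].
    replace ((lip + 1) * (eps / (lip + 1))) with eps in Hs by (field; lra). exact Hs. }
  apply Rabs_def1; nra.
Qed.

Lemma sup_family_eq t s : (forall x, dom x -> q x t = q x s) -> sup_family t = sup_family s.
Proof.
  intros H. apply Rle_antisym; apply sup_family_lub; intros x Hx.
  - rewrite H by exact Hx. apply sup_family_lub. exact Hx.
  - rewrite <- H by exact Hx. apply sup_family_lub. exact Hx.
Qed.

End SupFamily.

(** * The integral of the supremum of window sums *)

Lemma is_RInt_const_R (a b c d : R) : (b - a) * c = d -> is_RInt (fun _ => c) a b d.
Proof. intros <-. exact (is_RInt_const (V := R_NormedModule) a b c). Qed.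

Lemma is_RInt_rsum (F : nat -> R -> R) (v : nat -> R) n a b :
  (forall i, (i < n)%nat -> is_RInt (F i) a b (v i)) ->
  is_RInt (fun t => rsum (fun i => F i t) n) a b (rsum v n).
Proof.
  induction n as [|n IH]; intros H; simpl.
  - apply is_RInt_const_R. ring.
  - apply (is_RInt_plus (fun t => rsum (fun i => F i t) n)); [apply IH; intros; apply H; lia | apply H; lia].
Qed.

Lemma rsum_single v n i0 : (i0 < n)%nat -> (forall i, (i < n)%nat -> i <> i0 -> v i = 0) ->
  rsum v n = v i0.
Proof.
  induction n as [|n IH]; intros Hi H; [lia|]. simpl.
  destruct (Nat.eq_dec i0 n) as [->|E].
  - rewrite (rsum_ext _ (fun _ => 0)) by (intros i Hi'; apply H; lia). rewrite rsum_const. ring.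
  - rewrite IH by (try lia; intros; apply H; lia). rewrite (H n) by lia. ring.
Qed.

Lemma fst_csum F n : fst (csum F n) = rsum (fun i => fst (F i)) n.
Proof. induction n as [|n IH]; simpl; [reflexivity|]. rewrite IH. reflexivity. Qed.

Lemma Rabs_fst_le_Cmod (w : C) : Rabs (fst w) <= Cmod w.
Proof. eapply Rle_trans; [apply Rmax_l | apply (Rmax_Cmod w)]. Qed.

(** Orthogonality of the characters, for real parts only: an explicit primitive with equal values at
    0 and 1 avoids complex integration. *)
Lemma is_RInt_harmonic (w : C) (d : Z) : d <> 0%Z ->
  is_RInt (fun t => fst (Cmult w (e (IZR d * t)))) 0 1 0.
Proof.
  intros Hd. assert (Hd' : IZR d <> 0) by (apply eq_IZR_contrapositive; exact Hd). pose proof PI_RGT_0.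
  set (F := fun t => (fst w * sin (2 * PI * (IZR d * t)) + snd w * cos (2 * PI * (IZR d * t)))
                     / (2 * PI * IZR d)).
  assert (E : minus (F 1) (F 0) = 0).
  { assert (E1 : sin (2 * PI * IZR d) = 0).
    { replace (2 * PI * IZR d) with (2 * PI * (0 + IZR d)) by ring.
      rewrite (periodic_Z (fun y => sin (2 * PI * y))); [rewrite Rmult_0_r; apply sin_0|].
      intros y n. rewrite <- (sin_period (2 * PI * y) n). f_equal. ring. }
    assert (E2 : cos (2 * PI * IZR d) = 1).
    { replace (2 * PI * IZR d) with (2 * PI * (0 + IZR d)) by ring.
      rewrite (periodic_Z (fun y => cos (2 * PI * y))); [rewrite Rmult_0_r; apply cos_0|].
      intros y n. rewrite <- (cos_period (2 * PI * y) n). f_equal. ring. }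
    unfold F, minus, plus, opp; simpl. rewrite Rmult_1_r, !Rmult_0_r, sin_0, cos_0, E1, E2. ring. }
  enough (H0 : is_RInt (fun t => fst (Cmult w (e (IZR d * t)))) 0 1 (minus (F 1) (F 0)))
    by (rewrite E in H0; exact H0).
  apply (is_RInt_derive F).
  - intros t _. unfold F. auto_derive; [exact I|]. unfold e; simpl. field. split; lra.
  - intros t _. unfold e; simpl.
    apply (ex_derive_continuous (fun t => fst w * cos (2 * PI * (IZR d * t)) - snd w * sin (2 * PI * (IZR d * t)))).
    auto_derive. exact I.
Qed.

Section WindowSup.

Variables (phi : nat -> C) (a b z : R).
Hypothesis Hphi : forall m, Cmod (phi m) <= 1.
Hypothesis Hab : 0 < a < b.
Hypothesis Hz : 0 < z.

Definition window_sum (theta x : R) : C :=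
  sum_between (fun m => Cmult (phi m) (e (INR m * theta))) x (x + z).

(** For a = f(A) and b = f(2A) this unfolds to the integrand of [J], so [J] is its integral by
    conversion. *)
Definition window_sup : R -> R :=
  sup_family (fun x => a < x <= b) (fun x theta => / z * Cmod (window_sum theta x)).

Lemma window_sum_bound x theta : a < x <= b ->
  0 <= / z * Cmod (window_sum theta x) <= / z * (z + 1).
Proof.
  intros Hx. pose proof (Rinv_0_lt_compat z Hz) as Hz'. split.
  - apply Rmult_le_pos; [lra | apply Cmod_ge_0].
  - apply Rmult_le_compat_l; [lra|]. unfold window_sum.
    eapply Rle_trans; [apply Cmod_sum_between_le with (B := 1)|]; [lra|lra| |lra].
    intros m _. rewrite Cmod_mult, Cmod_e, Rmult_1_r. apply Hphi.
Qed.

(** At most z + 1 terms, each with a frequency m <= b + z and hence with derivative at most 2 PI (b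
    + z). *)
Definition window_lip : R := / z * ((z + 1) * (2 * PI * (b + z))).

Lemma window_lip_nonneg : 0 <= window_lip.
Proof.
  unfold window_lip. pose proof (Rinv_0_lt_compat z Hz). pose proof PI_RGT_0.
  apply Rmult_le_pos; [lra|]. apply Rmult_le_pos; [lra|]. apply Rmult_le_pos; lra.
Qed.

Lemma window_sum_lipschitz x t s : a < x <= b ->
  / z * Cmod (window_sum t x) <= / z * Cmod (window_sum s x) + window_lip * Rabs (t - s).
Proof.
  intros Hx. pose proof (Rinv_0_lt_compat z Hz) as Hz'. pose proof PI_RGT_0.
  replace (window_sum t x)
    with (Cplus (window_sum s x) (Cminus (window_sum t x) (window_sum s x))) by ring.
  assert (H0 : Cmod (Cminus (window_sum t x) (window_sum s x))
     <= (z + 1) * (2 * PI * (b + z) * Rabs (t - s))).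
  { unfold window_sum. rewrite <- sum_between_minus by lra.
    pose proof (Rabs_pos (t - s)).
    eapply Rle_trans; [apply Cmod_sum_between_le with (B := 2 * PI * (b + z) * Rabs (t - s))|];
      [lra | assert (0 <= 2 * PI * (b + z)) by nra; apply Rmult_le_pos; assumption | | right; ring].
    intros m Hm.
    replace (Cminus (Cmult (phi m) (e (INR m * t))) (Cmult (phi m) (e (INR m * s))))
      with (Cmult (phi m) (Cminus (e (INR m * t)) (e (INR m * s)))) by ring.
    rewrite Cmod_mult. pose proof (Hphi m). pose proof (Cmod_ge_0 (phi m)).
    pose proof (Cmod_e_sub (INR m * t) (INR m * s)) as He.
    replace (INR m * t - INR m * s) with (INR m * (t - s)) in He by ring.
    rewrite Rabs_mult, (Rabs_pos_eq (INR m)) in He by apply pos_INR.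
    pose proof (Cmod_ge_0 (Cminus (e (INR m * t)) (e (INR m * s)))).
    apply Rle_trans with (1 * (2 * PI * (INR m * Rabs (t - s)))).
    - apply Rmult_le_compat; assumption.
    - rewrite Rmult_1_l.
      replace (2 * PI * (INR m * Rabs (t - s))) with (2 * PI * INR m * Rabs (t - s)) by ring.
      apply Rmult_le_compat_r; [assumption|].
      apply Rmult_le_compat_l; lra. }
  pose proof (Cmod_triangle (window_sum s x) (Cminus (window_sum t x) (window_sum s x))) as H1.
  apply Rle_trans with (/ z * (Cmod (window_sum s x) + (z + 1) * (2 * PI * (b + z) * Rabs (t - s)))).
  - apply Rmult_le_compat_l; lra.
  - unfold window_lip. right; ring.
Qed.

(** [RInt] is a total function; continuity is what makes the value of [J] a genuine integral. *)
Lemma window_sup_continuous t : continuous window_sup t.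
Proof.
  apply (continuous_sup_family _ _ (/ z * (z + 1)) window_lip b).
  - lra.
  - exact (fun x t Hx => window_sum_bound x t Hx).
  - exact window_sum_lipschitz.
  - exact window_lip_nonneg.
Qed.

Lemma window_sup_nonneg t : 0 <= window_sup t.
Proof.
  apply (sup_family_nonneg _ _ (/ z * (z + 1)) b); [lra|].
  exact (fun x t Hx => window_sum_bound x t Hx).
Qed.

Lemma window_sup_periodic t : window_sup (t + 1) = window_sup t.
Proof.
  apply (sup_family_eq _ _ (/ z * (z + 1)) b); [lra| |].
  - exact (fun x t Hx => window_sum_bound x t Hx).
  - intros x Hx. do 2 f_equal. unfold window_sum. apply sum_between_ext; [lra|].
    intros m _. rewrite Rmult_plus_distr_l, Rmult_1_r, e_add, e_INR. ring.
Qed.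

Lemma window_sum_le_sup x t : a < x <= b -> Cmod (window_sum t x) <= z * window_sup t.
Proof.
  intros Hx.
  assert (Hb : a < b <= b) by lra.
  destruct (sup_family_lub (fun x => a < x <= b) (fun x theta => / z * Cmod (window_sum theta x))
              (/ z * (z + 1)) b Hb (fun x t Hx => window_sum_bound x t Hx) t) as [H _].
  pose proof (H x Hx) as H1. fold window_sup in H1.
  apply Rmult_le_compat_l with (r := z) in H1; [|lra].
  rewrite <- Rmult_assoc, Rinv_r, Rmult_1_l in H1 by lra. exact H1.
Qed.

(* A single coefficient is recovered by integrating the exponential sum against [e (- m theta)]. *)
Lemma Cmod_phi_le_integral m : a < INR m <= b -> Cmod (phi m) <= z * RInt window_sup 0 1.
Proof.
  intros Hm. set (I := RInt window_sup 0 1).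
  assert (HI : 0 <= I) by (apply RInt_nonneg; [exact window_sup_continuous | exact window_sup_nonneg | lra]).
  (* The main argument ends by cancelling one factor [Cmod (phi m)], so a vanishing coefficient is
     treated separately. *)
  destruct (Cmod_ge_0 (phi m)) as [Hc|<-]; [|apply Rmult_le_pos; lra].
  (* A window that contains m and starts inside (a, b]; halving m - a keeps its left end above a. *)
  assert (Hx : exists x, a < x <= b /\ x < INR m <= x + z).
  { exists (INR m - Rmin z ((INR m - a) / 2)).
    pose proof (Rmin_l z ((INR m - a) / 2)). pose proof (Rmin_r z ((INR m - a) / 2)).
    assert (0 < Rmin z ((INR m - a) / 2)) by (apply Rmin_glb_lt; lra). lra. }
  destruct Hx as [x [Hx Hxm]].
  set (s := S (floorN x)). set (k := (floorN (x + z) - floorN x)%nat).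
  pose proof (floorN_spec x ltac:(lra)) as Hf1. pose proof (floorN_spec (x + z) ltac:(lra)) as Hf2.
  assert (Hs : (s <= m)%nat).
  { unfold s. assert (floorN x < m)%nat by (apply INR_lt; lra). lia. }
  assert (Hk : (m - s < k)%nat).
  { assert (m < S (floorN (x + z)))%nat by (apply INR_lt; rewrite S_INR; lra). unfold k, s in *. lia. }
  assert (Hws : forall t, window_sum t x
            = csum (fun i => Cmult (phi (s + i)%nat) (e (INR (s + i) * t))) k).
  { intros t. unfold window_sum. rewrite sum_between_csum by lra. reflexivity. }
  set (c := Cconj (phi m)).
  (* Real part of conj(phi m) e(-m t) times the window sum. Integration leaves only the index m - s,
     that is, the square of the modulus of phi m. *)
  set (V := fun t => rsum (fun i => fst (Cmult (Cmult c (phi (s + i)%nat))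
                        (e (IZR (Z.of_nat (s + i) - Z.of_nat m) * t)))) k).
  assert (HV : is_RInt V 0 1 (Cmod (phi m) ^ 2)).
  { set (v := fun i => if Nat.eq_dec i (m - s) then Cmod (phi m) ^ 2 else 0).
    replace (Cmod (phi m) ^ 2) with (rsum v k).
    - apply (is_RInt_rsum (fun i t => fst (Cmult (Cmult c (phi (s + i)%nat))
                        (e (IZR (Z.of_nat (s + i) - Z.of_nat m) * t)))) v).
      intros i Hi. unfold v. destruct (Nat.eq_dec i (m - s)) as [E|E].
      + replace (s + i)%nat with m by lia. rewrite Z.sub_diag.
        apply (is_RInt_ext (fun _ => Cmod (phi m) ^ 2)).
        * intros t _. rewrite Rmult_0_l. change 0 with (INR 0). rewrite e_INR, Cmult_1_r.
          unfold c. rewrite Cmult_comm, <- Cmod2_conj. reflexivity.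
        * apply is_RInt_const_R. ring.
      + apply is_RInt_harmonic. lia.
    - rewrite (rsum_single v k (m - s)); [|exact Hk|].
      + unfold v. destruct (Nat.eq_dec (m - s) (m - s)); [reflexivity|contradiction].
      + intros i _ Hi. unfold v. destruct (Nat.eq_dec i (m - s)); [contradiction|reflexivity]. }
  assert (HV2 : forall t, V t <= Cmod (phi m) * z * window_sup t).
  { intros t. eapply Rle_trans; [apply Rle_abs|].
    assert (E : V t = fst (Cmult (Cmult c (e (- (INR m * t)))) (window_sum t x))).
    { rewrite Hws, <- csum_scal, fst_csum. apply rsum_ext. intros i _. f_equal.
      replace (IZR (Z.of_nat (s + i) - Z.of_nat m) * t) with (- (INR m * t) + INR (s + i) * t)
        by (rewrite minus_IZR, <- !INR_IZR_INZ; ring).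
      rewrite e_add. ring. }
    rewrite E. eapply Rle_trans; [apply Rabs_fst_le_Cmod|].
    rewrite !Cmod_mult, Cmod_e, Rmult_1_r. unfold c. rewrite Cmod_conj, Rmult_assoc.
    apply Rmult_le_compat_l; [lra|]. apply window_sum_le_sup. exact Hx. }
  assert (Hle : Cmod (phi m) ^ 2 <= Cmod (phi m) * z * I).
  { apply (is_RInt_le V (fun t => scal (Cmod (phi m) * z) (window_sup t)) 0 1); [lra | exact HV | |].
    - apply (is_RInt_scal window_sup 0 1 (Cmod (phi m) * z)).
      apply (RInt_correct (V := R_CompleteNormedModule)). apply ex_RInt_cont. exact window_sup_continuous.
    - intros t _. apply HV2. }
  apply Rmult_le_reg_l with (Cmod (phi m)); [exact Hc|]. nra.
Qed.

End WindowSup.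

(** * Beatty sums on one window *)

(* If [i] is the first index that is [near], any further one [j] is paid for by [P (j - i)]. *)
Lemma pigeonhole_sum (P : nat -> R) kappa B : (forall d, 0 <= P d) -> 0 <= B ->
  forall k (near : nat -> Prop) (r : nat -> R),
  (forall i, (i < k)%nat -> r i <= kappa \/ (near i /\ r i <= B + kappa)) ->
  (forall i j, (i < j < k)%nat -> near i -> near j -> 1 <= P (j - i)%nat) ->
  rsum r k <= INR k * kappa + B * (1 + rsum (fun d => P (S d)) k).
Proof.
  intros HP HB. induction k as [|k IH]; intros near r Hr Hn.
  - simpl. lra.
  - rewrite rsum_S_l, S_INR. cbn [rsum]. pose proof (HP (S k)) as H0.
    destruct (Hr O ltac:(lia)) as [H1|[H1 H2]].
    + assert (H3 : rsum (fun i => r (S i)) k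
                   <= INR k * kappa + B * (1 + rsum (fun d => P (S d)) k)).
      { apply (IH (fun i => near (S i))).
        - intros i Hi. apply (Hr (S i)). lia.
        - intros i j Hij Hi Hj. apply (Hn (S i) (S j)); [lia | exact Hi | exact Hj]. }
      nra.
    (* Index 0 is near: every later near index is compared with it directly, without the induction
       hypothesis. *)
    + assert (H3 : rsum (fun i => r (S i)) k <= rsum (fun i => kappa + B * P (S i)) k).
      { apply rsum_le. intros i Hi. pose proof (HP (S i)).
        destruct (Hr (S i) ltac:(lia)) as [H4|[H4 H5]]; [nra|].
        pose proof (Hn O (S i) ltac:(lia) H1 H4) as H6. rewrite Nat.sub_0_r in H6. nra. }
      rewrite rsum_plus, rsum_const, rsum_scal in H3. nra.
Qed.

(** The constant [(0, - (1 / 2))] is 1/(2i). *)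
Lemma RtoC_sin y : RtoC (sin (2 * PI * y)) = Cmult (0, - (1 / 2)) (Cminus (e y) (e (- y))).
Proof.
  unfold e. replace (2 * PI * - y) with (- (2 * PI * y)) by ring.
  rewrite sin_neg, cos_neg. unfold RtoC, Cmult, Cminus, Cplus, Copp; simpl. f_equal; field.
Qed.

Lemma Cmod_half_i : Cmod (0, - (1 / 2)) = 1 / 2.
Proof.
  unfold Cmod; simpl. replace (0 * (0 * 1) + - (1 / 2) * (- (1 / 2) * 1)) with (Rsqr (1 / 2))
    by (unfold Rsqr; field). rewrite sqrt_Rsqr by lra. reflexivity.
Qed.

Lemma Cmod_csum_rsum (phi : nat -> C) (V : nat -> nat -> R) k n :
  Cmod (csum (fun i => Cmult (phi i) (RtoC (rsum (fun h => V h i) n))) k)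
  <= rsum (fun h => Cmod (csum (fun i => Cmult (phi i) (RtoC (V h i))) k)) n.
Proof.
  induction n as [|n IH]; cbn [rsum].
  - rewrite (csum_ext _ (fun i => Cmult (RtoC 0) (phi i))) by (intros; ring).
    rewrite csum_scal, Cmod_mult, Cmod_0. lra.
  - rewrite (csum_ext _ (fun i => Cplus (Cmult (phi i) (RtoC (rsum (fun h => V h i) n)))
                                        (Cmult (phi i) (RtoC (V n i)))))
      by (intros; rewrite RtoC_plus; ring).
    rewrite csum_plus. eapply Rle_trans; [apply Cmod_triangle|]. lra.
Qed.

Lemma Cmod_csum_Rscal (phi : nat -> C) (v : nat -> R) c k : 0 <= c ->
  Cmod (csum (fun i => Cmult (phi i) (RtoC (c * v i))) k)
  = c * Cmod (csum (fun i => Cmult (phi i) (RtoC (v i))) k).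
Proof.
  intros Hc. rewrite (csum_ext _ (fun i => Cmult (RtoC c) (Cmult (phi i) (RtoC (v i)))))
    by (intros; rewrite RtoC_mult; ring).
  rewrite csum_scal, Cmod_mult, Cmod_R, Rabs_pos_eq by exact Hc. reflexivity.
Qed.

Section LinearWindow.

Variables (phi : nat -> C) (s k : nat) (u x beta : R).

Definition exp_sum (theta : R) : C :=
  csum (fun i => Cmult (phi (s + i)%nat) (e (INR (s + i) * theta))) k.

(** The tangent of g at x, with u = g(x) and beta = g'(x), evaluated at the integer s + i. *)
Definition ell (i : nat) : R := u + (INR (s + i) - x) * beta.

(** One step along the tangent multiplies e(h ell) by e(h beta), so the factor e(h beta) - 1 leaves
    the sum; the remaining sums are exponential sums at h beta and - h beta. *)
Lemma sin_sum_bound h :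
  Cmod (csum (fun i => Cmult (phi (s + i)%nat)
     (RtoC (sin (2 * PI * (h * (ell i + beta))) - sin (2 * PI * (h * ell i))))) k)
  <= 1 / 2 * Cmod (Cminus (e (h * beta)) (RtoC 1))
     * (Cmod (exp_sum (h * beta)) + Cmod (exp_sum (- (h * beta)))).
Proof.
  set (c0 := u - x * beta).
  rewrite (csum_ext _ (fun i => Cminus
     (Cmult (Cmult (0, - (1 / 2)) (Cmult (Cminus (e (h * beta)) (RtoC 1)) (e (h * c0))))
        (Cmult (phi (s + i)%nat) (e (INR (s + i) * (h * beta)))))
     (Cmult (Cmult (0, - (1 / 2)) (Cmult (Cminus (e (- (h * beta))) (RtoC 1)) (e (- (h * c0)))))
        (Cmult (phi (s + i)%nat) (e (INR (s + i) * - (h * beta))))))).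
  - rewrite csum_minus, !csum_scal. fold (exp_sum (h * beta)). fold (exp_sum (- (h * beta))).
    assert (E : Cmod (Cminus (e (- (h * beta))) (RtoC 1)) = Cmod (Cminus (e (h * beta)) (RtoC 1))).
    { rewrite !Cmod_e_sub_1. replace (PI * - (h * beta)) with (- (PI * (h * beta))) by ring.
      rewrite sin_neg, Rabs_Ropp. reflexivity. }
    unfold Cminus at 1. eapply Rle_trans; [apply Cmod_triangle|].
    rewrite Cmod_opp, !Cmod_mult, !Cmod_e, E, Cmod_half_i. right; ring.
  - intros i _. rewrite RtoC_minus, !RtoC_sin.
    set (m := INR (s + i)).
    replace (h * (ell i + beta)) with (h * beta + (h * c0 + m * (h * beta)))
      by (unfold ell, c0; fold m; ring).
    replace (h * ell i) with (h * c0 + m * (h * beta)) by (unfold ell, c0; fold m; ring).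
    rewrite !Ropp_plus_distr.
    replace (- (m * (h * beta))) with (m * - (h * beta)) by ring.
    rewrite !e_add. ring.
Qed.

(** The modulus of e(h beta) - 1 is at most 2 and at most 2 PI h beta; divided by 2 PI h this gives
    the two parts of the minimum. A Fejer mean averages partial sums, each of which is bounded by
    the full sum of the nonnegative bounds. *)
Lemma saw_sum_bound n : (0 < n)%nat -> 0 <= beta ->
  Cmod (csum (fun i => Cmult (phi (s + i)%nat) (RtoC (saw n (ell i + beta) - saw n (ell i)))) k)
  <= rsum (fun h => Rmin (/ INR (S h)) beta
        * (Cmod (exp_sum (INR (S h) * beta)) + Cmod (exp_sum (- (INR (S h) * beta))))) n.
Proof.
  intros Hn Hb. assert (HN : 0 < INR n) by (apply lt_0_INR; exact Hn). pose proof PI_RGT_0 as HP.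
  set (V := fun (h i : nat) => sin (2 * PI * (INR (S h) * (ell i + beta)))
                             - sin (2 * PI * (INR (S h) * ell i))).
  rewrite (csum_ext _ (fun i => Cmult (phi (s + i)%nat)
     (RtoC (/ INR n * rsum (fun j => rsum (fun h => / (PI * INR (S h)) * V h i) j) n)))).
  2:{ intros i _. do 2 f_equal. unfold saw. rewrite <- Rmult_minus_distr_l. f_equal.
      rewrite <- rsum_minus. apply rsum_ext. intros j _.
      rewrite <- rsum_minus. apply rsum_ext. intros h _. unfold V, Rdiv. ring. }
  set (bd := fun h : nat => Rmin (/ INR (S h)) beta
        * (Cmod (exp_sum (INR (S h) * beta)) + Cmod (exp_sum (- (INR (S h) * beta))))).
  assert (Hbd0 : forall h, 0 <= bd h).
  { intros h. assert (0 < INR (S h)) by (apply lt_0_INR; lia). apply Rmult_le_pos.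
    - apply Rmin_glb; [left; apply Rinv_0_lt_compat; assumption | exact Hb].
    - pose proof (Cmod_ge_0 (exp_sum (INR (S h) * beta))).
      pose proof (Cmod_ge_0 (exp_sum (- (INR (S h) * beta)))). lra. }
  assert (Hbd : forall h, / (PI * INR (S h)) * Cmod (csum (fun i => Cmult (phi (s + i)%nat) (RtoC (V h i))) k) <= bd h).
  { intros h. assert (HS : 0 < INR (S h)) by (apply lt_0_INR; lia).
    unfold V, bd. set (H := INR (S h)) in *. set (E := Cmod (exp_sum _) + _).
    assert (HE : 0 <= E) by (pose proof (Cmod_ge_0 (exp_sum (H * beta)));
      pose proof (Cmod_ge_0 (exp_sum (- (H * beta)))); unfold E; lra).
    pose proof (Rinv_0_lt_compat (PI * H) ltac:(apply Rmult_lt_0_compat; lra)) as HPH.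
    apply Rle_trans with (/ (PI * H) * (1 / 2 * Cmod (Cminus (e (H * beta)) (RtoC 1)) * E)).
    - apply Rmult_le_compat_l; [lra | apply sin_sum_bound].
    - rewrite <- !Rmult_assoc. apply Rmult_le_compat_r; [exact HE|].
      pose proof PI2_3_2. apply Rmin_glb.
      + pose proof (Cmod_e_sub_1_le2 (H * beta)) as H2.
        apply Rle_trans with (/ (PI * H) * (1 / 2) * 2).
        * apply Rmult_le_compat_l; lra.
        * replace (/ (PI * H) * (1 / 2) * 2) with (/ (PI * H)) by (field; split; lra).
          apply Rinv_le_contravar; nra.
      + pose proof (Cmod_e_sub_1_le (H * beta)) as H2.
        rewrite Rabs_pos_eq in H2 by (apply Rmult_le_pos; lra).
        apply Rle_trans with (/ (PI * H) * (1 / 2) * (2 * PI * (H * beta))).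
        * apply Rmult_le_compat_l; lra.
        * right. field. split; lra. }
  rewrite Cmod_csum_Rscal by (left; apply Rinv_0_lt_compat; exact HN).
  apply Rmult_le_reg_l with (INR n); [exact HN|]. rewrite <- Rmult_assoc, Rinv_r, Rmult_1_l by lra.
  eapply Rle_trans; [apply (Cmod_csum_rsum (fun i => phi (s + i)%nat)
     (fun j i => rsum (fun h => / (PI * INR (S h)) * V h i) j))|].
  rewrite <- rsum_const. apply rsum_le. intros j Hj.
  eapply Rle_trans; [apply (Cmod_csum_rsum (fun i => phi (s + i)%nat)
     (fun h i => / (PI * INR (S h)) * V h i))|].
  apply Rle_trans with (rsum bd j); [|apply rsum_le_length; [lia | intros; apply Hbd0]].
  apply rsum_le. intros h _. rewrite Cmod_csum_Rscal; [apply Hbd|].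
  left. apply Rinv_0_lt_compat. apply Rmult_lt_0_compat; [lra | apply lt_0_INR; lia].
Qed.

Variables (g : nat -> R) (delta mu : R) (n n1 : nat).
Hypothesis Hn : (0 < n)%nat.
Hypothesis Hn1 : (0 < n1)%nat.
Hypothesis Hbeta : 0 <= beta.
Hypothesis Hdelta : 0 < delta < 1.
Hypothesis Hdelta1 : 2 * delta <= / (2 * INR n1).
Hypothesis Hg : forall i, (i <= k)%nat -> g i <= ell i <= g i + delta.
Hypothesis Hmu : forall i, (i < k)%nat -> Cmod (phi (s + i)%nat) <= mu.
Hypothesis Hmu0 : 0 <= mu.

(** Two errors at once: the ceiling of g against that of its tangent, and the sawtooth against its
    Fejer mean. *)
Definition ceil_err (i : nat) : R := IZR (ceil (g i)) - ell i - 1 / 2 - saw n (ell i).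

(** As g <= ell <= g + delta with delta < 1, the two ceilings differ by at most 1, and they differ
    only if an integer lies in [g, ell), hence within delta of ell. The 2 covers this 1 and the 1/2
    of [saw_approx]. *)
Lemma ceil_err_cases i : (i <= k)%nat ->
  Rabs (ceil_err i) <= / (INR n * delta) \/
  ((exists z : Z, Rabs (ell i - IZR z) <= delta) /\
   Rabs (ceil_err i) <= 2 + / (INR n * delta)).
Proof.
  intros Hi. pose proof (Hg i Hi) as H.
  pose proof (ceil_spec (ell i)) as H1. pose proof (ceil_spec (g i)) as H2.
  destruct (classic (exists z : Z, Rabs (ell i - IZR z) <= delta)) as [Hz|Hz].
  - right. split; [exact Hz|].
    assert (HN : 0 < INR n) by (apply lt_0_INR; exact Hn).
    assert (0 < / (INR n * delta)) by (apply Rinv_0_lt_compat; apply Rmult_lt_0_compat; lra).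
    pose proof (saw_approx n (ell i) Hn) as H3. apply Rabs_le_between in H3.
    unfold ceil_err. apply Rabs_le.
    assert (IZR (ceil (g i)) <= IZR (ceil (ell i))) by (apply IZR_le, ceil_mono; lra).
    assert (IZR (ceil (ell i)) <= IZR (ceil (g i) + 1)) as Hc4.
    { apply IZR_le. assert (ceil (ell i) < ceil (g i) + 2)%Z; [|lia].
      apply lt_IZR. rewrite plus_IZR. lra. }
    rewrite plus_IZR in Hc4. lra.
  - left. unfold ceil_err. replace (ceil (g i)) with (ceil (ell i)).
    + apply saw_approx_far; [exact Hn | lra|]. intros z. apply Rnot_lt_le. intros Hlt.
      apply Hz. exists z. lra.
    + symmetry. apply ceil_unique. split; [lra|]. apply Rnot_le_lt. intros Hle.
      apply Hz. exists (ceil (ell i) - 1)%Z. rewrite minus_IZR.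
      apply Rabs_le. lra.
Qed.

(** At least 1 whenever d beta is within 1/(2 n1) of an integer, by [fejer_ge]. As a smooth periodic
    function of d beta it can later be integrated over beta, which an indicator of nearness would
    not allow as easily. *)
Definition near_weight (d : nat) : R := 16 / INR n1 * fejer n1 (INR d * beta).

Lemma near_weight_nonneg d : 0 <= near_weight d.
Proof.
  assert (HN : 0 < INR n1) by (apply lt_0_INR; exact Hn1).
  apply Rmult_le_pos; [|apply fejer_nonneg; exact Hn1].
  left. apply Rdiv_lt_0_compat; lra.
Qed.

Lemma ceil_err_sum :
  rsum (fun i => Rabs (ceil_err i)) (S k)
  <= INR (S k) * / (INR n * delta) + 2 * (1 + rsum (fun d => near_weight (S d)) (S k)).
Proof.
  apply (pigeonhole_sum near_weight _ 2 near_weight_nonneg ltac:(lra) (S k)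
           (fun i => exists z : Z, Rabs (ell i - IZR z) <= delta)).
  - intros i Hi. apply ceil_err_cases. lia.
  (* Subtracting the two integers puts (j - i) beta within 2 delta of z2 - z1, which [Hdelta1]
     brings into the range of [fejer_ge]. *)
  - intros i j Hij [z1 Hz1] [z2 Hz2]. apply (fejer_ge n1 _ (z2 - z1)); [exact Hn1|].
    eapply Rle_trans; [|exact Hdelta1]. rewrite minus_INR by lia. rewrite minus_IZR.
    replace ((INR j - INR i) * beta - (IZR z2 - IZR z1))
      with ((ell j - IZR z2) - (ell i - IZR z1)) by (unfold ell; rewrite !plus_INR; ring).
    eapply Rle_trans; [apply Rabs_triang|]. rewrite Rabs_Ropp. lra.
Qed.

(** An increment of the ceiling minus beta is an increment of [saw] along the tangent plus an
    increment of [ceil_err]. The k increments involve S k points, each at most twice, whence the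
    factor 2. *)
Lemma linear_window_bound :
  Cmod (csum (fun i => Cmult (phi (s + i)%nat)
          (RtoC (IZR (ceil (g (S i))) - IZR (ceil (g i)) - beta))) k)
  <= mu * (2 * (INR (S k) * / (INR n * delta)
                + 2 * (1 + rsum (fun d => near_weight (S d)) (S k))))
     + rsum (fun h => Rmin (/ INR (S h)) beta
        * (Cmod (exp_sum (INR (S h) * beta)) + Cmod (exp_sum (- (INR (S h) * beta))))) n.
Proof.
  rewrite (csum_ext _ (fun i => Cplus
      (Cmult (phi (s + i)%nat) (RtoC (ceil_err (S i) - ceil_err i)))
      (Cmult (phi (s + i)%nat) (RtoC (saw n (ell i + beta) - saw n (ell i)))))).
  2:{ intros i _. rewrite <- Cmult_plus_distr_l, <- RtoC_plus. do 2 f_equal.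
      unfold ceil_err.
      assert (E : ell (S i) = ell i + beta) by (unfold ell; rewrite Nat.add_succ_r, S_INR; ring).
      rewrite E. ring. }
  rewrite csum_plus. eapply Rle_trans; [apply Cmod_triangle|].
  apply Rplus_le_compat; [|apply saw_sum_bound; [exact Hn | exact Hbeta]].
  pose proof ceil_err_sum as H. set (B := INR (S k) * _ + _) in *.
  eapply Rle_trans; [apply Cmod_csum|].
  apply Rle_trans with (rsum (fun i => mu * (Rabs (ceil_err (S i)) + Rabs (ceil_err i))) k).
  - apply rsum_le. intros i Hi. rewrite Cmod_mult, Cmod_R.
    apply Rmult_le_compat; [apply Cmod_ge_0 | apply Rabs_pos | apply Hmu; exact Hi|].
    eapply Rle_trans; [apply Rabs_triang|]. rewrite Rabs_Ropp. lra.
  - rewrite rsum_scal, rsum_plus. apply Rmult_le_compat_l; [exact Hmu0|].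
    pose proof (rsum_S_l (fun i => Rabs (ceil_err i)) k) as H1.
    cbn [rsum] in H, H1. pose proof (Rabs_pos (ceil_err 0)). pose proof (Rabs_pos (ceil_err k)). lra.
Qed.

End LinearWindow.

(** * The convex function and its inverse *)

Section ConvexFunction.

Variables f finv : R -> R.
Hypothesis Hdiff : forall x, 0 < x ->
  ex_derive f x /\ ex_derive (Derive f) x /\ continuous (Derive (Derive f)) x.
Hypothesis Hpos : forall x, 0 < x -> 0 < f x /\ 0 < Derive f x /\ 0 < Derive (Derive f) x.
Hypothesis Hinv : forall x, 0 < x -> finv (f x) = x.

Notation f1 := (Derive f).
Notation f2 := (Derive (Derive f)).

Lemma is_derive_f x : 0 < x -> is_derive f x (f1 x).
Proof. intros Hx. apply Derive_correct. apply Hdiff. exact Hx. Qed.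

Lemma is_derive_f1 x : 0 < x -> is_derive f1 x (f2 x).
Proof. intros Hx. apply Derive_correct. apply Hdiff. exact Hx. Qed.

Lemma f1_mono x y : 0 < x <= y -> f1 x <= f1 y.
Proof.
  intros H. destruct (mean_value f1 f2 x y) as [c [Hc E]]; [lra | intros; apply is_derive_f1; lra|].
  destruct (Hpos c ltac:(lra)) as [_ [_ H2]]. nra.
Qed.

Lemma f_growth x y : 0 < x <= y -> f x + f1 x * (y - x) <= f y <= f x + f1 y * (y - x).
Proof.
  intros H. destruct (mean_value f f1 x y) as [c [Hc E]]; [lra | intros; apply is_derive_f; lra|].
  pose proof (f1_mono x c ltac:(lra)). pose proof (f1_mono c y ltac:(lra)). nra.
Qed.

Lemma f_incr x y : 0 < x < y -> f x < f y.
Proof.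
  intros H. pose proof (f_growth x y ltac:(lra)). destruct (Hpos x ltac:(lra)) as [_ [H1 _]]. nra.
Qed.

Lemma f_le_cancel x y : 0 < x -> 0 < y -> f x <= f y -> x <= y.
Proof.
  intros Hx Hy H. apply Rnot_lt_le. intros Hlt. pose proof (f_incr y x ltac:(lra)). lra.
Qed.

Lemma f_lt_cancel x y : 0 < x -> 0 < y -> f x < f y -> x < y.
Proof.
  intros Hx Hy H. apply Rnot_le_lt. intros [Hlt|E].
  - pose proof (f_incr y x ltac:(lra)). lra.
  - subst. lra.
Qed.

Lemma continuity_pt_f x : 0 < x -> continuity_pt f x.
Proof.
  intros Hx. apply continuity_pt_filterlim. apply (ex_derive_continuous f). apply Hdiff. exact Hx.
Qed.

(** [finv] is only known as a left inverse, so y must first be shown to be a value of f: the tangent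
    at s bounds the convex f from below, and the intermediate value theorem applies. *)
Lemma finv_spec s y : 0 < s -> f s <= y -> s <= finv y /\ f (finv y) = y.
Proof.
  intros Hs Hy. destruct (Hpos s Hs) as [_ [H1 _]].
  (* At this point the tangent at s has the value y + f'(s), which exceeds y. *)
  set (t := s + (y - f s) / f1 s + 1).
  assert (H0 : 0 <= (y - f s) / f1 s) by (apply Rdiv_le_0_compat; lra).
  assert (Ht : y <= f t).
  { pose proof (f_growth s t ltac:(unfold t; lra)) as [H _].
    assert (f1 s * (t - s) = y - f s + f1 s) by (unfold t; field; lra). lra. }
  destruct (f_interv_is_interv f s t y) as [v [Hv E]]; [unfold t; lra | lra | |].
  - intros x Hx. apply continuity_pt_f. lra.
  - rewrite <- E, Hinv by lra. split; [lra | reflexivity].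
Qed.

Lemma finv_mono s y y' : 0 < s -> f s <= y <= y' -> finv y <= finv y'.
Proof.
  intros Hs H. destruct (finv_spec s y Hs ltac:(lra)) as [H1 H2].
  destruct (finv_spec s y' Hs ltac:(lra)) as [H3 H4].
  apply f_le_cancel; lra.
Qed.

(** By the mean value theorem the difference quotient is 1/f'(c) with c close to finv y, and 1/f' is
    continuous there. *)
Lemma is_derive_finv s y : 0 < s -> f s < y -> is_derive finv y (/ f1 (finv y)).
Proof.
  intros Hs Hy. destruct (finv_spec s y Hs ltac:(lra)) as [Hv0 Ev]. set (v := finv y) in *.
  assert (Hv : s < v) by (apply f_lt_cancel; lra).
  destruct (Hpos v ltac:(lra)) as [_ [H1 _]].
  apply is_derive_Reals. intros eps Heps.
  assert (Hc : continuity_pt (fun x => / f1 x) v).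
  { apply continuity_pt_filterlim. apply (ex_derive_continuous (fun x => / f1 x)).
    exists (- f2 v / (f1 v)^2). apply (is_derive_inv f1); [apply is_derive_f1; lra | lra]. }
  destruct (Hc eps Heps) as [r [Hr Hcr]].
  set (d := Rmin r (v - s) / 2).
  assert (Hd : 0 < d <= (v - s) / 2 /\ d < r).
  { pose proof (Rmin_l r (v - s)). pose proof (Rmin_r r (v - s)).
    assert (0 < Rmin r (v - s)) by (apply Rmin_glb_lt; lra). unfold d; lra. }
  pose proof (f_incr (v - d) v ltac:(lra)) as Hl. pose proof (f_incr v (v + d) ltac:(lra)) as Hu.
  pose proof (f_incr s (v - d) ltac:(lra)) as Hsl.
  assert (Hm : 0 < Rmin (y - f (v - d)) (f (v + d) - y)) by (apply Rmin_glb_lt; lra).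
  (* For such h the value y + h stays between f(v - d) and f(v + d), which traps finv(y + h) within
     d of v. *)
  exists (mkposreal _ Hm). intros h Hh Hhm. simpl in Hhm.
  pose proof (Rmin_l (y - f (v - d)) (f (v + d) - y)).
  pose proof (Rmin_r (y - f (v - d)) (f (v + d) - y)).
  apply Rabs_lt_between in Hhm.
  destruct (finv_spec s (y + h) Hs ltac:(lra)) as [Hw0 Ew]. set (w := finv (y + h)) in *.
  assert (Hw1 : v - d < w) by (apply f_lt_cancel; lra).
  assert (Hw2 : w < v + d) by (apply f_lt_cancel; lra).
  assert (Hmv : exists c, v - d <= c <= v + d /\ f w - f v = f1 c * (w - v)).
  { destruct (Rle_dec v w) as [Hvw|Hvw].
    - destruct (mean_value f f1 v w Hvw) as [c [Hc0 E]]; [intros; apply is_derive_f; lra|].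
      exists c. split; [lra | exact E].
    - destruct (mean_value f f1 w v ltac:(lra)) as [c [Hc0 E]]; [intros; apply is_derive_f; lra|].
      exists c. split; [lra|]. lra. }
  destruct Hmv as [c [Hc1 E]].
  destruct (Hpos c ltac:(lra)) as [_ [H2 _]].
  change (finv y) with v. replace ((w - v) / h) with (/ f1 c).
  (* [continuity_pt] constrains only points different from v, so c = v is a case of its own. *)
  - destruct (Req_dec c v) as [Ecv|Hne].
    { change (Rabs (/ f1 c - / f1 v) < eps). rewrite Ecv, Rminus_diag, Rabs_R0. exact Heps. }
    apply (Hcr c). split.
    + split; [exact I | intros E'; apply Hne; symmetry; exact E'].
    + simpl. unfold R_dist. apply Rabs_def1; lra.
  - rewrite Ew, Ev in E. replace (y + h - y) with h in E by ring.
    assert (w - v <> 0) by (intros E0; rewrite E0 in E; lra).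
    rewrite E. field. split; lra.
Qed.

Lemma Derive_finv s y : 0 < s -> f s < y -> Derive finv y = / f1 (finv y).
Proof. intros Hs Hy. apply is_derive_unique. apply (is_derive_finv s); assumption. Qed.

Definition tangent_slope (y : R) : R := / f1 (finv y).
Definition tangent_slope' (y : R) : R := - (f2 (finv y) / (f1 (finv y))^3).

Lemma is_derive_slope s y : 0 < s -> f s < y -> is_derive tangent_slope y (tangent_slope' y).
Proof.
  intros Hs Hy. destruct (finv_spec s y Hs ltac:(lra)) as [Hv0 Ev].
  destruct (Hpos (finv y) ltac:(lra)) as [_ [H1 _]].
  unfold tangent_slope, tangent_slope'.
  replace (- (f2 (finv y) / f1 (finv y) ^ 3))
    with (scal (/ f1 (finv y)) (- f2 (finv y) / (f1 (finv y))^2))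
    by (unfold scal; simpl; unfold mult; simpl; field; lra).
  apply (is_derive_comp (fun v => / f1 v) finv).
  - apply (is_derive_inv f1); [apply is_derive_f1; lra | lra].
  - apply (is_derive_finv s); assumption.
Qed.

Lemma continuous_slope' s y : 0 < s -> f s < y -> continuous tangent_slope' y.
Proof.
  intros Hs Hy. destruct (finv_spec s y Hs ltac:(lra)) as [Hv0 Ev].
  destruct (Hpos (finv y) ltac:(lra)) as [_ [H1 _]].
  apply (continuous_comp finv (fun v => - (f2 v / (f1 v)^3))).
  - apply (ex_derive_continuous finv). exists (/ f1 (finv y)). apply (is_derive_finv s); assumption.
  - apply (continuous_opp (fun v => f2 v / (f1 v)^3)).
    apply (continuous_mult f2 (fun v => / (f1 v)^3)).
    + apply Hdiff. lra.
    + apply (continuous_comp f1 (fun w => / w^3)).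
      * apply (ex_derive_continuous f1). apply Hdiff. lra.
      * apply (ex_derive_continuous (fun w => / w^3)). auto_derive.
        apply Rgt_not_eq. repeat apply Rmult_lt_0_compat; lra.
Qed.

Variable c2 : R.
Hypothesis Hreg : forall x y, 0 < x -> x <= y -> y <= 2 * x ->
  1 / 2 * f2 x <= f2 y /\ f2 y <= c2 * f2 x.

Lemma c2_ge_1 : 1 <= c2.
Proof.
  destruct (Hreg 1 1 ltac:(lra) ltac:(lra) ltac:(lra)) as [_ H].
  destruct (Hpos 1 ltac:(lra)) as [_ [_ H2]]. nra.
Qed.

(** On [x/2, x] the second derivative is at least f''(x)/c2, and f' increases there by at most
    f'(x). *)
Lemma x_f2_le_f1 x : 0 < x -> x * f2 x <= 2 * c2 * f1 x.
Proof.
  intros Hx. destruct (mean_value f1 f2 (x / 2) x) as [c [Hc E]];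
    [lra | intros; apply is_derive_f1; lra|].
  destruct (Hreg c x ltac:(lra) ltac:(lra) ltac:(lra)) as [_ H].
  destruct (Hpos (x / 2) ltac:(lra)) as [_ [H1 _]]. pose proof c2_ge_1.
  assert (f2 c * (x / 2) <= f1 x) by lra.
  assert (c2 * (f2 c * (x / 2)) <= c2 * f1 x) by (apply Rmult_le_compat_l; lra). nra.
Qed.

(** From x to 2x the derivative gains at most c2 x f''(x), which [x_f2_le_f1] bounds by 2 c2^2
    f'(x). *)
Lemma f1_double x : 0 < x -> f1 (2 * x) <= (1 + 2 * c2 * c2) * f1 x.
Proof.
  intros Hx. destruct (mean_value f1 f2 x (2 * x)) as [c [Hc E]];
    [lra | intros; apply is_derive_f1; lra|].
  destruct (Hreg x c ltac:(lra) ltac:(lra) ltac:(lra)) as [_ H].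
  pose proof (x_f2_le_f1 x Hx). pose proof c2_ge_1.
  assert (c2 * (x * f2 x) <= c2 * (2 * c2 * f1 x)) by (apply Rmult_le_compat_l; lra).
  replace (2 * x - x) with x in E by ring.
  assert (f2 c * x <= c2 * f2 x * x) by (apply Rmult_le_compat_r; lra). lra.
Qed.

(** This is where c_1 >= 1/2 is decisive: passing from w/2 to w does not decrease t f''(t), so
    arbitrarily many doublings lose nothing. The factor 2 comes from the single incomplete
    doubling. *)
Lemma x_f2_quasi_mono x y : 0 < x <= y -> x * f2 x <= 2 * (y * f2 y).
Proof.
  intros Hxy.
  assert (H : forall n y, x <= y -> y <= 2 ^ n * x -> x * f2 x <= 2 * (y * f2 y)).
  { intros n. induction n as [|n IH]; intros w Hw Hn.
    - simpl in Hn. assert (w = x) by lra. subst w.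
      destruct (Hpos x ltac:(lra)) as [_ [_ H2]]. nra.
    - destruct (Rle_dec w (2 * x)) as [Hle|Hle].
      + destruct (Hreg x w ltac:(lra) Hw Hle) as [H1 _].
        destruct (Hpos x ltac:(lra)) as [_ [_ H2]].
        assert (w * (1 / 2 * f2 x) <= w * f2 w) by (apply Rmult_le_compat_l; lra).
        assert (x * f2 x <= w * f2 x) by (apply Rmult_le_compat_r; lra). lra.
      + pose proof (IH (w / 2) ltac:(lra) ltac:(simpl in Hn; lra)) as H1.
        destruct (Hreg (w / 2) w ltac:(lra) ltac:(lra) ltac:(lra)) as [H2 _].
        assert (w * (1 / 2 * f2 (w / 2)) <= w * f2 w) by (apply Rmult_le_compat_l; lra). lra. }
  destruct (Pow_x_infinity 2 ltac:(rewrite Rabs_pos_eq; lra) (y / x)) as [n Hn].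
  apply (H n); [lra|]. pose proof (Hn n (le_n n)) as H1.
  rewrite Rabs_pos_eq in H1 by (apply pow_le; lra).
  apply Rge_le in H1. apply Rmult_le_compat_r with (r := x) in H1; [|lra].
  unfold Rdiv in H1. rewrite Rmult_assoc, Rinv_l in H1 by lra. lra.
Qed.

Lemma ln_ge_half x : 2 <= x -> 1 / 2 <= ln x.
Proof.
  intros Hx. pose proof ln_lt_2. destruct Hx as [Hx|<-]; [|lra].
  pose proof (ln_increasing 2 x ltac:(lra) Hx). lra.
Qed.

(* By quasi-monotonicity [f2 t <= 2 x (f2 x) / t] on [1, x], which integrates to a logarithm. *)
Lemma f1_le_log x : 2 <= x -> f1 x <= (2 + 4 * (f1 1 / f2 1)) * (x * f2 x * ln x).
Proof.
  intros Hx. destruct (Hpos 1 ltac:(lra)) as [_ [H1 H2]].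
  destruct (Hpos x ltac:(lra)) as [_ [H3 H4]].
  pose proof (ln_ge_half x Hx) as HL. set (M := x * f2 x) in *.
  assert (HM : 0 < M) by (apply Rmult_lt_0_compat; lra).
  pose proof (x_f2_quasi_mono 1 x ltac:(lra)) as H5. fold M in H5. rewrite Rmult_1_l in H5.
  assert (H6 : f1 x - 2 * M * ln x <= f1 1 - 2 * M * ln 1).
  { apply (antitone_of_deriv (fun t => f1 t - 2 * M * ln t) (fun t => f2 t - 2 * M * / t)); [lra| |].
    - intros t Ht. apply (is_derive_minus f1 (fun t => 2 * M * ln t)).
      + apply is_derive_f1. lra.
      + apply is_derive_scal. apply is_derive_ln. lra.
    - intros t Ht. pose proof (x_f2_quasi_mono t x ltac:(lra)) as H7. fold M in H7.
      apply Rmult_le_reg_l with t; [lra|]. rewrite Rmult_0_r.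
      replace (t * (f2 t - 2 * M * / t)) with (t * f2 t - 2 * M) by (field; lra). lra. }
  rewrite ln_1, Rmult_0_r, Rminus_0_r in H6.
  (* The boundary value at 1 is absorbed with f''(1) <= 2 M and ln x >= 1/2. *)
  assert (H7 : f1 1 <= 4 * (f1 1 / f2 1) * (M * ln x)).
  { replace (f1 1) with (f1 1 / f2 1 * f2 1) at 1 by (field; lra).
    assert (0 < f1 1 / f2 1) by (apply Rdiv_lt_0_compat; lra).
    rewrite (Rmult_comm 4), Rmult_assoc. apply Rmult_le_compat_l; [lra|].
    assert (M * (1 / 2) <= M * ln x) by (apply Rmult_le_compat_l; lra). lra. }
  lra.
Qed.

Section Range.

Variable A : R.
Hypothesis HA : 0 < A.

Lemma finv_range y : f A <= y <= f (2 * A) -> A <= finv y <= 2 * A /\ f (finv y) = y.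
Proof.
  intros Hy. destruct (finv_spec A y HA ltac:(lra)) as [H1 H2]. split; [|exact H2].
  split; [exact H1|]. apply f_le_cancel; lra.
Qed.

(** Differentiability of [finv] at y needs a point whose value is strictly below y; A/2 serves at
    the endpoint y = f(A). *)
Lemma half_lt : f (A / 2) < f A.
Proof. apply f_incr. lra. Qed.

Lemma slope_bounds y : f A <= y <= f (2 * A) -> 0 < tangent_slope y <= / f1 A.
Proof.
  intros Hy. destruct (finv_range y Hy) as [H1 _]. unfold tangent_slope.
  destruct (Hpos A HA) as [_ [H2 _]]. pose proof (f1_mono A (finv y) ltac:(lra)).
  split; [apply Rinv_0_lt_compat; lra | apply Rinv_le_contravar; lra].
Qed.

(** The rate at which the slope is forced to decrease, the [lam] of the substitution lemma;
    [slope'_lower] is the matching bound for its total variation. *)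
Lemma slope'_upper y : f A <= y <= f (2 * A) -> tangent_slope' y <= - (f2 A / 2 / (f1 (2 * A))^3).
Proof.
  intros Hy. destruct (finv_range y Hy) as [H1 _]. unfold tangent_slope'. apply Ropp_le_contravar.
  destruct (Hpos A HA) as [_ [H2 H3]].
  destruct (Hreg A (finv y) HA ltac:(lra) ltac:(lra)) as [H4 _].
  pose proof (f1_mono (finv y) (2 * A) ltac:(lra)) as H5.
  destruct (Hpos (finv y) ltac:(lra)) as [_ [H6 _]].
  assert (0 < (f1 (finv y))^3) by (apply pow_lt; exact H6).
  apply Rmult_le_compat; [lra | left; apply Rinv_0_lt_compat; apply pow_lt; lra | lra|].
  apply Rinv_le_contravar; [assumption|]. apply pow_incr. lra.
Qed.

Lemma slope'_lower y : f A <= y <= f (2 * A) -> - (c2 * f2 A / (f1 A)^3) <= tangent_slope' y.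
Proof.
  intros Hy. destruct (finv_range y Hy) as [H1 _]. unfold tangent_slope'. apply Ropp_le_contravar.
  destruct (Hpos A HA) as [_ [H2 H3]].
  destruct (Hreg A (finv y) HA ltac:(lra) ltac:(lra)) as [_ H4].
  pose proof (f1_mono A (finv y) ltac:(lra)) as H5.
  destruct (Hpos (finv y) ltac:(lra)) as [_ [H6 H7]].
  assert (0 < (f1 A)^3) by (apply pow_lt; exact H2).
  apply Rmult_le_compat; [lra | left; apply Rinv_0_lt_compat; apply pow_lt; lra | lra|].
  apply Rinv_le_contravar; [assumption|]. apply pow_incr. lra.
Qed.

Lemma slope_lipschitz x y : f A <= x <= y -> y <= f (2 * A) ->
  0 <= tangent_slope x - tangent_slope y <= c2 * f2 A / (f1 A)^3 * (y - x).
Proof.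
  intros Hx Hy. pose proof half_lt.
  destruct (mean_value tangent_slope tangent_slope' x y) as [c [Hc E]]; [lra| |].
  - intros t Ht. apply (is_derive_slope (A / 2)); lra.
  - pose proof (slope'_lower c ltac:(lra)). pose proof (slope'_upper c ltac:(lra)) as H1.
    destruct (Hpos A HA) as [_ [H2 H3]]. destruct (Hpos (2 * A) ltac:(lra)) as [_ [H4 _]].
    assert (0 < f2 A / 2 / (f1 (2 * A))^3) by (apply Rdiv_lt_0_compat; [lra | apply pow_lt; lra]).
    nra.
Qed.

(** With u and v the inverse values at x and y, the gap is (f'(c) - f'(u)) (v - u) / f'(u) for some
    c in [u, v]. A second mean value bounds it by c2 f''(A) (v - u)^2 / f'(A), and v - u <= (y -
    x)/f'(A). *)
Lemma tangent_bound x y : f A <= x <= y -> y <= f (2 * A) ->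
  finv y <= finv x + (y - x) * tangent_slope x <= finv y + c2 * f2 A * (y - x)^2 / (f1 A)^3.
Proof.
  intros Hx Hy. destruct (finv_range x ltac:(lra)) as [Hu Eu].
  destruct (finv_range y ltac:(lra)) as [Hv Ev].
  pose proof (finv_mono A x y HA ltac:(lra)) as Huv.
  unfold tangent_slope. set (u := finv x) in *. set (v := finv y) in *.
  destruct (Hpos A HA) as [_ [H2 H3]]. pose proof (f1_mono A u ltac:(lra)) as Hau.
  pose proof c2_ge_1 as Hc2.
  destruct (mean_value f f1 u v Huv) as [c [Hc E]]; [intros; apply is_derive_f; lra|].
  destruct (mean_value f1 f2 u c ltac:(lra)) as [d [Hd E2]]; [intros; apply is_derive_f1; lra|].
  destruct (Hreg A d HA ltac:(lra) ltac:(lra)) as [_ Hd2].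
  rewrite Eu, Ev in E.
  assert (E3 : (y - x) * / f1 u - (v - u) = (f1 c - f1 u) * (v - u) / f1 u)
    by (rewrite E; field; lra).
  pose proof (f1_mono u c ltac:(lra)) as Huc.
  assert (Hvu : v - u <= (y - x) / f1 A).
  { apply Rmult_le_reg_r with (f1 A); [lra|]. unfold Rdiv. rewrite Rmult_assoc, Rinv_l by lra. nra. }
  destruct (Hpos d ltac:(lra)) as [_ [_ Hd3]].
  assert (H5 : f1 c - f1 u <= c2 * f2 A * (v - u)).
  { rewrite E2. apply Rmult_le_compat; lra. }
  assert (H6 : (f1 c - f1 u) * (v - u) / f1 u <= c2 * f2 A * (y - x)^2 / (f1 A)^3).
  { assert (0 < c2 * f2 A) by (apply Rmult_lt_0_compat; lra).
    apply Rle_trans with (c2 * f2 A * ((v - u) * (v - u)) * / f1 A).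
    - apply Rmult_le_compat; [apply Rmult_le_pos; lra | left; apply Rinv_0_lt_compat; lra | |
        apply Rinv_le_contravar; lra].
      rewrite <- Rmult_assoc. apply Rmult_le_compat_r; lra.
    - replace (c2 * f2 A * (y - x) ^ 2 / f1 A ^ 3)
        with (c2 * f2 A * ((y - x) / f1 A * ((y - x) / f1 A)) * / f1 A) by (field; lra).
      apply Rmult_le_compat_r; [left; apply Rinv_0_lt_compat; lra|].
      apply Rmult_le_compat_l; [lra|]. apply Rmult_le_compat; lra. }
  assert (H7 : 0 <= (f1 c - f1 u) * (v - u) / f1 u).
  { apply Rmult_le_pos; [apply Rmult_le_pos; lra | left; apply Rinv_0_lt_compat; lra]. }
  lra.
Qed.

End Range.

End ConvexFunction.

(** * Averaging over windows *)

(** The step is ln(n/(n+1)) <= n/(n+1) - 1 = -1/(n+1). *)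
Lemma rsum_inv_le_ln n : (0 < n)%nat -> rsum (fun h => / INR (S h)) n <= 1 + ln (INR n).
Proof.
  induction n as [|n IH]; intros Hn; [lia|]. destruct (Nat.eq_dec n 0) as [->|E].
  - simpl. rewrite ln_1, Rinv_1. lra.
  - cbn [rsum]. specialize (IH ltac:(lia)).
    assert (HN : 0 < INR n) by (apply lt_0_INR; lia).
    assert (HS : 0 < INR (S n)) by (apply lt_0_INR; lia).
    assert (Hq : 0 < INR n / INR (S n)) by (apply Rdiv_lt_0_compat; assumption).
    assert (H : ln (INR n / INR (S n)) <= INR n / INR (S n) - 1).
    { rewrite <- (ln_exp (INR n / INR (S n) - 1)). apply ln_le; [exact Hq|].
      pose proof (exp_ineq1_le (INR n / INR (S n) - 1)). lra. }
    rewrite ln_div in H by assumption.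
    replace (INR n / INR (S n) - 1) with (- / INR (S n)) in H
      by (rewrite S_INR in *; field; lra).
    lra.
Qed.

(** Integrability and an upper bound in one predicate, so that estimates of sums of integrals
    compose without side conditions. *)
Definition int_le (F : R -> R) (a b M : R) : Prop := exists l, is_RInt F a b l /\ l <= M.

Lemma int_le_const c a b : int_le (fun _ => c) a b ((b - a) * c).
Proof. exists ((b - a) * c). split; [apply is_RInt_const_R; reflexivity | lra]. Qed.

Lemma int_le_plus F G a b M N : int_le F a b M -> int_le G a b N ->
  int_le (fun x => F x + G x) a b (M + N).
Proof.
  intros [l [Hl Hl']] [k [Hk Hk']]. exists (l + k). split; [|lra].
  apply (is_RInt_plus F G); assumption.
Qed.

Lemma int_le_scal c F a b M : 0 <= c -> int_le F a b M -> int_le (fun x => c * F x) a b (c * M).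
Proof.
  intros Hc [l [Hl Hl']]. exists (c * l). split; [|apply Rmult_le_compat_l; assumption].
  apply (is_RInt_scal F). exact Hl.
Qed.

Lemma int_le_rsum (F : nat -> R -> R) (M : nat -> R) n a b :
  (forall i, (i < n)%nat -> int_le (F i) a b (M i)) ->
  int_le (fun x => rsum (fun i => F i x) n) a b (rsum M n).
Proof.
  induction n as [|n IH]; intros H; cbn [rsum].
  - exists 0. split; [apply is_RInt_const_R; ring | lra].
  - apply int_le_plus; [apply IH; intros; apply H; lia | apply H; lia].
Qed.

Lemma int_le_weaken F a b M N : int_le F a b M -> M <= N -> int_le F a b N.
Proof. intros [l [H1 H2]] H. exists l. split; [exact H1 | lra]. Qed.

(** The integral is cut at the multiples of z and every piece is translated to [0, z]. *)
Lemma is_RInt_windows (F : R -> R) a z k l : 0 <= z ->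
  is_RInt F a (a + INR k * z) l ->
  is_RInt (fun t => rsum (fun j => F (a + INR j * z + t)) k) 0 z l.
Proof.
  intros Hz. revert l. induction k as [|k IH]; intros l H.
  - simpl in H. rewrite Rmult_0_l, Rplus_0_r in H.
    pose proof (is_RInt_point F a) as H0.
    apply (is_RInt_unique (V := R_CompleteNormedModule)) in H.
    apply (is_RInt_unique (V := R_CompleteNormedModule)) in H0.
    cbn [rsum]. apply is_RInt_const_R. rewrite <- H, H0. unfold zero; simpl. ring.
  - rewrite S_INR in H. pose proof (pos_INR k) as Hk0.
    assert (Hkz : 0 <= INR k * z) by (apply Rmult_le_pos; lra).
    assert (Hex : ex_RInt F a (a + (INR k + 1) * z)) by (exists l; exact H).
    assert (H1 : ex_RInt F a (a + INR k * z)).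
    { apply (ex_RInt_Chasles_1 F a _ (a + (INR k + 1) * z)); [|exact Hex]. nra. }
    assert (H2 : ex_RInt F (a + INR k * z) (a + (INR k + 1) * z)).
    { apply (ex_RInt_Chasles_2 F a); [|exact Hex]. nra. }
    destruct H1 as [l1 H1]. destruct H2 as [l2 H2].
    pose proof (is_RInt_Chasles _ _ _ _ _ _ H1 H2) as H3.
    apply (is_RInt_unique (V := R_CompleteNormedModule)) in H.
    apply (is_RInt_unique (V := R_CompleteNormedModule)) in H3.
    rewrite H in H3. rewrite H3. clear H H3. cbn [rsum].
    apply (is_RInt_plus (fun t => rsum (fun j => F (a + INR j * z + t)) k)
                        (fun t => F (a + INR k * z + t))); [apply IH; exact H1|].
    pose proof (is_RInt_comp_lin F 1 (a + INR k * z) 0 z l2) as H4.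
    replace (1 * 0 + (a + INR k * z)) with (a + INR k * z) in H4 by ring.
    replace (1 * z + (a + INR k * z)) with (a + (INR k + 1) * z) in H4 by ring.
    eapply is_RInt_ext; [|apply H4; exact H2].
    intros t _. unfold scal; simpl; unfold mult; simpl. rewrite !Rmult_1_l. f_equal. ring.
Qed.

Lemma sum_between_windows_le (F : nat -> C) (B : R -> R) a z t k : 0 <= a -> 0 < z -> 0 <= t ->
  (forall j, (j < k)%nat ->
     Cmod (sum_between F (a + INR j * z + t) (a + INR j * z + t + z)) <= B (a + INR j * z + t)) ->
  Cmod (sum_between F (a + t) (a + INR k * z + t)) <= rsum (fun j => B (a + INR j * z + t)) k.
Proof.
  intros Ha Hz Ht. induction k as [|k IH]; intros H.
  - simpl. rewrite Rmult_0_l, Rplus_0_r, sum_between_csum by lra.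
    rewrite Nat.sub_diag. simpl. rewrite Cmod_0. lra.
  - assert (Hkz : 0 <= INR k * z) by (apply Rmult_le_pos; [apply pos_INR | lra]).
    rewrite (sum_between_chasles F (a + t) (a + INR k * z + t));
      [|lra | rewrite S_INR; nra].
    eapply Rle_trans; [apply Cmod_triangle|]. cbn [rsum]. apply Rplus_le_compat.
    + apply IH. intros j Hj. apply H. lia.
    + replace (a + INR (S k) * z + t) with (a + INR k * z + t + z) by (rewrite S_INR; ring).
      apply H. lia.
Qed.

(* Averaging over the offset [t] of a partition into windows turns the sum over windows into an integral. *)
Lemma sum_between_average (F : nat -> C) (B : R -> R) mu a b z M :
  0 <= a <= b -> 1 <= z -> 0 <= mu -> 0 <= M ->
  (forall m, a < INR m <= b -> Cmod (F m) <= mu) ->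
  (forall x, a < x -> x + z <= b - 1 -> Cmod (sum_between F x (x + z)) <= B x) ->
  (forall k, a + INR k * z <= b - 1 -> int_le B a (a + INR k * z) M) ->
  Cmod (sum_between F a b) <= mu * (3 * z + 3) + / z * M.
Proof.
  intros Hab Hz Hmu HM HF HB HI.
  assert (HzM : 0 <= / z * M) by (apply Rmult_le_pos; [left; apply Rinv_0_lt_compat; lra | lra]).
  destruct (Rle_dec z (b - a - 1)) as [Hbig|Hsmall].
  2:{ pose proof (Cmod_sum_between_le F a b mu Hab Hmu HF) as H.
      assert ((b - a + 1) * mu <= mu * (3 * z + 3)); [|lra].
      rewrite Rmult_comm. apply Rmult_le_compat_l; lra. }
  pose proof (floorN_spec ((b - a - 1) / z) ltac:(apply Rdiv_le_0_compat; lra)) as [H1 H2].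
  assert (Ediv : (b - a - 1) / z * z = b - a - 1) by (field; lra).
  assert (Hge : (1 <= floorN ((b - a - 1) / z))%nat).
  { assert (0 < floorN ((b - a - 1) / z))%nat; [|lia]. apply INR_lt. simpl.
    assert (1 <= (b - a - 1) / z); [|lra].
    apply Rmult_le_reg_r with z; lra. }
  (* One window fewer than fit into b - a - 1, so that all of them remain in range when shifted by
     an offset t < z. *)
  set (k := (floorN ((b - a - 1) / z) - 1)%nat).
  replace (floorN ((b - a - 1) / z)) with (S k) in * by (unfold k; lia).
  rewrite S_INR in *.
  apply Rmult_le_compat_r with (r := z) in H1; [|lra]. rewrite Ediv in H1.
  apply Rmult_lt_compat_r with (r := z) in H2; [|lra]. rewrite Ediv in H2.
  destruct (HI k ltac:(lra)) as [l [Hl HlM]].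
  assert (Hk0 : 0 <= INR k * z) by (apply Rmult_le_pos; [apply pos_INR | lra]).
  assert (Hpt : forall t, 0 < t < z ->
     Cmod (sum_between F a b) - mu * (3 * z + 3) <= rsum (fun j => B (a + INR j * z + t)) k).
  { intros t Ht.
    assert (Hw : Cmod (sum_between F (a + t) (a + INR k * z + t))
                 <= rsum (fun j => B (a + INR j * z + t)) k).
    { apply sum_between_windows_le; try lra. intros j Hj.
      assert (INR j + 1 <= INR k) as Hjk by (rewrite <- S_INR; apply le_INR; lia).
      assert (0 <= INR j * z) by (apply Rmult_le_pos; [apply pos_INR | lra]).
      apply HB; [lra|]. nra. }
    rewrite (sum_between_chasles F a (a + t)) by lra.
    rewrite (sum_between_chasles F (a + t) (a + INR k * z + t)) by lra.
    pose proof (Cmod_sum_between_le F a (a + t) mu ltac:(lra) Hmu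
                  ltac:(intros; apply HF; lra)) as E1.
    pose proof (Cmod_sum_between_le F (a + INR k * z + t) b mu ltac:(lra) Hmu
                  ltac:(intros; apply HF; lra)) as E2.
    set (s1 := sum_between F a (a + t)) in *.
    set (s2 := sum_between F (a + t) (a + INR k * z + t)) in *.
    set (s3 := sum_between F (a + INR k * z + t) b) in *.
    pose proof (Cmod_triangle s1 (Cplus s2 s3)). pose proof (Cmod_triangle s2 s3).
    (* The two uncovered ends have total length b - a - k z < 2 z + 1; rounding adds 1 for each. *)
    assert (((a + t - a + 1) + (b - (a + INR k * z + t) + 1)) * mu <= (3 * z + 3) * mu)
      by (apply Rmult_le_compat_r; lra).
    lra. }
  assert (Hfin : (Cmod (sum_between F a b) - mu * (3 * z + 3)) * z <= l).
  { apply (is_RInt_le (fun _ => Cmod (sum_between F a b) - mu * (3 * z + 3))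
             (fun t => rsum (fun j => B (a + INR j * z + t)) k) 0 z); [lra | | |].
    - apply is_RInt_const_R. ring.
    - apply is_RInt_windows; [lra | exact Hl].
    - exact Hpt. }
  assert (Cmod (sum_between F a b) - mu * (3 * z + 3) <= / z * M); [|lra].
  apply Rmult_le_reg_r with z; [lra|].
  replace (/ z * M * z) with M by (field; lra). lra.
Qed.

Lemma csum_const (c : C) n : csum (fun _ => c) n = Cmult c (RtoC (INR n)).
Proof.
  induction n as [|n IH]; [simpl; ring|]. rewrite S_INR, RtoC_plus. cbn [csum]. rewrite IH. ring.
Qed.

Lemma csum_blocks (F : nat -> C) (c : nat -> nat) s k :
  (forall i, (i < k)%nat -> (c (s + i) <= c (S (s + i)))%nat) ->
  (c s <= c (s + k))%nat /\
  csum (fun j => F (c s + j)%nat) (c (s + k)%nat - c s)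
  = csum (fun i => csum (fun j => F (c (s + i) + j)%nat) (c (S (s + i)) - c (s + i)%nat)) k.
Proof.
  induction k as [|k IH]; intros H.
  - rewrite Nat.add_0_r, Nat.sub_diag. split; [lia | reflexivity].
  - destruct (IH ltac:(intros; apply H; lia)) as [H1 H2]. pose proof (H k ltac:(lia)) as H3.
    rewrite Nat.add_succ_r. split; [lia|]. cbn [csum]. rewrite <- H2.
    replace (c (S (s + k)) - c s)%nat
      with ((c (s + k) - c s) + (c (S (s + k)) - c (s + k)))%nat by lia.
    rewrite csum_app. f_equal. apply csum_ext. intros j _. f_equal. lia.
Qed.

(** * The bound before optimisation of the parameters *)

Section MainBound.

Variables f finv : R -> R.
Hypothesis Hdiff : forall x, 0 < x ->
  ex_derive f x /\ ex_derive (Derive f) x /\ continuous (Derive (Derive f)) x.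
Hypothesis Hpos : forall x, 0 < x -> 0 < f x /\ 0 < Derive f x /\ 0 < Derive (Derive f) x.
Hypothesis Hinv : forall x, 0 < x -> finv (f x) = x.

Variable A : nat.
Hypothesis HA : 1 <= INR A.
Hypothesis HfA : 1 <= Derive f (INR A).

Notation f1 := (Derive f).
Notation f2 := (Derive (Derive f)).
Notation a := (f (INR A)).
Notation b := (f (2 * INR A)).

(** The number of integers n in [g(m), g(m+1)), that is, with integer part of f(n) equal to m. *)
Definition hits (m : nat) : R := IZR (ceil (finv (INR (S m)))) - IZR (ceil (finv (INR m))).

Lemma a_lt_b : 0 < a < b.
Proof.
  split; [apply Hpos; lra|]. apply (f_incr f Hdiff Hpos). lra.
Qed.

(** Here f'(A) >= 1 enters: the slope of g is at most 1, so every m is hit at most once. *)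
Lemma finv_step y : a <= y -> finv y <= finv (y + 1) <= finv y + 1.
Proof.
  intros Hy. destruct (finv_spec f finv Hdiff Hpos Hinv (INR A) y ltac:(lra) Hy) as [H1 H2].
  split; [apply (finv_mono f finv Hdiff Hpos Hinv (INR A)); lra|].
  destruct (finv_spec f finv Hdiff Hpos Hinv (INR A) (y + 1) ltac:(lra) ltac:(lra)) as [H3 H4].
  apply (f_le_cancel f Hdiff Hpos); [lra | lra|].
  pose proof (f_growth f Hdiff Hpos (finv y) (finv y + 1) ltac:(lra)) as [H5 _].
  pose proof (f1_mono f Hdiff Hpos (INR A) (finv y) ltac:(lra)). lra.
Qed.

Lemma hits_range m : a <= INR m -> 0 <= hits m <= 1.
Proof.
  intros Hm. pose proof (finv_step (INR m) Hm) as H. unfold hits. rewrite S_INR.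
  set (u := finv (INR m)) in *. set (v := finv (INR m + 1)) in *.
  pose proof (ceil_spec u). pose proof (ceil_spec v).
  assert (H2 : (ceil u <= ceil v)%Z) by (apply ceil_mono; lra).
  assert (H3 : (ceil v < ceil u + 2)%Z) by (apply lt_IZR; rewrite plus_IZR; lra).
  assert (H4 : (ceil v <= ceil u + 1)%Z) by lia.
  apply IZR_le in H2. apply IZR_le in H4. rewrite plus_IZR in H4. lra.
Qed.

(** The first integer m above f(n) is at most f(n) + 1 <= f(n+1), so n < g(m) <= n + 1. For n = A
    and n = 2A this matches the ends of the two sums. *)
Lemma ceil_finv_next n : (A <= n)%nat ->
  Z.to_nat (ceil (finv (INR (S (floorN (f (INR n))))))) = S n.
Proof.
  intros Hn. apply le_INR in Hn.
  destruct (Hpos (INR n) ltac:(lra)) as [H0 _].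
  pose proof (floorN_spec (f (INR n)) ltac:(lra)) as H.
  set (y := INR (S (floorN (f (INR n))))).
  assert (Hy : f (INR n) < y <= f (INR n) + 1) by (unfold y; rewrite S_INR; lra).
  destruct (finv_spec f finv Hdiff Hpos Hinv (INR n) y ltac:(lra) ltac:(lra)) as [H1 H2].
  assert (H3 : INR n < finv y) by (apply (f_lt_cancel f Hdiff Hpos); lra).
  assert (H4 : finv y <= INR n + 1).
  { apply (f_le_cancel f Hdiff Hpos); [lra | lra|].
    pose proof (f_growth f Hdiff Hpos (INR n) (INR n + 1) ltac:(lra)) as [H5 _].
    pose proof (f1_mono f Hdiff Hpos (INR A) (INR n) ltac:(lra)). lra. }
  rewrite (ceil_unique (finv y) (Z.of_nat (S n))); [apply Nat2Z.id|].
  rewrite <- INR_IZR_INZ, S_INR. lra.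
Qed.

Lemma floorN_INR n : floorN (INR n) = n.
Proof. apply floorN_unique. lra. Qed.

Lemma hit_sum (phi : nat -> C) :
  sum_between (fun n => phi (Z.to_nat (floorZ (f (INR n))))) (INR A) (2 * INR A)
  = sum_between (fun m => Cmult (phi m) (RtoC (hits m))) a b.
Proof.
  pose proof a_lt_b as Hab. rewrite !sum_between_csum by lra.
  set (p := floorN a). set (q := floorN b).
  set (c := fun m => Z.to_nat (ceil (finv (INR m)))).
  assert (E2A : 2 * INR A = INR (2 * A)) by (rewrite mult_INR; reflexivity).
  assert (Hcp : c (S p) = S A) by (apply ceil_finv_next; lia).
  assert (Hcq : c (S q) = S (2 * A)) by (unfold c, q; rewrite E2A; apply ceil_finv_next; lia).
  assert (Hpq : (p <= q)%nat) by (apply floorN_mono; lra).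
  assert (Hm : forall m, (S p <= m)%nat -> a <= INR m).
  { intros m Hm. apply le_INR in Hm. rewrite S_INR in Hm.
    pose proof (floorN_spec a ltac:(lra)). fold p in H. lra. }
  assert (Hc0 : forall m, (S p <= m)%nat -> IZR (ceil (finv (INR m))) = INR (c m) /\ INR A <= finv (INR m)
                                              /\ f (finv (INR m)) = INR m).
  { intros m H. destruct (finv_spec f finv Hdiff Hpos Hinv (INR A) (INR m) ltac:(lra) (Hm m H)) as [H1 H2].
    split; [|split; assumption]. unfold c.
    pose proof (ceil_spec (finv (INR m))). rewrite (INR_IZR_INZ (Z.to_nat _)), Z2Nat.id; [reflexivity|].
    apply le_IZR. lra. }
  assert (Hcm : forall m, (S p <= m)%nat -> hits m = INR (c (S m)) - INR (c m)).
  { intros m H. unfold hits. rewrite (proj1 (Hc0 m H)), (proj1 (Hc0 (S m) ltac:(lia))). reflexivity. }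
  rewrite E2A, !floorN_INR.
  set (F := fun n => phi (Z.to_nat (floorZ (f (INR n))))).
  (* The n are grouped into the blocks [c m, c (m+1)), on which the integer part of f(n) is
     constantly m. *)
  destruct (csum_blocks F c (S p) (q - p)) as [_ E].
  { intros i _. set (m := (S p + i)%nat). apply INR_le.
    pose proof (Hcm m ltac:(unfold m; lia)).
    pose proof (hits_range m (Hm m ltac:(unfold m; lia))). lra. }
  replace (S p + (q - p))%nat with (S q) in E by lia. rewrite Hcp, Hcq in E.
  replace (2 * A - A)%nat with (S (2 * A) - S A)%nat by lia. etransitivity; [exact E|].
  apply csum_ext. intros i Hi. set (m := (S p + i)%nat).
  rewrite (csum_ext _ (fun _ => phi m)).
  - rewrite csum_const, Hcm by (unfold m; lia). rewrite minus_INR; [reflexivity|].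
    apply INR_le. pose proof (Hcm m ltac:(unfold m; lia)).
    pose proof (hits_range m (Hm m ltac:(unfold m; lia))). lra.
  - intros j Hj. unfold F. f_equal. change (floorN (f (INR (c m + j))) = m).
    destruct (Hc0 m ltac:(unfold m; lia)) as [H1 [H2 H3]].
    destruct (Hc0 (S m) ltac:(unfold m; lia)) as [H4 [H5 H6]].
    pose proof (ceil_spec (finv (INR m))) as H7. pose proof (ceil_spec (finv (INR (S m)))) as H8.
    rewrite H1 in H7. rewrite H4 in H8.
    assert (Hn : finv (INR m) <= INR (c m + j)) by (rewrite plus_INR; pose proof (pos_INR j); lra).
    assert (Hn2 : INR (c m + j) < finv (INR (S m))).
    { assert (S (c m + j) <= c (S m))%nat as Hle by lia. apply le_INR in Hle.
      rewrite S_INR in Hle. lra. }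
    apply floorN_unique. rewrite <- S_INR. split.
    + rewrite <- H3 at 1. destruct Hn as [Hn|<-]; [|lra].
      left. apply (f_incr f Hdiff Hpos). lra.
    + rewrite <- H6. apply (f_incr f Hdiff Hpos). lra.
Qed.

Variable c2 : R.
Hypothesis Hreg : forall x y, 0 < x -> x <= y -> y <= 2 * x ->
  1 / 2 * f2 x <= f2 y /\ f2 y <= c2 * f2 x.

Variables (phi : nat -> C) (mu : R).
Hypothesis Hphi : forall m, Cmod (phi m) <= 1.
Hypothesis Hmu0 : 0 <= mu.
Hypothesis Hmu : forall m, a < INR m <= b -> Cmod (phi m) <= mu.

Notation slope := (tangent_slope f finv).

Lemma diff_as_sum :
  Cminus (sum_between (fun n => phi (Z.to_nat (floorZ (f (INR n))))) (INR A) (2 * INR A))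
         (sum_between (fun m => Cmult (phi m) (RtoC (Derive finv (INR m)))) a b)
  = sum_between (fun m => Cmult (phi m) (RtoC (hits m - slope (INR m)))) a b.
Proof.
  pose proof a_lt_b. rewrite hit_sum, <- sum_between_minus by lra.
  apply sum_between_ext; [lra|]. intros m Hm.
  rewrite (Derive_finv f finv Hdiff Hpos Hinv (INR A)) by lra.
  rewrite RtoC_minus. unfold tangent_slope. ring.
Qed.

Lemma trivial_bound : Cmod
  (Cminus (sum_between (fun n => phi (Z.to_nat (floorZ (f (INR n))))) (INR A) (2 * INR A))
         (sum_between (fun m => Cmult (phi m) (RtoC (Derive finv (INR m)))) a b))
  <= mu * (INR A + 1) + mu * / f1 (INR A) * (b - a + 1).
Proof.
  pose proof a_lt_b. unfold Cminus. eapply Rle_trans; [apply Cmod_triangle|].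
  rewrite Cmod_opp. apply Rplus_le_compat.
  - replace (mu * (INR A + 1)) with ((2 * INR A - INR A + 1) * mu) by ring.
    apply Cmod_sum_between_le; [lra | exact Hmu0|]. intros n Hn. apply Hmu.
    change (a < INR (floorN (f (INR n))) <= b).
    assert (HSA : INR A + 1 <= INR n).
    { rewrite <- S_INR. apply le_INR. assert (A < n)%nat; [apply INR_lt; lra | lia]. }
    destruct (Hpos (INR n) ltac:(lra)) as [H0 _].
    pose proof (floorN_spec (f (INR n)) ltac:(lra)) as H1.
    pose proof (f_growth f Hdiff Hpos (INR A) (INR n) ltac:(lra)) as [H2 _].
    (* For n > A this gives f(n) >= f(A) + 1, so even the integer part of f(n) exceeds f(A) and
       [Hmu] applies to it. *)
    assert (f1 (INR A) * 1 <= f1 (INR A) * (INR n - INR A)) by (apply Rmult_le_compat_l; lra).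
    split.
    + lra.
    + assert (f (INR n) <= b); [|lra]. destruct (proj2 Hn) as [Hlt|<-]; [|lra].
      left. apply (f_incr f Hdiff Hpos). lra.
  - rewrite (Rmult_comm (mu * / f1 (INR A))). apply Cmod_sum_between_le; [lra| |].
    + apply Rmult_le_pos; [exact Hmu0 | left; apply Rinv_0_lt_compat; lra].
    + intros m Hm. rewrite (Derive_finv f finv Hdiff Hpos Hinv (INR A)) by lra.
      rewrite Cmod_mult, Cmod_R.
      pose proof (slope_bounds f finv Hdiff Hpos Hinv (INR A) ltac:(lra) (INR m) ltac:(lra)) as Hs.
      unfold tangent_slope in Hs. rewrite Rabs_pos_eq by lra.
      apply Rmult_le_compat; [apply Cmod_ge_0 | lra | apply Hmu; exact Hm | lra].
Qed.

Variables (z : R) (n n1 D : nat).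
Hypothesis Hz : 1 <= z.
Hypothesis Hn : (0 < n)%nat.
Hypothesis Hn1 : (0 < n1)%nat.
Hypothesis HD : z + 2 <= INR D.

(** [delta] is the error in [tangent_bound] at distance z + 1 <= 2 z; [lam0] and [lam1] are the
    lower and upper bounds for minus the derivative of the slope. *)
Notation delta := (4 * c2 * f2 (INR A) * z^2 / (f1 (INR A))^3).
Notation lam0 := (f2 (INR A) / 2 / (f1 (2 * INR A))^3).
Notation lam1 := (c2 * f2 (INR A) / (f1 (INR A))^3).
Notation W := (window_sup phi a b z).

Hypothesis Hdelta : delta < 1.
Hypothesis Hdelta1 : 2 * delta <= / (2 * INR n1).

Lemma consts_pos : 1 <= c2 /\ 0 < f2 (INR A) /\ 0 < delta /\ 0 < lam0 /\ 0 < lam1.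
Proof.
  pose proof (c2_ge_1 f Hpos c2 Hreg) as H1. destruct (Hpos (INR A) ltac:(lra)) as [_ [H2 H3]].
  destruct (Hpos (2 * INR A) ltac:(lra)) as [_ [H4 _]].
  assert (0 < (f1 (INR A))^3) by (apply pow_lt; lra).
  assert (0 < (f1 (2 * INR A))^3) by (apply pow_lt; lra).
  assert (0 < z^2) by (apply pow_lt; lra).
  repeat split; [exact H1 | exact H3 | | |];
    repeat (apply Rdiv_lt_0_compat || apply Rmult_lt_0_compat); lra.
Qed.

(** The first line collects what does not depend on x: the drift of the slope inside the window, the
    far errors and the cost of the first near index. The rest depends on x only through [slope x],
    which makes the substitution possible. *)
Definition window_bd (x : R) : R :=
  mu * ((z + 1) * (lam1 * z) + 2 * (INR D * / (INR n * delta) + 2))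
  + (4 * mu * rsum (fun d => near_weight (slope x) n1 (S d)) D
     + z * rsum (fun h => Rmin (/ INR (S h)) (/ f1 (INR A))
              * (W (INR (S h) * slope x) + W (- (INR (S h) * slope x)))) n).

Lemma window_le x : a < x -> x + z <= b - 1 ->
  Cmod (sum_between (fun m => Cmult (phi m) (RtoC (hits m - slope (INR m)))) x (x + z))
  <= window_bd x.
Proof.
  intros Hx Hxz. pose proof a_lt_b as Hab. destruct consts_pos as [Hc2 [Hf2 [Hd0 [Hl0 Hl1]]]].
  rewrite sum_between_csum by lra.
  pose proof (floorN_spec x ltac:(lra)) as Hp. pose proof (floorN_spec (x + z) ltac:(lra)) as Hq.
  pose proof (floorN_mono x (x + z) ltac:(lra)) as Hpq.
  pose proof (floorN_diff_le x (x + z) ltac:(lra)) as Hk.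
  set (s := S (floorN x)) in *. set (k := (floorN (x + z) - floorN x)%nat) in *.
  pose proof (slope_bounds f finv Hdiff Hpos Hinv (INR A) ltac:(lra) x ltac:(lra)) as Hb.
  rewrite (csum_ext _ (fun i => Cplus
     (Cmult (phi (s + i)%nat) (RtoC (IZR (ceil (finv (INR (s + S i)))) - IZR (ceil (finv (INR (s + i)))) - slope x)))
     (Cmult (phi (s + i)%nat) (RtoC (slope x - slope (INR (s + i))))))).
  2:{ intros i _. rewrite <- Cmult_plus_distr_l, <- RtoC_plus. do 2 f_equal.
      unfold hits. rewrite Nat.add_succ_r. ring. }
  rewrite csum_plus. eapply Rle_trans; [apply Cmod_triangle|].
  (* The last ceiling difference reads [finv] one integer past the window; the margin x + z <= b - 1
     keeps that point in range. *)
  assert (Hsi : forall i, (i <= k)%nat -> x <= INR (s + i) <= x + z + 1).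
  { intros i Hi. rewrite plus_INR. unfold s. rewrite S_INR. pose proof (pos_INR i).
    assert (INR i <= INR k) as Hik by (apply le_INR; exact Hi).
    unfold k in Hik. rewrite minus_INR in Hik by exact Hpq. lra. }
  assert (Hsi2 : forall i, (i < k)%nat -> x < INR (s + i) <= x + z)
    by (intros i Hi; apply between_floorN; [lra | exact Hi]).
  pose proof (linear_window_bound phi s k (finv x) x (slope x)
     (fun i => finv (INR (s + i))) delta mu n n1 Hn Hn1 ltac:(lra) ltac:(lra) Hdelta1) as Hlin.
  rewrite (Rplus_comm (Cmod _)). unfold window_bd.
  rewrite Rmult_plus_distr_l, Rplus_assoc. apply Rplus_le_compat.
  { eapply Rle_trans; [apply Cmod_csum_le with (B := mu * (lam1 * z))|].
    - intros i Hi. specialize (Hsi2 i Hi). rewrite Cmod_mult, Cmod_R.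
      apply Rmult_le_compat; [apply Cmod_ge_0 | apply Rabs_pos | apply Hmu; lra|].
      pose proof (slope_lipschitz f finv Hdiff Hpos Hinv c2 Hreg (INR A) ltac:(lra) x (INR (s + i))
                   ltac:(lra) ltac:(lra)) as H1.
      rewrite Rabs_pos_eq by lra. eapply Rle_trans; [apply H1|].
      apply Rmult_le_compat_l; lra.
    - replace (mu * ((z + 1) * (lam1 * z))) with ((z + 1) * (mu * (lam1 * z))) by ring.
      apply Rmult_le_compat_r; [|lra].
      apply Rmult_le_pos; [lra|]. apply Rmult_le_pos; lra. }
  assert (HSk : (S k <= D)%nat) by (apply INR_le; rewrite S_INR; lra).
  assert (HnR : 0 < INR n) by (apply lt_0_INR; exact Hn).
  assert (Hnd : 0 < / (INR n * delta)) by (apply Rinv_0_lt_compat, Rmult_lt_0_compat; lra).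
  eapply Rle_trans; [apply Hlin|].
  - intros i Hi. specialize (Hsi i Hi). unfold ell.
    pose proof (tangent_bound f finv Hdiff Hpos Hinv c2 Hreg (INR A) ltac:(lra) x (INR (s + i))
                   ltac:(lra) ltac:(lra)) as H1.
    split; [lra|]. eapply Rle_trans; [apply H1|]. apply Rplus_le_compat_l.
    assert (H2 : (INR (s + i) - x) ^ 2 <= 4 * z^2) by nra.
    apply Rmult_le_compat_r; [left; apply Rinv_0_lt_compat, pow_lt; lra|].
    replace (4 * c2 * f2 (INR A) * z ^ 2) with (c2 * f2 (INR A) * (4 * z^2)) by ring.
    apply Rmult_le_compat_l; [apply Rmult_le_pos; lra | exact H2].
  - intros i Hi. apply Hmu. specialize (Hsi2 i Hi). lra.
  - exact Hmu0.
  - rewrite <- Rplus_assoc. apply Rplus_le_compat.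
    + assert (H1 : INR (S k) * / (INR n * delta) <= INR D * / (INR n * delta))
        by (apply Rmult_le_compat_r; [lra | apply le_INR; exact HSk]).
      pose proof (rsum_le_length (fun d => near_weight (slope x) n1 (S d)) (S k) D HSk
                    (fun d _ => near_weight_nonneg (slope x) n1 Hn1 (S d))) as H2.
      set (r1 := rsum _ (S k)) in *. set (r2 := rsum _ D) in *.
      apply Rle_trans with (mu * (2 * (INR D * / (INR n * delta) + 2 * (1 + r2)))).
      * apply Rmult_le_compat_l; lra.
      * right; ring.
    + rewrite <- rsum_scal. apply rsum_le. intros h _.
      assert (HS : 0 < INR (S h)) by (apply lt_0_INR; lia).
      assert (Hexp : forall th, Cmod (exp_sum phi s k th) <= z * W th).
      { intros th. pose proof (window_sum_le_sup phi a b z Hphi Hab ltac:(lra) x th ltac:(lra)) as H1.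
        unfold window_sum in H1. rewrite sum_between_csum in H1 by lra. exact H1. }
      pose proof (Hexp (INR (S h) * slope x)) as H1.
      pose proof (Hexp (- (INR (S h) * slope x))) as H2.
      replace (z * (Rmin (/ INR (S h)) (/ f1 (INR A)) * (W (INR (S h) * slope x) + W (- (INR (S h) * slope x)))))
        with (Rmin (/ INR (S h)) (/ f1 (INR A)) * (z * W (INR (S h) * slope x) + z * W (- (INR (S h) * slope x)))) by ring.
      apply Rmult_le_compat; [| | |lra].
      * apply Rmin_glb; [left; apply Rinv_0_lt_compat; exact HS | lra].
      * apply Rplus_le_le_0_compat; apply Cmod_ge_0.
      * apply Rmin_glb; [apply Rmin_l|]. eapply Rle_trans; [apply Rmin_r | apply Hb].
Qed.

(** The complete periods cost lam1/lam0 (b - a), uniformly in h; the incomplete one costs 1/(lam0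
    h). *)
Lemma int_le_periodic (P : R -> R) h k :
  (forall x, continuous P x) -> (forall x, P (x + 1) = P x) -> (forall x, 0 <= P x) ->
  0 < h -> a + INR k * z <= b - 1 ->
  int_le (fun x => P (h * slope x)) a (a + INR k * z)
    ((lam1 / lam0 * (b - a) + / lam0 * / h) * RInt P 0 1).
Proof.
  intros Pc Pp P0 Hh Hk. pose proof a_lt_b as Hab. destruct consts_pos as [Hc2 [Hf2 [Hd0 [Hl0 Hl1]]]].
  assert (Hkz : 0 <= INR k * z) by (apply Rmult_le_pos; [apply pos_INR | lra]).
  assert (Hab' : a <= a + INR k * z) by lra.
  set (b' := a + INR k * z) in *.
  pose proof (half_lt f Hdiff Hpos (INR A) ltac:(lra)) as Hhalf.
  assert (Hd : forall x, a <= x <= b' -> is_derive slope x (tangent_slope' f finv x))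
    by (intros x Hx; apply (is_derive_slope f finv Hdiff Hpos Hinv (INR A / 2)); lra).
  exists (RInt (fun x => P (h * slope x)) a b'). split.
  - apply (RInt_correct (V := R_CompleteNormedModule)).
    apply (ex_RInt_continuous (V := R_CompleteNormedModule)).
    rewrite Rmin_left, Rmax_right by lra. intros x Hx.
    apply (continuous_comp (fun x => h * slope x) P); [|apply Pc].
    apply (continuous_scal_r h slope). apply (ex_derive_continuous slope).
    exists (tangent_slope' f finv x). apply Hd. exact Hx.
  - eapply Rle_trans.
    + apply (RInt_comp_periodic_le P Pc Pp P0 slope (tangent_slope' f finv) h lam0); [lra | lra | lra | exact Hd | |].
      * intros x Hx. apply (continuous_slope' f finv Hdiff Hpos Hinv (INR A / 2)); lra.
      * intros x Hx. apply (slope'_upper f finv Hdiff Hpos Hinv c2 Hreg); lra.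
    + rewrite <- Rmult_assoc. apply Rmult_le_compat_r; [apply RInt_nonneg; [exact Pc | exact P0 | lra]|].
      pose proof (slope_lipschitz f finv Hdiff Hpos Hinv c2 Hreg (INR A) ltac:(lra) a b'
                   ltac:(lra) ltac:(lra)) as [_ H1].
      assert (H2 : slope a - slope b' <= lam1 * (b - a)).
      { eapply Rle_trans; [exact H1|]. apply Rmult_le_compat_l; lra. }
      set (l0 := lam0) in *. set (l1 := lam1) in *.
      replace (l1 / l0 * (b - a) + / l0 * / h) with (/ (h * l0) * (h * (l1 * (b - a)) + 1))
        by (field; lra).
      apply Rmult_le_compat_l; [left; apply Rinv_0_lt_compat, Rmult_lt_0_compat; lra|].
      apply Rplus_le_compat_r. apply Rmult_le_compat_l; lra.
Qed.

Lemma main_bound : Cmod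
  (Cminus (sum_between (fun n => phi (Z.to_nat (floorZ (f (INR n))))) (INR A) (2 * INR A))
         (sum_between (fun m => Cmult (phi m) (RtoC (Derive finv (INR m)))) a b))
  <= mu * (3 * z + 3) + / z *
     ((b - a) * (mu * ((z + 1) * (lam1 * z) + 2 * (INR D * / (INR n * delta) + 2)))
      + (4 * mu * (16 / INR n1 * (INR D * (lam1 / lam0 * (b - a)) + / lam0 * (1 + ln (INR D))))
         + z * (2 * RInt W 0 1 * ((1 + ln (INR n)) * (lam1 / lam0 * (b - a) + / lam0 * / f1 (INR A)))))).
Proof.
  pose proof a_lt_b as Hab. destruct consts_pos as [Hc2 [Hf2 [Hd0 [Hl0 Hl1]]]].
  rewrite diff_as_sum.
  assert (Hzpos : 0 < z) by lra.
  pose proof (window_sup_continuous phi a b z Hphi Hab Hzpos) as Wc.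
  pose proof (window_sup_nonneg phi a b z Hphi Hab Hzpos) as W0.
  pose proof (window_sup_periodic phi a b z Hphi Hab Hzpos) as Wp.
  assert (HI : 0 <= RInt W 0 1) by (apply RInt_nonneg; [exact Wc | exact W0 | lra]).
  assert (HnR : 0 < INR n) by (apply lt_0_INR; exact Hn).
  assert (Hn1R : 0 < INR n1) by (apply lt_0_INR; exact Hn1).
  assert (HDn : (0 < D)%nat) by (apply INR_lt; simpl; lra).
  assert (Hinvf : 0 < / f1 (INR A)) by (apply Rinv_0_lt_compat; lra).
  assert (Hnd : 0 < / (INR n * delta)) by (apply Rinv_0_lt_compat, Rmult_lt_0_compat; lra).
  pose proof (rsum_inv_le_ln D HDn) as HhD. pose proof (rsum_inv_le_ln n Hn) as Hhn.
  assert (Hsum0 : forall k, 0 <= rsum (fun h => / INR (S h)) k)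
    by (intros k; apply rsum_nonneg; intros; left; apply Rinv_0_lt_compat, lt_0_INR; lia).
  pose proof (Hsum0 D) as HhD0. pose proof (Hsum0 n) as Hhn0.
  set (l0 := lam0) in *. set (l1 := lam1) in *.
  assert (Hl10 : 0 <= l1 / l0) by (left; apply Rdiv_lt_0_compat; lra).
  assert (HR : 0 <= l1 / l0 * (b - a)) by (apply Rmult_le_pos; lra).
  assert (Hil0 : 0 < / l0) by (apply Rinv_0_lt_compat; lra).
  assert (Hpos2 : 0 <= (z + 1) * (l1 * z) + 2 * (INR D * / (INR n * delta) + 2)).
  { pose proof (pos_INR D).
    assert (0 <= (z + 1) * (l1 * z)) by (apply Rmult_le_pos; [lra | apply Rmult_le_pos; lra]).
    assert (0 <= INR D * / (INR n * delta)) by (apply Rmult_le_pos; lra). lra. }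
  apply (sum_between_average _ window_bd).
  - lra.
  - exact Hz.
  - exact Hmu0.
  - assert (0 <= (b - a) * (mu * ((z + 1) * (l1 * z) + 2 * (INR D * / (INR n * delta) + 2))))
      by (apply Rmult_le_pos; [lra | apply Rmult_le_pos; assumption]).
    assert (0 <= 4 * mu * (16 / INR n1 * (INR D * (l1 / l0 * (b - a)) + / l0 * (1 + ln (INR D))))).
    { apply Rmult_le_pos; [lra|]. apply Rmult_le_pos; [left; apply Rdiv_lt_0_compat; lra|].
      apply Rplus_le_le_0_compat; apply Rmult_le_pos; try lra. }
    assert (0 <= z * (2 * RInt W 0 1 * ((1 + ln (INR n)) * (l1 / l0 * (b - a) + / l0 * / f1 (INR A))))).
    { apply Rmult_le_pos; [lra|]. apply Rmult_le_pos; [lra|]. apply Rmult_le_pos; [lra|].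
      apply Rplus_le_le_0_compat; [exact HR | apply Rmult_le_pos; lra]. }
    lra.
  - intros m Hm. rewrite Cmod_mult, Cmod_R, <- (Rmult_1_r mu).
    apply Rmult_le_compat; [apply Cmod_ge_0 | apply Rabs_pos | apply Hmu; exact Hm|].
    pose proof (hits_range m ltac:(lra)).
    pose proof (slope_bounds f finv Hdiff Hpos Hinv (INR A) ltac:(lra) (INR m) ltac:(lra)) as Hs.
    assert (/ f1 (INR A) <= 1) by (rewrite <- Rinv_1; apply Rinv_le_contravar; lra).
    apply Rabs_le. lra.
  - exact window_le.
  - intros k Hk. unfold window_bd.
    assert (Hkz : 0 <= INR k * z) by (apply Rmult_le_pos; [apply pos_INR | lra]).
    apply int_le_plus; [|apply int_le_plus].
    + eapply int_le_weaken; [apply int_le_const|].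
      apply Rmult_le_compat_r; [apply Rmult_le_pos; [exact Hmu0 | exact Hpos2] | lra].
    + apply int_le_scal; [lra|].
      eapply int_le_weaken.
      { apply (int_le_rsum (fun d x => near_weight (slope x) n1 (S d))
           (fun d => 16 / INR n1 * (l1 / l0 * (b - a) + / l0 * / INR (S d)))).
        intros d _. unfold near_weight.
        apply (int_le_scal (16 / INR n1) (fun x => fejer n1 (INR (S d) * slope x)));
          [left; apply Rdiv_lt_0_compat; lra|].
        eapply int_le_weaken; [apply (int_le_periodic (fejer n1))|].
        - apply continuous_fejer.
        - intros y. apply (fejer_periodic n1 y 1).
        - intros y. apply fejer_nonneg. exact Hn1.
        - apply lt_0_INR. lia.
        - exact Hk.
        - rewrite RInt_fejer by exact Hn1. fold l0 l1. lra. }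
      rewrite rsum_scal, rsum_plus, rsum_const, rsum_scal.
      apply Rmult_le_compat_l; [left; apply Rdiv_lt_0_compat; lra|].
      apply Rplus_le_compat_l. apply Rmult_le_compat_l; lra.
    + apply int_le_scal; [lra|].
      eapply int_le_weaken.
      { apply (int_le_rsum (fun h x => Rmin (/ INR (S h)) (/ f1 (INR A))
              * (W (INR (S h) * slope x) + W (- (INR (S h) * slope x))))
           (fun h => 2 * RInt W 0 1 * ((l1 / l0 * (b - a) + / l0 * / f1 (INR A)) * / INR (S h)))).
        intros h _. assert (HS : 0 < INR (S h)) by (apply lt_0_INR; lia).
        assert (HiS : 0 < / INR (S h)) by (apply Rinv_0_lt_compat; exact HS).
        pose proof (int_le_periodic W (INR (S h)) k Wc Wp W0 HS Hk) as H1.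
        pose proof (int_le_periodic (fun t => W (- t)) (INR (S h)) k) as H2.
        rewrite (RInt_reflect W Wc Wp) in H2.
        eapply int_le_weaken.
        - apply int_le_scal; [apply Rmin_glb; lra|]. apply int_le_plus; [exact H1|]. apply H2.
          + exact (continuous_reflect W Wc).
          + exact (reflect_periodic W Wp).
          + intros t; apply W0.
          + exact HS.
          + exact Hk.
        (* The weight is used as 1/h on the complete periods, and as 1/f'(A) on the incomplete one,
           which carries a 1/h already. *)
        - fold l0 l1. set (m := Rmin (/ INR (S h)) (/ f1 (INR A))).
          assert (Hm1 : m <= / INR (S h)) by apply Rmin_l.
          assert (Hm2 : m <= / f1 (INR A)) by apply Rmin_r.
          replace (m * ((l1 / l0 * (b - a) + / l0 * / INR (S h)) * RInt W 0 1 +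
                        (l1 / l0 * (b - a) + / l0 * / INR (S h)) * RInt W 0 1))
            with (2 * RInt W 0 1 * (l1 / l0 * (b - a) * m + / l0 * / INR (S h) * m)) by ring.
          apply Rmult_le_compat_l; [lra|].
          rewrite Rmult_plus_distr_r. apply Rplus_le_compat.
          + apply Rmult_le_compat_l; lra.
          + replace (/ l0 * / f1 (INR A) * / INR (S h)) with (/ l0 * / INR (S h) * / f1 (INR A)) by ring.
            apply Rmult_le_compat_l; [apply Rmult_le_pos; lra | exact Hm2]. }
      rewrite rsum_scal, rsum_scal.
      apply Rmult_le_compat_l; [lra|]. rewrite Rmult_comm.
      apply Rmult_le_compat_r; [|exact Hhn].
      apply Rplus_le_le_0_compat; [exact HR | apply Rmult_le_pos; lra].
Qed.

End MainBound.

(** * Choice of the parameters *)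

Lemma mult3_le x x' y y' w w' : 0 <= x <= x' -> 0 <= y <= y' -> 0 <= w <= w' ->
  x * y * w <= x' * y' * w'.
Proof.
  intros Hx Hy Hw. apply Rmult_le_compat; try lra; [apply Rmult_le_pos; lra|].
  apply Rmult_le_compat; lra.
Qed.

(** Pure arithmetic on [main_bound], with r = A, F = f'(A), B = f(2A) - f(A), I = J, L = log A, R0 =
    lam1/lam0, il0 = 1/lam0, q = 1/(n delta), w = 16/n1, RD = D, and HD, HN the harmonic bounds 1 +
    log D, 1 + log n. The terms are: T0 uncovered ends, T1 drift of the slope, T2 far errors, T3
    first near indices, T4 and T5 further near indices over complete and incomplete periods, T6
    exponential sums. T3 and T6 are charged to the [J] part Y, the others to X. *)
Lemma assemble (r F B z mu I L c2 C3 C5 C6 C7 R RD HN HD delta eta lam1 R0 il0 q w : R) :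
  1 <= r -> 1 <= F -> 1 <= z -> 0 <= mu <= 1 -> mu <= z * I -> 0 <= I -> 1 / 2 <= L ->
  0 < c2 -> 0 < C3 -> 0 < C5 -> 0 < C6 -> 0 < C7 -> 0 < R -> 0 <= delta -> 0 <= eta ->
  0 <= lam1 -> F * (lam1 * z) <= c2 * eta -> F * delta = 4 * c2 * eta ->
  0 <= B <= C5 * (F * r) -> 0 <= R0 <= R -> 0 <= il0 -> 0 <= q <= delta ->
  0 <= w <= 128 * delta -> 0 <= RD <= 4 * z -> 0 <= HD <= C7 * L -> 0 <= HN <= C6 * L ->
  w * il0 <= 1024 * c2 * C5^3 * z^2 -> il0 * / F <= 2 * C5^3 * C3 * (F * (r * L)) ->
  z * L^2 <= C3 * (eta * r) / 8 ->
  mu * (3 * z + 3) + / z *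
     (B * (mu * ((z + 1) * (lam1 * z) + 2 * (RD * q + 2)))
      + (4 * mu * (w * (RD * (R0 * B) + il0 * HD))
         + z * (2 * I * (HN * (R0 * B + il0 * / F)))))
  <= r * ((3 * C3 + 2 * c2 * C5 + 32 * c2 * C5 + 32 * C5 + 8192 * c2 * R * C5
            + 1024 * c2 * C5^3 * C7 * C3 + 2 * C6 * (4 * R * C5 + 4 * C5^3 * C3))
          * (eta + F * L^3 * I)).
Proof.
  intros Hr HF Hz Hmu HmuI HI HL Hc2 HC3 HC5 HC6 HC7 HR Hd Heta Hl1 Hl1' HFd HB HR0 Hil0 Hq Hw
    HRD HHD HHN Hwi HiF HzL.
  assert (HC53 : 0 < C5^3) by (apply pow_lt; exact HC5).
  assert (HFr : 0 <= F * r) by (apply Rmult_le_pos; lra).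
  assert (Her : 0 <= eta * r) by (apply Rmult_le_pos; lra).
  assert (HL2 : 1 / 4 <= L^2) by nra.
  assert (HL3 : L / 4 <= L^3) by (replace (L^3) with (L * L^2) by ring; nra).
  assert (HL3' : L^2 / 2 <= L^3) by (replace (L^3) with (L * L^2) by ring; nra).
  assert (Hiz : 0 < / z) by (apply Rinv_0_lt_compat; lra).
  set (X := eta * r) in *. set (Y := r * (F * L^3 * I)).
  assert (HY : 0 <= Y).
  { unfold Y. repeat apply Rmult_le_pos; lra. }
  assert (HYI : F * r * I * L^3 = Y) by (unfold Y; ring).
  assert (HFrI : 0 <= F * r * I) by (apply Rmult_le_pos; lra).
  assert (T0 : mu * (3 * z + 3) <= 3 * C3 * X).
  { assert (mu * (3 * z + 3) <= 1 * (3 * z + 3)) by (apply Rmult_le_compat_r; lra).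
    assert (z * (1 / 4) <= z * L^2) by (apply Rmult_le_compat_l; lra). lra. }
  assert (T1 : / z * (B * (mu * ((z + 1) * (lam1 * z)))) <= 2 * c2 * C5 * X).
  { replace (/ z * (B * (mu * ((z + 1) * (lam1 * z))))) with (B * mu * ((z + 1) * lam1)) by (field; lra).
    apply Rle_trans with (C5 * (F * r) * 1 * (2 * z * lam1)).
    - apply mult3_le; [exact HB | exact Hmu | split; [apply Rmult_le_pos; lra|]].
      apply Rmult_le_compat_r; lra.
    - replace (C5 * (F * r) * 1 * (2 * z * lam1)) with (2 * C5 * r * (F * (lam1 * z))) by ring.
      replace (2 * c2 * C5 * X) with (2 * C5 * r * (c2 * eta)) by (unfold X; ring).
      apply Rmult_le_compat_l; [|exact Hl1']. apply Rmult_le_pos; lra. }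
  assert (T2 : / z * (B * (mu * (2 * (RD * q)))) <= 32 * c2 * C5 * X).
  { apply Rle_trans with (/ z * (C5 * (F * r) * 1 * (2 * (4 * z * delta)))).
    - apply Rmult_le_compat_l; [lra|]. rewrite <- Rmult_assoc.
      apply mult3_le; [exact HB | exact Hmu|].
      split; [apply Rmult_le_pos; [lra | apply Rmult_le_pos; lra]|].
      apply Rmult_le_compat_l; [lra|]. apply Rmult_le_compat; lra.
    - right. replace (/ z * (C5 * (F * r) * 1 * (2 * (4 * z * delta))))
        with (8 * C5 * r * (F * delta)) by (field; lra).
      rewrite HFd. unfold X. ring. }
  (* There is no small factor here: mu is replaced by z I, which also cancels the 1/z. *)
  assert (T3 : / z * (B * (mu * 4)) <= 32 * C5 * Y).
  { apply Rle_trans with (/ z * (C5 * (F * r) * (z * I) * 4)).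
    - apply Rmult_le_compat_l; [lra|]. rewrite <- Rmult_assoc.
      apply mult3_le; [exact HB | lra | lra].
    - replace (/ z * (C5 * (F * r) * (z * I) * 4)) with (32 * C5 * (F * r * I * (1 / 8))) by (field; lra).
      rewrite <- HYI. apply Rmult_le_compat_l; [lra|]. apply Rmult_le_compat_l; [exact HFrI | lra]. }
  assert (HR0B : 0 <= R0 * B <= R * (C5 * (F * r))).
  { split; [apply Rmult_le_pos; lra | apply Rmult_le_compat; lra]. }
  assert (T4 : / z * (4 * mu * (w * (RD * (R0 * B)))) <= 8192 * c2 * R * C5 * X).
  { apply Rle_trans with (/ z * (4 * 1 * (128 * delta * (4 * z * (R * (C5 * (F * r))))))).
    - apply Rmult_le_compat_l; [lra|]. apply Rmult_le_compat; [lra | | lra|].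
      + apply Rmult_le_pos; [lra | apply Rmult_le_pos; lra].
      + apply Rmult_le_compat; [lra | apply Rmult_le_pos; lra | lra|].
        apply Rmult_le_compat; lra.
    - right. replace (/ z * (4 * 1 * (128 * delta * (4 * z * (R * (C5 * (F * r)))))))
        with (2048 * R * C5 * r * (F * delta)) by (field; lra).
      rewrite HFd. unfold X. ring. }
  assert (T5 : / z * (4 * mu * (w * (il0 * HD))) <= 1024 * c2 * C5^3 * C7 * C3 * X).
  { apply Rle_trans with (/ z * (4 * 1 * (1024 * c2 * C5^3 * z^2 * (C7 * L)))).
    - apply Rmult_le_compat_l; [lra|]. apply Rmult_le_compat; [lra | | lra|].
      + apply Rmult_le_pos; [lra | apply Rmult_le_pos; lra].
      + rewrite <- (Rmult_assoc w). apply Rmult_le_compat; [apply Rmult_le_pos; lra | lra | exact Hwi | lra].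
    - replace (/ z * (4 * 1 * (1024 * c2 * C5^3 * z^2 * (C7 * L))))
        with (1024 * c2 * C5^3 * C7 * (4 * (z * L))) by (field; lra).
      rewrite (Rmult_assoc _ C3). apply Rmult_le_compat_l.
      + repeat apply Rmult_le_pos; lra.
      + assert (z * (L / 2) <= z * L^2) by (apply Rmult_le_compat_l; nra). lra. }
  assert (T6 : / z * (z * (2 * I * (HN * (R0 * B + il0 * / F))))
               <= 2 * C6 * (4 * R * C5 + 4 * C5^3 * C3) * Y).
  { assert (0 < / F) by (apply Rinv_0_lt_compat; lra).
    assert (HiF0 : 0 <= il0 * / F) by (apply Rmult_le_pos; lra).
    replace (/ z * (z * (2 * I * (HN * (R0 * B + il0 * / F)))))
      with (2 * I * (HN * (R0 * B + il0 * / F))) by (field; lra).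
    apply Rle_trans with (2 * I * (C6 * L * (R * (C5 * (F * r)) + 2 * C5^3 * C3 * (F * (r * L))))).
    - apply Rmult_le_compat_l; [lra|]. apply Rmult_le_compat; lra.
    - replace (2 * I * (C6 * L * (R * (C5 * (F * r)) + 2 * C5^3 * C3 * (F * (r * L)))))
        with (2 * C6 * (4 * R * C5 * (F * r * I * (L / 4)) + 4 * C5^3 * C3 * (F * r * I * (L^2 / 2))))
        by field.
      rewrite (Rmult_assoc (2 * C6)). apply Rmult_le_compat_l; [lra|].
      rewrite Rmult_plus_distr_r. apply Rplus_le_compat.
      + apply Rmult_le_compat_l; [repeat apply Rmult_le_pos; lra|]. rewrite <- HYI.
        apply Rmult_le_compat_l; lra.
      + apply Rmult_le_compat_l; [repeat apply Rmult_le_pos; lra|]. rewrite <- HYI.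
        apply Rmult_le_compat_l; lra. }
  set (K0 := 3 * C3 + 2 * c2 * C5 + 32 * c2 * C5 + 8192 * c2 * R * C5 + 1024 * c2 * C5^3 * C7 * C3).
  set (K1 := 32 * C5 + 2 * C6 * (4 * R * C5 + 4 * C5^3 * C3)).
  assert (HK0 : 0 <= K0).
  { unfold K0. repeat apply Rplus_le_le_0_compat; repeat apply Rmult_le_pos; lra. }
  assert (HK1 : 0 <= K1).
  { unfold K1. apply Rplus_le_le_0_compat; [lra|]. apply Rmult_le_pos; [lra|].
    apply Rplus_le_le_0_compat; repeat apply Rmult_le_pos; lra. }
  apply Rle_trans with (K0 * X + K1 * Y).
  - unfold K0, K1.
    replace (/ z *
     (B * (mu * ((z + 1) * (lam1 * z) + 2 * (RD * q + 2)))
      + (4 * mu * (w * (RD * (R0 * B) + il0 * HD))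
         + z * (2 * I * (HN * (R0 * B + il0 * / F))))))
     with (/ z * (B * (mu * ((z + 1) * (lam1 * z)))) + / z * (B * (mu * (2 * (RD * q))))
       + / z * (B * (mu * 4)) + / z * (4 * mu * (w * (RD * (R0 * B))))
       + / z * (4 * mu * (w * (il0 * HD))) + / z * (z * (2 * I * (HN * (R0 * B + il0 * / F))))) by ring.
    lra.
  - replace (r * (_ * (eta + F * L^3 * I))) with ((K0 + K1) * (X + Y)) by (unfold K0, K1, X, Y; ring).
    assert (0 <= K0 * Y) by (apply Rmult_le_pos; assumption).
    assert (0 <= K1 * X) by (apply Rmult_le_pos; assumption). lra.
Qed.

(** All parameters are polynomially bounded in A; since ln r >= 1/2, the constants are absorbed into
    a multiple of ln r. *)
Lemma ln_le_poly c k r x : 1 <= c -> 2 <= r -> 0 < x -> x <= c * r ^ k ->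
  1 + ln x <= (2 + 2 * ln c + INR k) * ln r.
Proof.
  intros Hc Hr Hx H. pose proof (ln_ge_half r Hr) as HL.
  assert (Hlc : 0 <= ln c) by (rewrite <- ln_1; apply ln_le; lra).
  assert (Hrk : 0 < r ^ k) by (apply pow_lt; lra).
  apply (ln_le x _ Hx) in H. rewrite ln_mult, ln_pow in H by lra.
  assert (ln c * (1 / 2) <= ln c * ln r) by (apply Rmult_le_compat_l; lra). lra.
Qed.

Lemma floorN_S r : 0 <= r -> r <= INR (S (floorN r)) <= r + 1.
Proof. intros H. rewrite S_INR. pose proof (floorN_spec r H). lra. Qed.

Section Regime.

Variables f finv : R -> R.
Hypothesis Hdiff : forall x, 0 < x ->
  ex_derive f x /\ ex_derive (Derive f) x /\ continuous (Derive (Derive f)) x.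
Hypothesis Hpos : forall x, 0 < x -> 0 < f x /\ 0 < Derive f x /\ 0 < Derive (Derive f) x.
Hypothesis Hinv : forall x, 0 < x -> finv (f x) = x.
Variable c2 : R.
Hypothesis Hreg : forall x y, 0 < x -> x <= y -> y <= 2 * x ->
  1 / 2 * Derive (Derive f) x <= Derive (Derive f) y /\
  Derive (Derive f) y <= c2 * Derive (Derive f) x.

Notation f1 := (Derive f).
Notation f2 := (Derive (Derive f)).
(** [C3] comes from [f1_le_log] and [C5] from [f1_double]; [C6] and [C7] are [ln_le_poly] for n <= 2
    C3^2 r^4 and D <= 4 C3 r^2; [ratio] bounds lam1/lam0. *)
Notation C3 := (2 + 4 * (f1 1 / f2 1)).
Notation C5 := (1 + 2 * c2 * c2).
Notation C6 := (2 + 2 * ln (2 * C3^2) + INR 4).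
Notation C7 := (2 + 2 * ln (4 * C3) + INR 2).
Notation ratio := (2 * c2 * C5^3).

Definition large_const : R :=
  3 * C3 + 2 * c2 * C5 + 32 * c2 * C5 + 32 * C5 + 8192 * c2 * ratio * C5
  + 1024 * c2 * C5^3 * C7 * C3 + 2 * C6 * (4 * ratio * C5 + 4 * C5^3 * C3).

Variables (A : nat) (phi : nat -> C) (mu z : R).
Hypothesis HA : 2 <= INR A.
Hypothesis HfA : 1 <= f1 (INR A).
Hypothesis Hphi : forall m, Cmod (phi m) <= 1.
Hypothesis Hz : 0 < z.
Hypothesis Hmu : forall m, f (INR A) < INR m <= f (2 * INR A) -> Cmod (phi m) <= mu.
Hypothesis Hmu01 : 0 <= mu <= 1.
Hypothesis HmuJ : mu <= z * J f phi (INR A) z.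

Notation r := (INR A).
Notation F := (f1 r).
Notation G := (f2 r).
Notation L := (ln r).
Notation eta := (G / F^2 * z^2).
Notation lhs := (Cmod
  (Cminus (sum_between (fun n => phi (Z.to_nat (floorZ (f (INR n))))) r (2 * r))
         (sum_between (fun m => Cmult (phi m) (RtoC (Derive finv (INR m)))) (f r) (f (2 * r))))).

Lemma C3_ge_2 : 2 <= C3.
Proof.
  destruct (Hpos 1 ltac:(lra)) as [_ [H1 H2]].
  assert (0 < f1 1 / f2 1) by (apply Rdiv_lt_0_compat; lra). lra.
Qed.

Lemma range_length : 0 <= f (2 * r) - f r <= C5 * (F * r).
Proof.
  pose proof (f_growth f Hdiff Hpos r (2 * r) ltac:(lra)) as [H1 H2].
  pose proof (f1_double f Hdiff Hpos c2 Hreg r ltac:(lra)) as H3.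
  replace (2 * r - r) with r in * by ring.
  assert (0 <= F * r) by (apply Rmult_le_pos; lra).
  assert (f1 (2 * r) * r <= C5 * F * r) by (apply Rmult_le_compat_r; lra). lra.
Qed.

Lemma trivial_le : lhs <= r * ((3 + C5) * mu).
Proof.
  pose proof (trivial_bound f finv Hdiff Hpos Hinv A ltac:(lra) HfA phi mu (proj1 Hmu01) Hmu) as H.
  pose proof range_length as HB. eapply Rle_trans; [exact H|].
  assert (HF : 0 < / F <= 1).
  { split; [apply Rinv_0_lt_compat; lra | rewrite <- Rinv_1; apply Rinv_le_contravar; lra]. }
  assert (H1 : / F * (f (2 * r) - f r + 1) <= C5 * r + 1).
  { rewrite Rmult_plus_distr_l. apply Rplus_le_compat; [|lra].
    apply Rle_trans with (/ F * (C5 * (F * r))); [apply Rmult_le_compat_l; lra|].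
    right. field. lra. }
  rewrite Rmult_assoc.
  assert (mu * (/ F * (f (2 * r) - f r + 1)) <= mu * (C5 * r + 1)) by (apply Rmult_le_compat_l; lra).
  replace (r * ((3 + C5) * mu)) with (mu * (r + 1) + mu * (C5 * r + 1) + mu * (2 * r - 2)) by ring.
  assert (0 <= mu * (2 * r - 2)) by (apply Rmult_le_pos; lra). lra.
Qed.

Hypothesis Hzlarge : 8 * (F * L^3) < z.
Hypothesis Heta : 16 * c2 * eta < 1.

(** Outside the trivial cases z and 1/delta are at most C3 r^2, so their logarithms are of size ln
    r. The last bound is what lets the first summand absorb errors of size z and z ln r. *)
Lemma regime_bounds : F <= z /\ 1 <= z /\ F <= C3 * (r * (G * L)) /\ L <= r /\
  z <= C3 * r^2 /\ / (4 * c2 * G * z^2 / F^3) <= C3 * r^2 /\ z * L^2 <= C3 * (eta * r) / 8.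
Proof.
  pose proof (ln_ge_half r HA) as HL. pose proof C3_ge_2 as HC3.
  pose proof (c2_ge_1 f Hpos c2 Hreg) as Hc2.
  destruct (Hpos r ltac:(lra)) as [_ [HF HG]].
  pose proof (f1_le_log f Hdiff Hpos c2 Hreg r HA) as Hlog.
  set (c3 := C3) in *. clearbody c3.
  assert (HLr : L <= r).
  { rewrite <- (ln_exp r) at 2. apply ln_le; [lra|]. pose proof (exp_ineq1_le r). lra. }
  assert (HL2 : 1 / 4 <= L^2) by nra.
  assert (HL3 : 1 / 8 <= L^3) by (replace (L^3) with (L * L^2) by ring; nra).
  assert (HFz : F <= z).
  { assert (F * (1 / 8) <= F * L^3) by (apply Rmult_le_compat_l; lra). lra. }
  assert (HFC : F <= c3 * (r * (G * L))) by lra.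
  assert (HF2 : 0 < F^2) by (apply pow_lt; lra).
  assert (HGz : G * z^2 <= F^2).
  { assert (eta <= 1).
    { assert (0 <= eta) by (apply Rmult_le_pos; [left; apply Rdiv_lt_0_compat; lra | apply pow_le; lra]).
      nra. }
    replace (G * z^2) with (F^2 * eta) by (field; lra). nra. }
  assert (HFC2 : F <= c3 * r^2 * G).
  { eapply Rle_trans; [exact HFC|].
    replace (c3 * (r * (G * L))) with (c3 * r * G * L) by ring.
    replace (c3 * r^2 * G) with (c3 * r * G * r) by ring.
    apply Rmult_le_compat_l; [repeat apply Rmult_le_pos; lra | exact HLr]. }
  assert (Hz2 : F^2 <= z^2) by (apply pow_incr; lra).
  assert (HG1 : G <= 1).
  { assert (G * F^2 <= G * z^2) by (apply Rmult_le_compat_l; lra). nra. }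
  assert (HCr : 0 < c3 * r^2) by (apply Rmult_lt_0_compat; [lra | apply pow_lt; lra]).
  repeat split; try assumption; try lra.
  - assert (HFCr : F <= c3 * r^2) by nra.
    (* From G z^2 <= F^2, one factor F being bounded by c3 r^2 G and the other by c3 r^2; then G
       cancels. *)
    assert (H1 : G * z^2 <= G * (c3 * r^2)^2).
    { eapply Rle_trans; [exact HGz|]. simpl. rewrite !Rmult_1_r. simpl in *. nra. }
    apply Rmult_le_reg_l in H1; [|exact HG].
    apply Rnot_lt_le. intros Hlt. assert ((c3 * r^2)^2 < z^2); [|lra].
    simpl. rewrite !Rmult_1_r. simpl in *. nra.
  (* delta >= G/F because F <= z, and F <= c3 r^2 G. *)
  - assert (Hd : / (c3 * r^2) <= 4 * c2 * G * z^2 / F^3).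
    { apply Rle_trans with (G / F).
      - apply Rmult_le_reg_r with (c3 * r^2 * F); [apply Rmult_lt_0_compat; lra|].
        replace (/ (c3 * r^2) * (c3 * r^2 * F)) with F by (field; split; lra).
        replace (G / F * (c3 * r^2 * F)) with (c3 * r^2 * G) by (field; lra). exact HFC2.
      - apply Rmult_le_reg_r with (F^3); [apply pow_lt; lra|].
        replace (G / F * F^3) with (G * F^2) by (field; lra).
        replace (4 * c2 * G * z^2 / F^3 * F^3) with (G * (4 * c2 * z^2)) by (field; lra).
        apply Rmult_le_compat_l; [lra|]. nra. }
    rewrite <- (Rinv_inv (c3 * r^2)). apply Rinv_le_contravar; [|exact Hd].
    apply Rinv_0_lt_compat. exact HCr.
  - assert (HL0 : 0 < L) by lra.
    (* After this scaling z >= 8 F L^3 bounds the left side by z^2, and F <= c3 r G L bounds the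
       right side from below by z^2. *)
    apply Rmult_le_reg_l with (8 * (F * L) ); [repeat apply Rmult_lt_0_compat; lra|].
    apply Rle_trans with (z * z).
    + replace (8 * (F * L) * (z * L^2)) with (8 * (F * L^3) * z) by ring.
      apply Rmult_le_compat_r; lra.
    + replace (8 * (F * L) * (c3 * (eta * r) / 8)) with (z * z * (c3 * (r * (G * L)) / F)) by (field; lra).
      rewrite <- (Rmult_1_r (z * z)) at 1. apply Rmult_le_compat_l; [nra|].
      apply Rmult_le_reg_r with F; [lra|]. unfold Rdiv. rewrite Rmult_assoc, Rinv_l by lra. lra.
Qed.

Lemma large_le : lhs <= r * (large_const * (eta + F * L^3 * J f phi r z)).
Proof.
  pose proof (ln_ge_half r HA) as HL. pose proof C3_ge_2 as HC3.
  pose proof (c2_ge_1 f Hpos c2 Hreg) as Hc2.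
  destruct (Hpos r ltac:(lra)) as [_ [HF HG]].
  destruct (Hpos (2 * r) ltac:(lra)) as [_ [HF2 _]].
  destruct regime_bounds as [HFz [Hz1 [HFC [HLr [HzC [HdC HzL]]]]]].
  pose proof (f1_double f Hdiff Hpos c2 Hreg r ltac:(lra)) as Hdbl.
  unfold large_const. set (c3 := C3) in *. clearbody c3.
  set (delta := 4 * c2 * G * z^2 / F^3) in *.
  assert (Hz2 : 0 < z^2) by (apply pow_lt; lra).
  assert (HF3 : 0 < F^3) by (apply pow_lt; lra).
  assert (HF23 : 0 < (f1 (2 * r))^3) by (apply pow_lt; lra).
  assert (HC5 : 1 <= C5) by nra.
  assert (HC53 : 0 < C5^3) by (apply pow_lt; lra).
  assert (Hetapos : 0 < eta).
  { apply Rmult_lt_0_compat; [apply Rdiv_lt_0_compat; [lra | apply pow_lt; lra] | exact Hz2]. }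
  assert (Hd : 0 < delta) by (unfold delta; apply Rdiv_lt_0_compat; [repeat apply Rmult_lt_0_compat; lra | exact HF3]).
  assert (HFd : F * delta = 4 * c2 * eta) by (unfold delta; field; lra).
  (* F >= 1 gives 4 delta <= 16 c2 eta; this is the origin of the 16 c2 in [Heta]. *)
  assert (Hd4 : 4 * delta < 1) by nra.
  assert (Hinvd : 1 < / (4 * delta)).
  { rewrite <- Rinv_1. apply Rinv_lt_contravar; lra. }
  (* The largest length allowed by 2 delta <= 1/(2 n1). As 1/(4 delta) > 1, its floor is at least
     half of it, whence 16/n1 <= 128 delta. *)
  set (n1 := floorN (/ (4 * delta))).
  pose proof (floorN_spec (/ (4 * delta)) ltac:(lra)) as Hn1s. fold n1 in Hn1s.
  assert (Hn1 : (0 < n1)%nat).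
  { destruct n1; [simpl in Hn1s; lra | lia]. }
  assert (Hn1R : 1 <= INR n1) by (apply (le_INR 1); lia).
  assert (Hw : 16 / INR n1 <= 128 * delta).
  { apply Rmult_le_reg_r with (INR n1); [lra|]. unfold Rdiv. rewrite Rmult_assoc, Rinv_l by lra.
    assert (4 * delta * / (4 * delta) <= 4 * delta * (2 * INR n1)) as Hm
      by (apply Rmult_le_compat_l; lra).
    rewrite Rinv_r in Hm by lra. lra. }
  assert (Hdelta1 : 2 * delta <= / (2 * INR n1)).
  { apply Rmult_le_reg_r with (2 * INR n1); [lra|]. rewrite Rinv_l by lra.
    assert (4 * delta * INR n1 <= 4 * delta * / (4 * delta)) as Hm
      by (apply Rmult_le_compat_l; lra).
    rewrite Rinv_r in Hm by lra. lra. }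
  assert (Hid2 : 0 < / delta ^ 2) by (apply Rinv_0_lt_compat, pow_lt; exact Hd).
  (* Chosen so that 1/(n delta) <= delta. *)
  set (n := S (floorN (/ delta ^ 2))).
  pose proof (floorN_S (/ delta ^ 2) ltac:(lra)) as Hns. fold n in Hns.
  (* At least one more than the number of integers in a window, which is at most z + 1. *)
  set (D := S (floorN (z + 2))).
  pose proof (floorN_S (z + 2) ltac:(lra)) as HDs. fold D in HDs.
  assert (Hq : 0 < / (INR n * delta) <= delta).
  { split; [apply Rinv_0_lt_compat, Rmult_lt_0_compat; lra|].
    apply Rmult_le_reg_r with (INR n * delta); [apply Rmult_lt_0_compat; lra|].
    rewrite Rinv_l by (apply Rgt_not_eq, Rmult_lt_0_compat; lra).
    replace (delta * (INR n * delta)) with (delta^2 * INR n) by ring.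
    rewrite <- (Rinv_r (delta^2)) by (apply Rgt_not_eq, pow_lt; lra).
    apply Rmult_le_compat_l; [apply pow_le; lra | lra]. }
  assert (Hr4 : 1 <= r^4) by (apply pow_R1_Rle; lra).
  assert (HC32 : 4 <= c3^2) by nra.
  assert (HHN : 1 + ln (INR n) <= (2 + 2 * ln (2 * c3^2) + INR 4) * L).
  { apply ln_le_poly; [lra | exact HA | lra|].
    apply Rle_trans with ((c3 * r^2)^2 + 1).
    - eapply Rle_trans; [apply Hns|]. apply Rplus_le_compat_r. rewrite <- pow_inv.
      apply pow_incr. split; [left; apply Rinv_0_lt_compat; exact Hd | exact HdC].
    - replace ((c3 * r^2)^2) with (c3^2 * r^4) by ring.
      assert (1 * 1 <= c3^2 * r^4) by (apply Rmult_le_compat; lra). lra. }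
  assert (HHD : 1 + ln (INR D) <= (2 + 2 * ln (4 * c3) + INR 2) * L).
  { apply ln_le_poly; [lra | exact HA | lra|].
    rewrite Rmult_assoc. lra. }
  assert (HlnN : 0 <= ln (INR n)).
  { rewrite <- ln_1. apply ln_le; [lra|]. unfold n. apply (le_INR 1). lia. }
  assert (HlnD : 0 <= ln (INR D)).
  { rewrite <- ln_1. apply ln_le; [lra|]. unfold D. apply (le_INR 1). lia. }
  assert (HC6 : 0 < (2 + 2 * ln (2 * c3^2) + INR 4)).
  { assert (0 <= ln (2 * c3^2)) by (rewrite <- ln_1; apply ln_le; lra).
    pose proof (pos_INR 4). lra. }
  assert (HC7 : 0 < (2 + 2 * ln (4 * c3) + INR 2)).
  { assert (0 <= ln (4 * c3)) by (rewrite <- ln_1; apply ln_le; lra).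
    pose proof (pos_INR 2). lra. }
  assert (Hil0 : / (G / 2 / (f1 (2 * r))^3) <= 2 * C5^3 * F^3 / G).
  { replace (/ (G / 2 / (f1 (2 * r))^3)) with (2 * (f1 (2 * r))^3 / G) by (field; split; lra).
    apply Rmult_le_compat_r; [left; apply Rinv_0_lt_compat; lra|].
    rewrite Rmult_assoc. apply Rmult_le_compat_l; [lra|].
    rewrite <- Rpow_mult_distr. apply pow_incr. lra. }
  assert (Hil0' : 0 < / (G / 2 / (f1 (2 * r))^3)).
  { apply Rinv_0_lt_compat. repeat apply Rdiv_lt_0_compat; lra. }
  assert (HI : 0 <= J f phi r z).
  { destruct (Rle_dec 0 (J f phi r z)) as [H|H]; [exact H|]. exfalso.
    assert (z * J f phi r z < 0) by nra. lra. }
  eapply Rle_trans.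
  { apply (main_bound f finv Hdiff Hpos Hinv A ltac:(lra) HfA c2 Hreg phi mu Hphi (proj1 Hmu01) Hmu
             z n n1 D Hz1 ltac:(unfold n; lia) Hn1 (proj1 HDs)).
    - fold delta. lra.
    - fold delta. exact Hdelta1. }
  fold delta. change (RInt (window_sup phi (f r) (f (2 * r)) z) 0 1) with (J f phi r z).
  set (q := / (INR n * delta)) in *. set (w := 16 / INR n1) in *.
  set (il0 := / (G / 2 / (f1 (2 * r))^3)) in *.
  set (lam1 := c2 * G / F^3).
  assert (Hw0 : 0 < w) by (unfold w; apply Rdiv_lt_0_compat; lra).
  assert (HR0 : lam1 / (G / 2 / (f1 (2 * r))^3) <= ratio).
  { change (lam1 * il0 <= ratio).
    apply Rle_trans with (lam1 * (2 * C5^3 * F^3 / G)).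
    - apply Rmult_le_compat_l; [|exact Hil0]. unfold lam1. left. apply Rdiv_lt_0_compat; [nra | lra].
    - right. unfold lam1. field. split; lra. }
  assert (Hl1 : 0 < lam1) by (unfold lam1; apply Rdiv_lt_0_compat; [nra | lra]).
  assert (HR0' : 0 < lam1 / (G / 2 / (f1 (2 * r))^3)).
  { change (0 < lam1 * il0). apply Rmult_lt_0_compat; assumption. }
  apply assemble with (delta := delta); try lra.
  - replace (F * (lam1 * z)) with (c2 * (G / F^2 * z)) by (unfold lam1; field; lra).
    apply Rmult_le_compat_l; [lra|]. apply Rmult_le_compat_l; [|nra].
    left. apply Rdiv_lt_0_compat; [lra | apply pow_lt; lra].
  - exact range_length.
  - apply Rle_trans with (128 * delta * (2 * C5^3 * F^3 / G)).
    + apply Rmult_le_compat; lra.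
    + right. unfold delta. field. split; lra.
  - apply Rle_trans with (2 * C5^3 * F^3 / G * / F).
    + apply Rmult_le_compat_r; [left; apply Rinv_0_lt_compat; lra | exact Hil0].
    + replace (2 * C5^3 * F^3 / G * / F) with (2 * C5^3 * (F * (F / G))) by (field; split; lra).
      rewrite (Rmult_assoc (2 * C5^3) c3).
      apply Rmult_le_compat_l; [lra|].
      replace (c3 * (F * (r * L))) with (F * (c3 * (r * L))) by ring.
      apply Rmult_le_compat_l; [lra|].
      apply Rmult_le_reg_r with G; [exact HG|]. unfold Rdiv at 1. rewrite Rmult_assoc, Rinv_l by lra. lra.
Qed.

End Regime.

Theorem theorem1 (f finv : R -> R)
  (Hdiff : forall x, 0 < x ->
     ex_derive f x /\ ex_derive (Derive f) x /\ continuous (Derive (Derive f)) x)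
  (Hpos : forall x, 0 < x -> 0 < f x /\ 0 < Derive f x /\ 0 < Derive (Derive f) x)
  (Hreg : exists c1 c2, 1/2 <= c1 /\ 0 < c2 /\
     forall x y, 0 < x -> x <= y -> y <= 2 * x ->
       c1 * Derive (Derive f) x <= Derive (Derive f) y /\
       Derive (Derive f) y <= c2 * Derive (Derive f) x)
  (Hinv : forall x, 0 < x -> finv (f x) = x)
  (A0 : R) (HA0 : 2 <= A0) (HfA0 : 1 <= Derive f A0) :
  exists K : R, forall (phi : nat -> C), (forall m, Cmod (phi m) <= 1) ->
    forall (A : nat) (z : R), A0 <= INR A -> 0 < z ->
      / INR A * Cmod (Cminus
          (sum_between (fun n => phi (Z.to_nat (floorZ (f (INR n))))) (INR A) (2 * INR A))
          (sum_between (fun m => Cmult (phi m) (RtoC (Derive finv (INR m)))) (f (INR A)) (f (2 * INR A))))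
      <= K * (Derive (Derive f) (INR A) / (Derive f (INR A))^2 * z^2
              + Derive f (INR A) * (ln (INR A))^3 * J f phi (INR A) z).
Proof.
  destruct Hreg as [c1 [c2 [Hc1 [Hc2 Hreg']]]].
  assert (Hr : forall x y, 0 < x -> x <= y -> y <= 2 * x ->
    1 / 2 * Derive (Derive f) x <= Derive (Derive f) y /\
    Derive (Derive f) y <= c2 * Derive (Derive f) x).
  (* As f'' > 0, any c1 >= 1/2 may be lowered to 1/2. *)
  { intros x y Hx Hxy Hy. destruct (Hreg' x y Hx Hxy Hy) as [H1 H2]. split; [|exact H2].
    destruct (Hpos x Hx) as [_ [_ H3]]. nra. }
  pose proof (c2_ge_1 f Hpos c2 Hr) as Hc2'.
  (* Constant of the trivial regime: the factor 3 + C5 of [trivial_le] times the 16 c2 from mu <= 16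
     c2 (X + Y). *)
  set (K1 := (3 + (1 + 2 * c2 * c2)) * (16 * c2)).
  set (K2 := large_const f c2).
  exists (Rmax K1 K2). intros phi Hphi A z HA Hz.
  assert (HA2 : 2 <= INR A) by lra.
  pose proof (f1_mono f Hdiff Hpos A0 (INR A) ltac:(lra)) as HfA.
  destruct (Hpos (INR A) ltac:(lra)) as [_ [HF HG]].
  assert (Hab : 0 < f (INR A) < f (2 * INR A)).
  { split; [apply Hpos; lra | apply (f_incr f Hdiff Hpos); lra]. }
  (* Bounds every coefficient in the range, because a single coefficient is at most z J. *)
  set (mu := Rmin 1 (z * J f phi (INR A) z)).
  assert (HJ : 0 <= J f phi (INR A) z).
  { apply RInt_nonneg; [exact (window_sup_continuous phi _ _ z Hphi Hab Hz) |
      exact (window_sup_nonneg phi _ _ z Hphi Hab Hz) | lra]. }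
  assert (Hmu0 : 0 <= mu <= 1).
  { split; [apply Rmin_glb; [lra | apply Rmult_le_pos; lra] | apply Rmin_l]. }
  assert (HmuJ : mu <= z * J f phi (INR A) z) by apply Rmin_r.
  assert (Hmu : forall m, f (INR A) < INR m <= f (2 * INR A) -> Cmod (phi m) <= mu).
  { intros m Hm. apply Rmin_glb; [apply Hphi|].
    exact (Cmod_phi_le_integral phi _ _ z Hphi Hab Hz m Hm). }
  set (lhs := Cmod _). set (X := Derive (Derive f) (INR A) / _ * _). set (Y := _ * J f phi (INR A) z).
  assert (HX : 0 < X).
  { apply Rmult_lt_0_compat; [apply Rdiv_lt_0_compat; [lra | apply pow_lt; lra] | apply pow_lt; lra]. }
  assert (HY : 0 <= Y).
  { unfold Y. apply Rmult_le_pos; [apply Rmult_le_pos; [lra|] | exact HJ].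
    apply pow_le. pose proof (ln_ge_half (INR A) HA2). lra. }
  assert (HK1 : 0 <= 3 + (1 + 2 * c2 * c2)) by nra.
  assert (Hgoal : lhs <= INR A * (Rmax K1 K2 * (X + Y))).
  { assert (Hlift : forall K, K <= Rmax K1 K2 -> lhs <= INR A * (K * (X + Y)) ->
              lhs <= INR A * (Rmax K1 K2 * (X + Y))).
    { intros K HK H. eapply Rle_trans; [exact H|]. apply Rmult_le_compat_l; [lra|].
      apply Rmult_le_compat_r; lra. }
    assert (Htriv : mu <= 16 * c2 * (X + Y) -> lhs <= INR A * (K1 * (X + Y))).
    { intros H.
      eapply Rle_trans; [apply (trivial_le f finv Hdiff Hpos Hinv c2 Hr A phi mu HA2 ltac:(lra)
                                  Hmu Hmu0)|].
      apply Rmult_le_compat_l; [lra|]. 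
      replace (K1 * (X + Y)) with ((3 + (1 + 2 * c2 * c2)) * (16 * c2 * (X + Y))) by (unfold K1; ring).
      apply Rmult_le_compat_l; lra. }
    (* For small z the trivial bound is enough since mu <= z J <= 8 Y; for large X, in the next
       case, since mu <= 1 <= 16 c2 X. *)
    destruct (Rle_dec z (8 * (Derive f (INR A) * (ln (INR A))^3))) as [Hs|Hs].
    { apply (Hlift K1 (Rmax_l _ _)), Htriv.
      assert (z * J f phi (INR A) z <= 8 * Y).
      { unfold Y. rewrite <- Rmult_assoc. apply Rmult_le_compat_r; lra. }
      nra. }
    destruct (Rle_dec 1 (16 * c2 * X)) as [He|He].
    { apply (Hlift K1 (Rmax_l _ _)), Htriv. nra. }
    apply (Hlift K2 (Rmax_r _ _)).
    apply (large_le f finv Hdiff Hpos Hinv c2 Hr A phi mu z HA2 ltac:(lra) Hphi Hz Hmu Hmu0 HmuJ);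
      [lra | fold X; lra]. }
  apply Rmult_le_reg_l with (INR A); [lra|]. rewrite <- Rmult_assoc, Rinv_r, Rmult_1_l by lra.
  exact Hgoal.
Qed.
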